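(* For any convex polyhedron $P$ in $\mathbb{R}^3$, $$1<\frac{\mathrm{Diam}(P)}{\mathrm{Rad}(P)}\leq 2.$$ The second inequality is sharp, and equality in it is achieved by normal $\varepsilon$-thick tetrahedra for small $\varepsilon$ (that is, there is $\varepsilon_0>0$ such that $\mathrm{Diam}(T)=2\,\mathrm{Rad}(T)$ for every normal $\varepsilon$-thick tetrahedron $T$ with $0<\varepsilon<\varepsilon_0$).
   Context: A convex polyhedron (in particular a tetrahedron) is identified with its surface. For a convex surface $S\subset\mathbb{R}^3$, the intrinsic metric $\rho(x,y)$ is the length of a shortest path on $S$ joining $x,y\in S$; $\mathrm{Diam}(S)=\max_{x,y\in S}\rho(x,y)$ is the intrinsic diameter, $\mathrm{Rad}(S)=\min_{x\in S}\max_{y\in S}\rho(x,y)$ the intrinsic radius, and $\mathrm{diam}(S)=\max_{x,y\in S}\|x-y\|$ the extrinsic diameter. For $\varepsilon>0$, an $\varepsilon$-thick tetrahedron is a tetrahedron $T$ with one edge included in a ball of radius $\varepsilon\,\mathrm{diam}(T)$ centered at the midpoint of its longest edge. An $\varepsilon$-thick tetrahedron is normal if its longest edge and the edge opposite to it are, on the one hand, normal to each other and, on the other hand, both normal to the line through their midpoints. *)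

(* Defs.v *)
From HB Require Import structures.
From mathcomp Require Import all_boot all_order all_algebra.
From mathcomp Require Import all_classical all_reals all_analysis.

Set Implicit Arguments.
Unset Strict Implicit.
Unset Printing Implicit Defensive.

Import Order.TTheory GRing.Theory Num.Theory.
Import numFieldNormedType.Exports.

Local Open Scope classical_set_scope.
Local Open Scope ring_scope.

(* The library norm `|x| on row vectors is the sup norm, hence the explicit
   Euclidean one; both induce the same topology, so the library's closure,
   interior and continuity on 'rV[R]_3 are the usual ones. *)
Definition dotp (R : realType) (x y : 'rV[R]_3) : R :=
  \sum_(i < 3) x ord0 i * y ord0 i.

Definition enorm (R : realType) (x : 'rV[R]_3) : R := Num.sqrt (dotp x x).

Definition convex_hull (R : realType) (A : set 'rV[R]_3) : set 'rV[R]_3 :=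
  smallest (@convex_set R 'rV[R]_3) A.

Definition boundary (R : realType) (A : set 'rV[R]_3) : set 'rV[R]_3 :=
  closure A `\` interior A.

(* A convex polyhedron is its surface; the solid is required to be
   3-dimensional, which excludes flat (doubly covered) polygons. *)
Definition convex_polyhedron (R : realType) (P : set 'rV[R]_3) : Prop :=
  exists V : set 'rV[R]_3,
    [/\ finite_set V, interior (convex_hull V) !=set0
      & P = boundary (convex_hull V)].

Definition polygonal_sum (R : realType) (g : R -> 'rV[R]_3) (a b : R)
    (s : seq R) : R :=
  \sum_(0 <= n < size s) enorm (g (nth b (a :: s) n.+1) - g (nth b (a :: s) n)).

Definition curve_length (R : realType) (g : R -> 'rV[R]_3) (a b : R) : \bar R :=
  ereal_sup [set (polygonal_sum g a b s)%:E | s in itv_partition a b].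

Definition path_on (R : realType) (S : set 'rV[R]_3) (x y : 'rV[R]_3)
    (g : R -> 'rV[R]_3) : Prop :=
  [/\ {within `[0, 1], continuous g}, g 0 = x, g 1 = y
    & g @` `[0, 1] `<=` S].

(* All the metric quantities below take values in \bar R.  On the surface of a
   convex polyhedron the infima and suprema are attained and finite. *)
Definition intrinsic_dist (R : realType) (S : set 'rV[R]_3)
    (x y : 'rV[R]_3) : \bar R :=
  ereal_inf [set curve_length g 0 1 | g in path_on S x y].

Definition intrinsic_diam (R : realType) (S : set 'rV[R]_3) : \bar R :=
  ereal_sup [set intrinsic_dist S p.1 p.2 | p in S `*` S].

Definition intrinsic_radius (R : realType) (S : set 'rV[R]_3) : \bar R :=
  ereal_inf [set ereal_sup [set intrinsic_dist S x y | y in S] | x in S].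

Definition extrinsic_diam (R : realType) (S : set 'rV[R]_3) : \bar R :=
  ereal_sup [set (enorm (p.1 - p.2))%:E | p in S `*` S].

(* A tetrahedron is given by its four vertices. *)
Definition nondegenerate (R : realType) (v : 'I_4 -> 'rV[R]_3) : Prop :=
  row_free (\matrix_(i < 3) (v (lift ord0 i) - v ord0)).

Definition tetra_surface (R : realType) (v : 'I_4 -> 'rV[R]_3) :
    set 'rV[R]_3 :=
  boundary (convex_hull (range v)).

Definition longest_edge (R : realType) (v : 'I_4 -> 'rV[R]_3) (i j : 'I_4) :
    Prop :=
  i != j /\ forall k l : 'I_4, enorm (v k - v l) <= enorm (v i - v j).

Definition midpoint (R : realType) (x y : 'rV[R]_3) : 'rV[R]_3 :=
  2^-1 *: (x + y).

Definition thick_along (R : realType) (eps : R) (v : 'I_4 -> 'rV[R]_3)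
    (i j : 'I_4) : Prop :=
  exists k l : 'I_4, k != l /\
    forall x, convex_hull [set v k; v l] x ->
      ((enorm (x - midpoint (v i) (v j)))%:E
         <= eps%:E * extrinsic_diam (tetra_surface v))%E.

(* The two edges are v i v j and, on the two other vertices, v k v l. *)
Definition normal_along (R : realType) (v : 'I_4 -> 'rV[R]_3) (i j : 'I_4) :
    Prop :=
  exists k l : 'I_4, uniq [:: i; j; k; l] /\
    let m := midpoint (v k) (v l) - midpoint (v i) (v j) in
    [/\ dotp (v j - v i) (v l - v k) = 0,
        dotp (v j - v i) m = 0
      & dotp (v l - v k) m = 0].

Definition thick_tetrahedron (R : realType) (eps : R)
    (v : 'I_4 -> 'rV[R]_3) : Prop :=
  nondegenerate v /\
  exists i j : 'I_4, longest_edge v i j /\ thick_along eps v i j.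

(* For eps < 1/2 the longest edge of an eps-thick tetrahedron is unique and the
   edge close to its midpoint is the opposite one. *)
Definition normal_thick_tetrahedron (R : realType) (eps : R)
    (v : 'I_4 -> 'rV[R]_3) : Prop :=
  thick_tetrahedron eps v /\
  exists i j : 'I_4, longest_edge v i j /\ normal_along v i j.

(* Main.v *)
(* Diam <= 2 Rad is the triangle inequality. For the strict inequality, suppose that
   every point of the surface has a point at distance D = Diam.

   Shortest paths are chains of segments through distinct facets, straight in the
   unfolding along these facets. Moving x along a line inside a facet and following a
   partner y, one finds a pair (x, y) at distance D, both inside facets, which can be
   displaced to first order by nonzero (xi, eta) without changing the distance: if the
   partners of x stay on edges or at vertices, xi is confined to finitely many lines.
   First variation in the unfolding, together with the maximality of D, gives shortest
   paths from x to y inducing the same rotation B from the tangent plane at y to the one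
   at x (the rotation taking eta to xi), whose initial directions are not contained in a
   closed half-plane; three of them suffice, with w3 = a w1 + b w2 and a + b < 0.

   Paths with the same B and distinct directions meet only at x and y, since swapping
   their ends at another common point would give a shortest path with a bend. Hence they
   form a theta graph on a sphere, whose cyclic orders at x and at y must be opposite,
   while B preserves orientation: a contradiction. Instead of the Jordan curve theorem,
   integer crossing numbers of closed chains are used, seen from a generic interior point
   o: the difference of the winding numbers of two arcs is constant along the third one,
   and the sum of the three differences is minus a local sign at x, plus that sign at y.

   For thick tetrahedra every point of the surface is at distance at most L / 2 from the
   midpoint of the longest edge, of length L. *)
Require Import Defs.
From HB Require Import structures.
From mathcomp Require Import all_boot all_order all_algebra.
From mathcomp Require Import all_classical all_reals all_analysis.
From mathcomp Require Import ring lra zify.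

Set Implicit Arguments.
Unset Strict Implicit.
Unset Printing Implicit Defensive.

Import Order.TTheory GRing.Theory Num.Theory.
Import numFieldNormedType.Exports.
Local Open Scope classical_set_scope.
Local Open Scope ring_scope.

(** * Euclidean vectors *)

(** Distances are estimated from above and from below by different means. From above: the nearest
    point projection onto the solid is 1-Lipschitz, so a polygonal line outside the interior
    projects to a surface curve that is no longer. Legs may therefore be drawn in the plane of a
    facet beyond the facet itself, and a displaced path need not be followed on the surface. From
    below: a shortest path may be taken as a chain through pairwise distinct facets, so only
    finitely many facet sequences occur, and a chain through the same facets unfolds to a plane
    path, at least as long as the segment joining its ends. The upper bound has a quadratic error,
    the lower one has none; comparing the first at (xi, eta) with the second at lam (xi, eta), for
    lam large, absorbs the error. A pair that merely realises D would not give a common rotation B: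
    each shortest path has its own, and only those carrying eta to a nonzero xi agree. This is why a
    pair that can be displaced is looked for. *)

Notation "u ∙ v" := (dotp u v) (at level 39, left associativity) : ring_scope.

Section Euclid.
Variable R : realType.
Local Notation V := 'rV[R]_3.
Implicit Types u v w x y z : V.

Definition co0 v : R := v ord0 ord0.
Definition co1 v : R := v ord0 (lift ord0 ord0).
Definition co2 v : R := v ord0 (lift ord0 (lift ord0 ord0)).

Definition vec (a b c : R) : V := \row_i [:: a; b; c]`_i.

Definition cross u v : V :=
  vec (co1 u * co2 v - co2 u * co1 v) (co2 u * co0 v - co0 u * co2 v)
      (co0 u * co1 v - co1 u * co0 v).

Definition triple u v w : R := cross u v ∙ w.

Lemma dotpE u v : u ∙ v = co0 u * co0 v + co1 u * co1 v + co2 u * co2 v.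
Proof. by rewrite /dotp !big_ord_recl big_ord0 addr0 addrA. Qed.

Lemma coD u v : (co0 (u + v) = co0 u + co0 v) * (co1 (u + v) = co1 u + co1 v) *
  (co2 (u + v) = co2 u + co2 v).
Proof. by rewrite /co0 /co1 /co2 !mxE. Qed.

Lemma coN u : (co0 (- u) = - co0 u) * (co1 (- u) = - co1 u) *
  (co2 (- u) = - co2 u).
Proof. by rewrite /co0 /co1 /co2 !mxE. Qed.

Lemma coZ (a : R) u : (co0 (a *: u) = a * co0 u) * (co1 (a *: u) = a * co1 u) *
  (co2 (a *: u) = a * co2 u).
Proof. by rewrite /co0 /co1 /co2 !mxE. Qed.

Lemma co_0 : (co0 (0 : V) = 0) * (co1 (0 : V) = 0) * (co2 (0 : V) = 0).
Proof. by rewrite /co0 /co1 /co2 !mxE. Qed.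

Lemma co_vec a b c : (co0 (vec a b c) = a) * (co1 (vec a b c) = b) *
  (co2 (vec a b c) = c).
Proof. by rewrite /co0 /co1 /co2 !mxE. Qed.

Lemma vecP u v : co0 u = co0 v -> co1 u = co1 v -> co2 u = co2 v -> u = v.
Proof.
move=> h0 h1 h2; apply/rowP => i.
case: (unliftP ord0 i) => [j|] -> //; case: (unliftP ord0 j) => [k|] -> //.
by rewrite (ord1 k).
Qed.

Definition coE := (dotpE, co_vec, coD, coN, coZ, co_0).

Lemma dotpC u v : u ∙ v = v ∙ u. Proof. by rewrite !coE; ring. Qed.
Lemma dotpDl u v w : (u + v) ∙ w = u ∙ w + v ∙ w.
Proof. by rewrite !coE; ring. Qed.
Lemma dotpDr u v w : w ∙ (u + v) = w ∙ u + w ∙ v.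
Proof. by rewrite !coE; ring. Qed.
Lemma dotpNl u v : (- u) ∙ v = - (u ∙ v). Proof. by rewrite !coE; ring. Qed.
Lemma dotpNr u v : u ∙ (- v) = - (u ∙ v). Proof. by rewrite !coE; ring. Qed.
Lemma dotpZl a u v : (a *: u) ∙ v = a * (u ∙ v).
Proof. by rewrite !coE; ring. Qed.
Lemma dotpZr a u v : u ∙ (a *: v) = a * (u ∙ v).
Proof. by rewrite !coE; ring. Qed.
Lemma dotp0l v : 0 ∙ v = 0. Proof. by rewrite !coE; ring. Qed.
Lemma dotp0r v : v ∙ 0 = 0. Proof. by rewrite !coE; ring. Qed.

Definition dotE := (dotpDl, dotpDr, dotpNl, dotpNr, dotpZl, dotpZr, dotp0l,
  dotp0r).

Lemma dotpB u v w : w ∙ (u - v) = w ∙ u - w ∙ v. Proof. by rewrite !dotE. Qed.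

Lemma dotp_ge0 u : 0 <= u ∙ u. Proof. by rewrite !coE; nra. Qed.

Lemma dotp_eq0 u : (u ∙ u == 0) = (u == 0).
Proof.
apply/idP/eqP => [|->]; last by rewrite dotp0l.
rewrite dotpE => /eqP h.
have h0 : co0 u = 0 by apply/eqP; rewrite -sqrf_eq0 expr2; apply/eqP; nra.
have h1 : co1 u = 0 by apply/eqP; rewrite -sqrf_eq0 expr2; apply/eqP; nra.
have h2 : co2 u = 0 by apply/eqP; rewrite -sqrf_eq0 expr2; apply/eqP; nra.
by apply: vecP; rewrite ?co_0.
Qed.

Lemma dotp_gt0 u : (0 < u ∙ u) = (u != 0).
Proof. by rewrite lt_def dotp_ge0 andbT dotp_eq0. Qed.

Lemma enorm_ge0 u : 0 <= enorm u. Proof. exact: sqrtr_ge0. Qed.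

Lemma enorm_sqr u : enorm u ^+ 2 = u ∙ u.
Proof. by rewrite sqr_sqrtr ?dotp_ge0. Qed.

Lemma enorm_eq0 u : (enorm u == 0) = (u == 0).
Proof. by rewrite -sqrf_eq0 enorm_sqr dotp_eq0. Qed.

Lemma enorm_gt0 u : (0 < enorm u) = (u != 0).
Proof. by rewrite lt_def enorm_ge0 andbT enorm_eq0. Qed.

Lemma enorm0 : enorm (0 : V) = 0. Proof. by apply/eqP; rewrite enorm_eq0. Qed.

Lemma enormN u : enorm (- u) = enorm u.
Proof. by rewrite /enorm !dotE opprK. Qed.

Lemma enormB u v : enorm (u - v) = enorm (v - u).
Proof. by rewrite -enormN opprB. Qed.

Lemma enormZ a u : enorm (a *: u) = `|a| * enorm u.
Proof.
by rewrite /enorm !dotE mulrA -expr2 sqrtrM ?sqr_ge0// sqrtr_sqr.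
Qed.

Lemma cross_sqr u v : cross u v ∙ cross u v = (u ∙ u) * (v ∙ v) - (u ∙ v) ^+ 2.
Proof. by rewrite /cross !coE; ring. Qed.

Lemma cauchy_sqr u v : (u ∙ v) ^+ 2 <= (u ∙ u) * (v ∙ v).
Proof. by rewrite -subr_ge0 -cross_sqr dotp_ge0. Qed.

Lemma cauchy u v : u ∙ v <= enorm u * enorm v.
Proof.
apply: le_trans (ler_norm _) _.
by rewrite -sqrtrM ?dotp_ge0// -sqrtr_sqr ler_wsqrtr// cauchy_sqr.
Qed.

Lemma cauchyN u v : - (enorm u * enorm v) <= u ∙ v.
Proof. by rewrite lerNl -dotpNl -(enormN u) cauchy. Qed.

Lemma enorm_le u (a : R) : 0 <= a -> u ∙ u <= a ^+ 2 -> enorm u <= a.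
Proof. by move=> a0 h; rewrite -(ger0_norm a0) -sqrtr_sqr ler_wsqrtr. Qed.

Lemma enorm_triangle u v : enorm (u + v) <= enorm u + enorm v.
Proof.
apply: enorm_le; first by rewrite addr_ge0 ?enorm_ge0.
have := cauchy u v; rewrite sqrrD !enorm_sqr !dotE (dotpC v u); lra.
Qed.

Lemma enorm_dist3 x y z : enorm (x - z) <= enorm (x - y) + enorm (y - z).
Proof. by apply: le_trans (enorm_triangle _ _); rewrite addrA subrK. Qed.

Lemma enorm_lipschitz u v : `|enorm u - enorm v| <= enorm (u - v).
Proof.
rewrite ler_norml; apply/andP; split.
  by have := enorm_triangle (v - u) u; rewrite subrK (enormB v u); lra.
by have := enorm_triangle (u - v) v; rewrite subrK; lra.
Qed.

Lemma enorm_sum (I : Type) (r : seq I) (F : I -> V) :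
  enorm (\sum_(i <- r) F i) <= \sum_(i <- r) enorm (F i).
Proof.
elim/big_rec2: _ => [|i a u _ h]; first by rewrite enorm0.
by apply: le_trans (enorm_triangle _ _) _; rewrite lerD2l.
Qed.

(* The tangent-line bound for the norm: sqrt (1 + t) <= 1 + t / 2. *)
Lemma enorm_add_le u v : u != 0 ->
  enorm (u + v) <= enorm u + (u ∙ v) / enorm u + (v ∙ v) / (2 * enorm u).
Proof.
rewrite -enorm_gt0 => u0.
set a := enorm u in u0 *.
have aa : a * a = u ∙ u by rewrite -expr2 enorm_sqr.
have vv := dotp_ge0 v.
have h := dotp_ge0 (u + v); rewrite !dotE (dotpC v u) -aa in h.
have E : a + (u ∙ v) / a + (v ∙ v) / (2 * a)
  = (2 * (a * a) + 2 * (u ∙ v) + v ∙ v) / (2 * a).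
  by field; rewrite gt_eqF.
rewrite E; apply: enorm_le.
  by rewrite divr_ge0 ?mulr_ge0//; [nra|apply: ltW].
rewrite expr_div_n ler_pdivlMr; last by rewrite exprn_gt0 ?mulr_gt0.
rewrite !dotE (dotpC v u) -aa !expr2.
have := sqr_ge0 (2 * (u ∙ v) + v ∙ v); rewrite expr2; nra.
Qed.

Lemma norm_le_enorm u : `|u| <= enorm u.
Proof.
rewrite [`|u|]mx_normrE; apply/bigmax_leP; split => [|[i j] _ /=].
  exact: enorm_ge0.
rewrite (ord1 i) -sqrtr_sqr ler_wsqrtr//.
rewrite /dotp (bigD1 j)//= expr2 lerDl sumr_ge0// => k _.
by rewrite -expr2 sqr_ge0.
Qed.

Lemma enorm_le_norm u : enorm u <= 3 * `|u|.
Proof.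
have h i : `|u ord0 i| <= `|u|.
  rewrite [`|u|]mx_normrE; exact: (le_bigmax _ (fun ij => `|u ij.1 ij.2|) (ord0, i)).
have sq (a : R) : `|a| <= `|u| -> a * a <= `|u| * `|u|.
  by move=> ha; rewrite -expr2 -real_normK ?num_real// expr2 ler_pM.
apply: enorm_le; first by rewrite mulr_ge0.
rewrite dotpE.
have := sq _ (h ord0); have := sq _ (h (lift ord0 ord0)).
have := sq _ (h (lift ord0 (lift ord0 ord0))).
rewrite -/(co0 u) -/(co1 u) -/(co2 u) expr2; nra.
Qed.

Lemma nbhs_enorm (x : V) (A : set V) : nbhs x A <->
  exists2 r : R, 0 < r & forall y, enorm (y - x) < r -> A y.
Proof.
split=> [/nbhs_ballP[r /= r0 h]|[r r0 h]].
  exists r => // y yx; apply: h; rewrite -ball_normE /=.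
  by apply: le_lt_trans (norm_le_enorm _) _; rewrite enormB.
apply/nbhs_ballP; exists (r / 3); first by rewrite /= divr_gt0.
move=> y; rewrite -ball_normE /= => yx; apply: h.
apply: le_lt_trans (enorm_le_norm _) _.
by rewrite distrC mulrC -ltr_pdivlMr.
Qed.

Lemma lipschitz_continuous (f : V -> R) (C : R) :
  (forall x y, `|f x - f y| <= C * enorm (x - y)) -> continuous f.
Proof.
move=> hf x; apply/(@cvgrPdist_lt _ _ _ (nbhs x) (@nbhs_filter V x)) => e e0.
apply/nbhs_enorm; have C0 : 0 < `|C| + 1 by rewrite ltr_wpDl.
exists (e / (`|C| + 1)); first by rewrite divr_gt0.
move=> y yx; rewrite distrC; apply: le_lt_trans (hf _ _) _.
apply: (@le_lt_trans _ _ ((`|C| + 1) * enorm (y - x))).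
  by rewrite ler_wpM2r ?enorm_ge0// ler_wpDr// ler_norm.
by rewrite mulrC -ltr_pdivlMr.
Qed.

Lemma dotp_lipschitz u v w : `|v ∙ u - w ∙ u| <= enorm u * enorm (v - w).
Proof.
rewrite (_ : v ∙ u - w ∙ u = u ∙ (v - w)); last by rewrite !coE; ring.
by rewrite ler_norml cauchy cauchyN.
Qed.

Lemma continuous_dotp u : continuous (fun v : V => v ∙ u).
Proof. by apply: lipschitz_continuous => x y; exact: dotp_lipschitz. Qed.

Lemma continuous_enorm : continuous (@enorm R).
Proof.
by apply: (@lipschitz_continuous _ 1) => x y; rewrite mul1r enorm_lipschitz.
Qed.

Lemma cross_orthol u v : cross u v ∙ u = 0.
Proof. by rewrite /cross !coE; ring. Qed.
Lemma cross_orthor u v : cross u v ∙ v = 0.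
Proof. by rewrite /cross !coE; ring. Qed.
Lemma crossC u v : cross u v = - cross v u.
Proof. by apply: vecP; rewrite /cross !coE; ring. Qed.

(** Cramer's rule without division. *)
Lemma triple_expand u v w x :
  triple u v w *: x = triple x v w *: u + triple u x w *: v + triple u v x *: w.
Proof. by apply: vecP; rewrite /triple /cross !coE; ring. Qed.

(** Expansion in the reciprocal basis: x is determined by its inner products with u, v and w. *)
Lemma cross_triple u v w x : triple u v w *: x =
  (x ∙ u) *: cross v w + (x ∙ v) *: cross w u + (x ∙ w) *: cross u v.
Proof. by apply: vecP; rewrite /triple /cross !coE; ring. Qed.

End Euclid.

(** * Rectifiable curves *)

Section Curves.
Variable R : realType.
Local Notation V := 'rV[R]_3.
Implicit Types (g : R -> V) (S : set V) (x y z : V).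

Fixpoint psum g (a : R) (s : seq R) : R :=
  if s is t :: s' then enorm (g t - g a) + psum g t s' else 0.

Lemma polygonal_sumE g a b s : polygonal_sum g a b s = psum g a s.
Proof.
rewrite /polygonal_sum; elim: s a => [|t s ih] a; first by rewrite big_nil.
rewrite big_nat_recl //= -ih; congr (_ + _).
Qed.

Lemma psum_ge0 g a s : 0 <= psum g a s.
Proof. by elim: s a => //= t s ih a; rewrite addr_ge0 ?enorm_ge0. Qed.

Lemma psum_rcons g a s c :
  psum g a (rcons s c) = psum g a s + enorm (g c - g (last a s)).
Proof.
elim: s a => [|t s ih] a /=; first by rewrite addrC.
by rewrite ih addrA.
Qed.

Lemma curve_lengthP g a b (r : R) : (curve_length g a b <= r%:E)%E <->
  forall s, path <%R a s -> last a s = b -> psum g a s <= r.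
Proof.
split=> [h s ps ls|h].
  rewrite -lee_fin; apply: le_trans h; apply: ereal_sup_ubound => /=.
  by exists s; [split => //; rewrite ls|rewrite polygonal_sumE].
by apply: ge_ereal_sup => _ [s [ps /eqP ls] <-]; rewrite lee_fin polygonal_sumE h.
Qed.

Lemma within01P g : {within `[0, 1], continuous g} <->
  (forall x : R, 0 <= x <= 1 -> forall e : R, 0 < e -> exists2 d : R, 0 < d &
    forall y : R, 0 <= y <= 1 -> `|y - x| < d -> enorm (g y - g x) < e).
Proof.
split=> [/subspace_continuousP gc x x01 e e0|h].
  have : nbhs (g x) [set v | enorm (v - g x) < e].
    by apply/nbhs_enorm; exists e.
  have x01' : `[0, 1]%classic x by rewrite /= in_itv.
  move=> /(gc x x01').
  rewrite /nbhs /= /within /= => /nbhs_ballP[d /= d0 hd].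
  exists d => // y y01 yx; apply: (hd y); last by rewrite /= in_itv.
  by rewrite /ball /= distrC.
apply/subspace_continuousP => x /=; rewrite in_itv /= => x01 A /nbhs_enorm[e e0 hA].
have [d d0 hd] := h x x01 e e0.
apply/nbhs_ballP; exists d => //= y; rewrite /ball /= distrC => yx.
by rewrite in_itv /= => y01; apply: hA; apply: hd.
Qed.

(** A path of length at most r, instead of an infimum: this keeps extended reals out of the
    geometry. [intrinsic_dist_le] and [intrinsic_dist_lt] translate. *)
Definition conn S x y (r : R) :=
  exists2 g, path_on S x y g & (curve_length g 0 1 <= r%:E)%E.

Lemma conn_le S x y r r' : r <= r' -> conn S x y r -> conn S x y r'.
Proof.
by move=> rr [g pg lg]; exists g => //; apply: le_trans lg _; rewrite lee_fin.
Qed.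

Lemma conn_enorm S x y r : conn S x y r -> enorm (x - y) <= r.
Proof.
move=> [g [_ g0 g1 _] /curve_lengthP /(_ [:: 1])] /=.
by rewrite ltr01 /= addr0 g0 g1 enormB; apply.
Qed.

Lemma psum_opp g a b s : path <%R a s -> last a s = b ->
  exists s', [/\ path <%R (1 - b) s', last (1 - b) s' = 1 - a &
    psum (fun t => g (1 - t)) a s = psum g (1 - b) s'].
Proof.
elim: s a => [|t s ih] a /=; first by move=> _ <-; exists [::].
move=> /andP[at_ ps] ls; have [s' [ps' ls' e]] := ih _ ps ls.
exists (rcons s' (1 - a)); split.
- by rewrite rcons_path ps' ls' /=; rewrite ltrD2l ltrN2.
- by rewrite last_rcons.
by rewrite psum_rcons ls' e addrC enormB.
Qed.

Lemma conn_sym S x y r : conn S x y r -> conn S y x r.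
Proof.
move=> [g [gc g0 g1 gS] lg]; exists (fun t => g (1 - t)); first split.
- apply/within01P => t t01 e e0; move/within01P: gc => /(_ (1 - t) _ e e0).
  case; first by lra.
  move=> d d0 h; exists d => // u u01 ut; apply: h; first by lra.
  by rewrite (_ : 1 - u - (1 - t) = - (u - t)) ?normrN//; lra.
- by rewrite subr0.
- by rewrite subrr.
- move=> v [t /=]; rewrite in_itv /= => t01 <-; apply: gS; exists (1 - t) => //=.
  by rewrite in_itv /=; lra.
apply/curve_lengthP => s ps ls; have [s' []] := psum_opp g ps ls.
rewrite subrr subr0 => ps' ls' ->.
by move/curve_lengthP: lg; apply.
Qed.

Definition concat (g1 g2 : R -> V) (t : R) : V :=
  if t <= 2^-1 then g1 (2 * t) else g2 (2 * t - 1).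

Lemma psum_concatR g1 g2 a s : 2^-1 < a -> path <%R a s ->
  psum (concat g1 g2) a s = psum g2 (2 * a - 1) [seq 2 * t - 1 | t <- s].
Proof.
elim: s a => //= t s ih a ha /andP[at_ ps].
have ht : 2^-1 < t by apply: lt_trans at_.
by rewrite ih// /concat !leNgt ht ha.
Qed.

(** Inserting the junction time 1/2 into the partition can only increase the sum, by the triangle
    inequality. *)
Lemma psum_concat g1 g2 a s : g1 1 = g2 0 -> 0 <= a -> a <= 2^-1 ->
  path <%R a s -> last a s = 1 -> exists s1 s2,
  [/\ path <%R (2 * a) s1, last (2 * a) s1 = 1, path <%R 0 s2, last 0 s2 = 1 &
    psum (concat g1 g2) a s <= psum g1 (2 * a) s1 + psum g2 0 s2].
Proof.
move=> g12; elim: s a => [|t s ih] a a0 ha /=; first by lra.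
move=> /andP[at_ ps] ls.
have ca : concat g1 g2 a = g1 (2 * a) by rewrite /concat ha.
have [ht|ht] := leP t 2^-1.
  have ct : concat g1 g2 t = g1 (2 * t) by rewrite /concat ht.
  have [|s1 [s2 [p1 l1 p2 l2 h]]] := ih t _ ht ps ls; first by lra.
  exists (2 * t :: s1), s2; split => //=.
    by rewrite p1 andbT ltr_pM2l.
  by rewrite ct ca -addrA lerD2l.
have ct : concat g1 g2 t = g2 (2 * t - 1) by rewrite /concat leNgt ht.
rewrite psum_concatR// ct ca.
(* Partitions are strictly increasing, so when a is already 1/2 the part on [g1] must be empty. *)
have E : exists s1, [/\ path <%R (2 * a) s1, last (2 * a) s1 = 1 &
    enorm (g1 1 - g1 (2 * a)) <= psum g1 (2 * a) s1].
  have [a12|a12] := ltP a (2^-1).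
    by exists [:: 1] => /=; split; rewrite ?andbT ?addr0//; lra.
  have -> : 2 * a = 1 by lra.
  by exists [::]; split; rewrite //= subrr enorm0.
have [s1 [p1 l1 h1]] := E.
exists s1, (2 * t - 1 :: [seq 2 * u - 1 | u <- s]); split => //=.
- rewrite (_ : 0 < 2 * t - 1) /=; last by lra.
  apply: (@homo_path _ _ (fun u => 2 * u - 1) <%R <%R) ps => u v uv.
  by rewrite ltrD2r ltr_pM2l.
- by rewrite (last_map (fun u => 2 * u - 1)) ls; lra.
rewrite addrA lerD2r; apply: le_trans (lerD h1 (lexx _)).
by rewrite -g12 [leRHS]addrC; apply: enorm_dist3.
Qed.

Lemma conn_trans S x y z r r' : conn S x y r -> conn S y z r' ->
  conn S x z (r + r').
Proof.
move=> [g1 [c1 g10 g11 S1] l1] [g2 [c2 g20 g21 S2] l2].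
have g12 : g1 1 = g2 0 by rewrite g11 g20.
exists (concat g1 g2); first split.
- apply/within01P => t t01 e e0.
  have L u : 0 <= u <= 2^-1 -> exists2 d, 0 < d & forall v, 0 <= v <= 2^-1 ->
      `|v - u| < d -> enorm (g1 (2 * v) - g1 (2 * u)) < e.
    move=> u01; move/within01P: c1 => /(_ (2 * u) _ e e0)[|d d0 h]; first by lra.
    exists (d / 2); first by rewrite divr_gt0.
    move=> v v01 uv; apply: h; first by lra.
    by rewrite -mulrBr normrM ger0_norm// mulrC -ltr_pdivlMr.
  have Q u : 2^-1 <= u <= 1 -> exists2 d, 0 < d & forall v, 2^-1 <= v <= 1 ->
      `|v - u| < d -> enorm (g2 (2 * v - 1) - g2 (2 * u - 1)) < e.
    move=> u01; move/within01P: c2 => /(_ (2 * u - 1) _ e e0)[|d d0 h]; first by lra.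
    exists (d / 2); first by rewrite divr_gt0.
    move=> v v01 uv; apply: h; first by lra.
    rewrite (_ : 2 * v - 1 - (2 * u - 1) = 2 * (v - u)); last by ring.
    by rewrite normrM ger0_norm// mulrC -ltr_pdivlMr.
  have [tl|tg|te] := ltrgtP t (2^-1).
  + have [|d d0 h] := L t; first by lra.
    exists (Num.min d (2^-1 - t)); first by rewrite lt_min d0 subr_gt0.
    move=> v v01; rewrite lt_min => /andP[vd]; rewrite ltr_norml => /andP[_ v2].
    have v12 : v <= 2^-1 by lra.
    rewrite /concat v12 (ltW tl); apply: h => //; lra.
  + have [|d d0 h] := Q t; first by lra.
    exists (Num.min d (t - 2^-1)); first by rewrite lt_min d0 subr_gt0.
    move=> v v01; rewrite lt_min => /andP[vd]; rewrite ltr_norml => /andP[v2 _].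
    have v12 : 2^-1 < v by lra.
    by rewrite /concat !leNgt v12 tg /=; apply: h => //; lra.
  have [|d d0 h] := L t; first by lra.
  have [|d' d0' h'] := Q t; first by lra.
  exists (Num.min d d'); first by rewrite lt_min d0.
  move=> v v01; rewrite lt_min => /andP[vd vd'].
  rewrite /concat te lexx -te; have [v12|v12] := leP v t.
    by apply: h => //; lra.
  rewrite (_ : g1 (2 * t) = g2 (2 * t - 1)); first by apply: h' => //; lra.
  by rewrite te (_ : 2 * 2^-1 = 1) ?subrr//; lra.
- by rewrite /concat ifT ?mulr0//; lra.
- rewrite /concat ifF; last by apply/negbTE; rewrite -ltNge; lra.
  by rewrite -g21; congr g2; lra.
- move=> v [t /=]; rewrite in_itv /= => t01 <-; rewrite /concat; case: ifPn => ht.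
    by apply: S1; exists (2 * t) => //=; rewrite in_itv /=; lra.
  by apply: S2; exists (2 * t - 1) => //=; rewrite in_itv /=; lra.
apply/curve_lengthP => s ps ls.
have [||s1 [s2 [p1 q1 p2 q2 h]]] := psum_concat g12 _ _ ps ls; [by []|by lra|].
move: p1 q1 h; rewrite mulr0 => p1 q1 h; apply: le_trans h _; apply: lerD.
  by move/curve_lengthP: l1; apply.
by move/curve_lengthP: l2; apply.
Qed.

Lemma psum_lipschitz g (L a b : R) s :
  (forall u v, a <= u -> u <= v -> v <= b -> enorm (g v - g u) <= L * (v - u)) ->
  path <%R a s -> last a s = b -> psum g a s <= L * (b - a).
Proof.
elim: s a => [|t s ih] a h /=; first by move=> _ ->; rewrite subrr mulr0.
move=> /andP[at_ ps] ls.
have tb : t <= b.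
  have := order_path_min (@lt_trans _ _) ps; rewrite -ls.
  move=> /allP /(_ (last t s)); case: (s) => //= t' s' H.
  by apply: ltW; apply: H; rewrite mem_last.
have -> : L * (b - a) = L * (t - a) + L * (b - t) by ring.
apply: lerD; first by apply: h => //; apply: ltW.
by apply: ih => // u v tu uv vb; apply: h => //; apply: le_trans tu; apply: ltW.
Qed.

End Curves.

(** * Nearest point projection *)

Section ConvexBody.
Variable R : realType.
Local Notation V := 'rV[R]_3.
Variable K : set V.
Hypothesis K_compact : compact K.
Hypothesis K_convex : forall x y (t : R), 0 <= t <= 1 -> K x -> K y ->
  K (x + t *: (y - x)).
Hypothesis K_neq0 : K !=set0.
Implicit Types (x y z p q : V).

Lemma nearest_exists x : exists p, K p /\
  forall q, K q -> enorm (x - p) <= enorm (x - q).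
Proof.
have fc : {within K, continuous (fun p => enorm (x - p))}.
  apply: continuous_subspaceT.
  apply: (@lipschitz_continuous _ _ 1) => u v; rewrite mul1r.
  apply: le_trans (enorm_lipschitz _ _) _.
  by rewrite (_ : x - u - (x - v) = v - u) 1?enormB//; apply: vecP; rewrite !coE; ring.
have [c cK h] := compact_EVT_min K_neq0 K_compact fc.
by exists c; split=> [|q Kq]; [exact: set_mem|apply: h; exact: mem_set].
Qed.

Definition nproj x := sval (cid (nearest_exists x)).

Lemma nproj_in x : K (nproj x).
Proof. by rewrite /nproj; case: cid => p []. Qed.

Lemma nproj_le x q : K q -> enorm (x - nproj x) <= enorm (x - q).
Proof. by rewrite /nproj; case: cid => p [Kp h] /=; apply: h. Qed.

Lemma nproj_id x : K x -> nproj x = x.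
Proof.
move=> Kx; have := nproj_le x Kx; rewrite subrr enorm0 => h.
apply/eqP; rewrite eq_sym -subr_eq0 -enorm_eq0; apply/eqP/le_anti.
by rewrite h enorm_ge0.
Qed.

(** The variational inequality: at an acute angle, a small move from the projection towards q would
    come closer to x. *)
Lemma nproj_obtuse x q : K q -> (x - nproj x) ∙ (q - nproj x) <= 0.
Proof.
move=> Kq; set p := nproj x; set a := _ ∙ _; rewrite leNgt; apply/negP => a0.
set d := q - p; have d0 : 0 < d ∙ d.
  rewrite dotp_gt0; apply/eqP => e; move: a0.
  by rewrite /a -/d e dotp0r ltxx.
(* The squared distance changes by - 2 t a + t^2 (d ∙ d), which is negative as soon as t (d ∙ d) <=
   a. *)
pose t := Num.min 1 (a / (d ∙ d)).
have t0 : 0 < t by rewrite lt_min ltr01 divr_gt0.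
have t1 : t <= 1 by rewrite ge_min lexx.
have ta : t * (d ∙ d) <= a by rewrite -ler_pdivlMr// ge_min lexx orbT.
have Kt : K (p + t *: d) by apply: K_convex => //; [lra|exact: nproj_in].
have := nproj_le x Kt; rewrite -/p -(ler_pXn2r (n := 2)) ?nnegrE ?enorm_ge0//.
rewrite !enorm_sqr; apply/negP; rewrite -ltNge.
have -> : (x - (p + t *: d)) ∙ (x - (p + t *: d)) =
   (x - p) ∙ (x - p) - 2 * t * a + t * t * (d ∙ d).
  by rewrite /a -/d !coE; ring.
nra.
Qed.

(** Sum of the two obtuse angle inequalities, then Cauchy-Schwarz. *)
Lemma nproj_lipschitz x y : enorm (nproj x - nproj y) <= enorm (x - y).
Proof.
set d := nproj x - nproj y.
have h : d ∙ d <= (x - y) ∙ d.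
  have h1 := nproj_obtuse x (nproj_in y); have h2 := nproj_obtuse y (nproj_in x).
  have : (x - y) ∙ d - d ∙ d = - ((x - nproj x) ∙ (nproj y - nproj x))
     - ((y - nproj y) ∙ (nproj x - nproj y)) by rewrite /d !coE; ring.
  by lra.
have [->|d0] := eqVneq d 0; first by rewrite enorm0 enorm_ge0.
rewrite -enorm_gt0 in d0; rewrite -(ler_pM2r d0) -expr2 enorm_sqr.
by apply: le_trans h _; exact: cauchy.
Qed.

Lemma K_closed : closed K.
Proof. by apply: compact_closed => //; exact: norm_hausdorff. Qed.

Lemma boundaryE x : boundary K x <-> K x /\ ~ interior K x.
Proof. by rewrite /boundary -((closure_id K).1 K_closed). Qed.

(** From an interior projection one could still move towards x inside K, against [nproj_obtuse]. *)
Lemma nproj_boundary x : ~ interior K x -> boundary K (nproj x).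
Proof.
move=> nx; apply/boundaryE; split; first exact: nproj_in.
move=> /nbhs_enorm[r r0 h].
have [e|ne] := eqVneq (x - nproj x) 0.
  have xp : x = nproj x by apply/eqP; rewrite -subr_eq0 e.
  apply: nx; apply/nbhs_enorm; exists r => //; move: h; rewrite -xp.
  by move=> h y /h.
have d0 := ne; rewrite -enorm_gt0 in d0; set d := x - nproj x in ne d0 *.
pose t := Num.min 1 (r / (2 * enorm d)).
have t0 : 0 < t by rewrite lt_min ltr01 divr_gt0// mulr_gt0.
have t1 : t <= 1 by rewrite ge_min lexx.
have td : t * (2 * enorm d) <= r.
  by rewrite -ler_pdivlMr ?mulr_gt0// ge_min lexx orbT.
have Kq : K (nproj x + t *: d).
  by apply: h; rewrite addrC addKr enormZ gtr0_norm//; nra.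
have := nproj_obtuse x Kq.
rewrite -/d addrC addKr dotpZr leNgt mulr_gt0//.
by rewrite dotp_gt0.
Qed.

Definition supports (n : V) (h : R) := n != 0 /\ forall x, K x -> n ∙ x <= h.

Lemma supports_not_interior n h x : supports n h -> h <= n ∙ x -> ~ interior K x.
Proof.
move=> [n0 Kh] hx /nbhs_enorm[r r0 hr].
have e0 : 0 < enorm n by rewrite enorm_gt0.
have t0 : 0 < r / (2 * enorm n) by rewrite divr_gt0 ?mulr_gt0.
have : K (x + (r / (2 * enorm n)) *: n).
  apply: hr; rewrite addrC addKr enormZ gtr0_norm//.
  have -> : r / (2 * enorm n) * enorm n = r / 2 by field; rewrite gt_eqF.
  by lra.
move=> /Kh; rewrite !dotE; apply/negP; rewrite -ltNge.
have := mulr_gt0 t0 (_ : 0 < n ∙ n); rewrite dotp_gt0 n0 => /(_ isT); lra.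
Qed.

(** The source of the upper bounds on intrinsic distances: the projection of a segment that avoids
    the interior is a curve on the boundary, no longer than the segment. *)
Lemma conn_exterior p q (r : R) :
  (forall t, 0 <= t <= 1 -> ~ interior K (p + t *: (q - p))) ->
  enorm (p - q) <= r ->
  conn (boundary K) (nproj p) (nproj q) r.
Proof.
move=> ext pq; apply: conn_le pq _.
pose c (t : R) := p + t *: (q - p).
have cL u v : enorm (nproj (c v) - nproj (c u)) <= enorm (p - q) * `|v - u|.
  apply: le_trans (nproj_lipschitz _ _) _.
  rewrite (_ : c v - c u = (v - u) *: (q - p)).
    by rewrite enormZ mulrC (enormB q).
  by apply: vecP; rewrite /c !coE; ring.
exists (fun t => nproj (c t)); first split.
- apply/within01P => x x01 e e0; exists (e / (enorm (p - q) + 1)).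
    by rewrite divr_gt0// ltr_wpDl ?enorm_ge0.
  move=> y y01; rewrite ltr_pdivlMr; last by rewrite ltr_wpDl ?enorm_ge0.
  move=> h; apply: le_lt_trans (cL _ _) _; apply: le_lt_trans h.
  by rewrite mulrC ler_wpM2l// lerDl.
- by rewrite /c scale0r addr0.
- by rewrite /c scale1r addrC subrK.
- move=> v [t /=]; rewrite in_itv /= => t01 <-.
  by apply: nproj_boundary; apply: ext.
apply/curve_lengthP => s ps ls; apply: le_trans (psum_lipschitz _ ps ls) _.
  by move=> u v _ uv _; apply: le_trans (cL _ _) _; rewrite ger0_norm ?subr_ge0.
by rewrite subr0 mulr1.
Qed.

Lemma conn_halfspace n h p q r : supports n h -> h <= n ∙ p -> h <= n ∙ q ->
  enorm (p - q) <= r -> conn (boundary K) (nproj p) (nproj q) r.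
Proof.
move=> s hp hq; apply: conn_exterior => t t01.
by apply: (supports_not_interior s); rewrite !dotE; nra.
Qed.

Lemma supports_boundary n h x : supports n h -> K x -> h <= n ∙ x -> boundary K x.
Proof.
by move=> s Kx hx; apply/boundaryE; split => //; apply: (supports_not_interior s).
Qed.

End ConvexBody.

(** * Intrinsic distance as a real number *)

Section Intrinsic.
Variable R : realType.
Local Notation V := 'rV[R]_3.
Variable S : set V.
Implicit Types x y z : V.
Local Open Scope ereal_scope.

Lemma curve_length_ge0 (g : R -> V) : 0 <= curve_length g 0 1.
Proof.
apply: le_trans (_ : (psum g 0 [:: 1%R])%:E <= _).
  by rewrite lee_fin psum_ge0.
apply: ereal_sup_ubound => /=; exists [:: 1%R]; last by rewrite polygonal_sumE.
by split; rewrite /= ?ltr01.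
Qed.

Lemma intrinsic_dist_ge0 x y : 0 <= intrinsic_dist S x y.
Proof. by apply: le_ereal_inf_tmp => _ [g _ <-]; exact: curve_length_ge0. Qed.

Lemma intrinsic_dist_le x y r : conn S x y r -> intrinsic_dist S x y <= r%:E.
Proof. by move=> [g pg lg]; apply: le_trans lg; apply: ereal_inf_lbound; exists g. Qed.

Lemma intrinsic_dist_lt x y r : intrinsic_dist S x y < r%:E -> conn S x y r.
Proof.
move=> /ereal_inf_lt[_ [g pg <-]] h; exists g => //; exact: ltW.
Qed.

(** [fine] sends infinite values to 0; by [rhoE] the value is faithful as soon as one rectifiable
    path exists. *)
Definition rho x y : R := fine (intrinsic_dist S x y).

Lemma rhoE x y r : conn S x y r -> intrinsic_dist S x y = (rho x y)%:E.
Proof.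
move=> /intrinsic_dist_le h; rewrite /rho fineK// fin_numE.
rewrite -ltey (le_lt_trans h (ltry _)) andbT.
by rewrite -ltNye (lt_le_trans (ltNyr 0) (intrinsic_dist_ge0 _ _)).
Qed.

Lemma rho_le x y r : conn S x y r -> (rho x y <= r)%R.
Proof. by move=> h; rewrite -lee_fin -(rhoE h) intrinsic_dist_le. Qed.

Lemma rho_conn x y r e : conn S x y r -> (0 < e)%R -> conn S x y (rho x y + e).
Proof.
by move=> h e0; apply: intrinsic_dist_lt; rewrite (rhoE h) lte_fin ltrDl.
Qed.

Lemma le_rho x y r : conn S x y r ->
  (enorm (x - y) <= rho x y)%R.
Proof.
move=> h; apply/ler_addgt0Pr => e e0; exact: conn_enorm (rho_conn h e0).
Qed.

Lemma rho_ge0 x y : (0 <= rho x y)%R.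
Proof. by apply: fine_ge0; exact: intrinsic_dist_ge0. Qed.

Lemma rho_sym x y r : conn S x y r -> rho y x = rho x y.
Proof.
have H x' y' r' : conn S x' y' r' -> (rho y' x' <= rho x' y')%R.
  move=> h; apply/ler_addgt0Pr => e e0.
  by apply: rho_le; apply: conn_sym; exact: rho_conn h e0.
by move=> h; apply/le_anti; rewrite (H _ _ _ h) (H _ _ _ (conn_sym h)).
Qed.

Lemma rho_triangle x y z r r' : conn S x y r -> conn S y z r' ->
  (rho x z <= rho x y + rho y z)%R.
Proof.
move=> h h'; apply/ler_addgt0Pr => e e0.
have e2 : (0 < e / 2)%R by rewrite divr_gt0.
have := conn_trans (rho_conn h e2) (rho_conn h' e2).
by move=> /rho_le; rewrite (_ : _ + _ = rho x y + rho y z + e)%R; last by field.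
Qed.

End Intrinsic.

Section TopologyHelp.
Variables (R : realType) (T : topologicalType).

Lemma continuous_sum (U : normedModType R) (J : Type) (r : seq J) (F : J -> T -> U) :
  (forall j, continuous (F j)) -> continuous (fun l => \sum_(j <- r) F j l).
Proof.
move=> Fc; elim: r => [|j r ih].
  rewrite (_ : (fun _ => _) = cst 0); first exact: cst_continuous.
  by apply/funext => l; rewrite big_nil.
rewrite (_ : (fun _ => _) = fun l => F j l + \sum_(j <- r) F j l).
  by move=> l; apply: cvgD; [exact: Fc|exact: ih].
by apply/funext => l; rewrite big_cons.
Qed.

Lemma continuous_scalel (U : normedModType R) (f : T -> R) (a : U) :
  continuous f -> continuous (fun l => f l *: a).
Proof. by move=> fc l; apply: cvgZr_tmp; exact: fc. Qed.

Lemma continuous_sub (U : normedModType R) (f g : T -> U) :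
  continuous f -> continuous g -> continuous (fun x => f x - g x).
Proof. by move=> fc gc x; apply: cvgB; [exact: fc|exact: gc]. Qed.

Lemma continuous_add (U : normedModType R) (f g : T -> U) :
  continuous f -> continuous g -> continuous (fun x => f x + g x).
Proof. by move=> fc gc x; apply: cvgD; [exact: fc|exact: gc]. Qed.

Lemma continuous_norm (f : T -> R) : continuous f -> continuous (fun x => `|f x|).
Proof. by move=> fc x; apply: (@cvg_norm _ R^o); exact: fc. Qed.

End TopologyHelp.

(** * Convex hulls of finite families *)

Section Hull.
Variable R : realType.
Local Notation V := 'rV[R]_3.
Implicit Types (A : set V) (x y : V).

Lemma convex_setE A : @convex_set R V A <->
  (forall x y (t : R), 0 <= t <= 1 -> A x -> A y -> A (x + t *: (y - x))).
Proof.
split=> [cA x y t /andP[t0 t1] Ax Ay|cA x y l /set_mem Ax /set_mem Ay].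
  have /set_mem := cA y x (Itv01 t0 t1) (mem_set Ay) (mem_set Ax).
  congr A; rewrite /conv /= /unstable.onem; apply: vecP; rewrite !coE; ring.
apply/mem_set; have := cA y x l%:num; rewrite ge0 le1 => /(_ isT Ay Ax).
congr A; rewrite /conv /= /unstable.onem; apply: vecP; rewrite !coE; ring.
Qed.

Lemma convex_hull_convex A x y (t : R) : 0 <= t <= 1 -> convex_hull A x ->
  convex_hull A y -> convex_hull A (x + t *: (y - x)).
Proof.
move=> t01 hx hy B [cB AB]; move/convex_setE: (cB); apply => //.
  by apply: hx.
by apply: hy.
Qed.

Lemma sub_convex_hull A : A `<=` convex_hull A.
Proof. by move=> x Ax B [_]; apply. Qed.

Lemma convex_hull_min A B : @convex_set R V B -> A `<=` B -> convex_hull A `<=` B.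
Proof. by move=> cB AB x; apply. Qed.

Definition comb (I : finType) (v : I -> V) (l : I -> R) : V :=
  \sum_i l i *: v i.

(** Induction on the list with the normalised partial combination; the first alternative covers
    partial sums that vanish and cannot be normalised. *)
Lemma convex_comb (I : eqType) (B : set V) (v : I -> V) (l : I -> R) (r : seq I) :
  @convex_set R V B -> (forall i, B (v i)) -> (forall i, 0 <= l i) ->
  \sum_(i <- r) l i = 1 -> B (\sum_(i <- r) l i *: v i).
Proof.
move=> /convex_setE cB Bv l0 l1.
suff H : \sum_(i <- r) l i = 0 \/
    0 < \sum_(i <- r) l i /\
    B ((\sum_(i <- r) l i)^-1 *: \sum_(i <- r) l i *: v i).
  by case: H => [|[_]]; rewrite l1 ?invr1 ?scale1r// => /eqP; rewrite oner_eq0.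
elim: r {l1} => [|i r ih]; first by rewrite big_nil; left.
rewrite !big_cons; set S := \sum_(j <- r) l j in ih *.
set W := \sum_(j <- r) _ in ih *.
have S0 : 0 <= S by rewrite sumr_ge0.
have [li|li] := eqVneq (l i) 0.
  by rewrite li scale0r !add0r.
have lp : 0 < l i by rewrite lt_def li l0.
right; split; first by rewrite ltr_wpDr.
case: ih => [e|[Sp BW]].
  have W0 : W = 0.
    rewrite /W big1_seq// => j /andP[_ jr].
    suff -> : l j = 0 by rewrite scale0r.
    apply/le_anti; rewrite l0 andbT -e /S.
    elim: (r) jr => //= k s ih; rewrite inE big_cons => /orP[/eqP ->|js].
      by rewrite lerDl sumr_ge0.
    by apply: le_trans (ih js) _; rewrite lerDr.
  by rewrite W0 e !addr0 scalerA mulVf// scale1r.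
have := cB (v i) (S^-1 *: W) (S / (l i + S)) _ (Bv i) BW.
rewrite divr_ge0 ?addr_ge0// ler_pdivrMr ?ltr_wpDr// mul1r lerDr l0 => /(_ isT).
congr B.
have Sn : S != 0 by rewrite gt_eqF.
have ln : l i + S != 0 by rewrite gt_eqF// ltr_wpDr.
by apply: vecP; rewrite !coE; field; rewrite Sn ln.
Qed.

Lemma convex_hullE (I : finType) (v : I -> V) x :
  convex_hull (range v) x <->
  exists l : I -> R, [/\ forall i, 0 <= l i, \sum_i l i = 1 & x = comb v l].
Proof.
split=> [|[l [l0 l1 ->]]]; last first.
  apply: convex_comb => //; last by move=> i; apply: sub_convex_hull; exists i.
  by apply/convex_setE => y z t; apply: convex_hull_convex.
apply: (@convex_hull_min _ [set x | exists l : I -> R, _]); last first.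
  move=> _ [i _ <-]; exists (fun j => (j == i)%:R); split.
  - by move=> j; rewrite ler0n.
  - by rewrite (bigD1 i)//= eqxx big1 ?addr0// => j /negbTE ->.
  rewrite /comb (bigD1 i)//= eqxx scale1r big1 ?addr0// => j /negbTE ->.
  by rewrite scale0r.
apply/convex_setE => _ _ t /andP[t0 t1] [l [l0 l1 ->]] [m [m0 m1 ->]].
exists (fun i => l i + t * (m i - l i)); split.
- by move=> i; have := l0 i; have := m0 i; nra.
- rewrite big_split /= l1 -mulr_sumr sumrB l1 m1; ring.
rewrite /comb -sumrB scaler_sumr -big_split /=; apply: eq_bigr => i _.
by rewrite scalerDl -scalerA scalerBl.
Qed.

(** The hull is the continuous image of the standard simplex, whose points are written as row
    vectors so that [rV_compact] applies. *)
Lemma convex_hull_compact (I : finType) (v : I -> V) :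
  compact (convex_hull (range v)).
Proof.
pose f (l : 'rV[R]_#|I|) : V := \sum_i l ord0 (enum_rank i) *: v i.
pose D : set 'rV[R]_#|I| :=
  [set l | forall i, `[0, 1]%classic (l ord0 i)] `&` [set l | \sum_i l ord0 i = 1].
have -> : convex_hull (range v) = f @` D.
  apply/seteqP; split=> x.
    move=> /convex_hullE[l [l0 l1 ->]].
    exists (\row_k l (enum_val k)); last first.
      by apply: eq_bigr => i _; rewrite mxE enum_rankK.
    split=> [k|] /=.
      rewrite in_itv /= mxE l0 /= -l1 (bigD1 (enum_val k))//= lerDl sumr_ge0//.
    rewrite -l1 (reindex_onto (fun k : 'I_#|I| => enum_val k) enum_rank) /=; last first.
      by move=> i _; rewrite enum_rankK.
    by apply: eq_big => [k|k _]; rewrite ?mxE ?enum_valK ?eqxx.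
  move=> [l [l01 l1] <-]; apply/convex_hullE.
  exists (fun i => l ord0 (enum_rank i)); split => //.
    by move=> i; have := l01 (enum_rank i); rewrite /= in_itv /= => /andP[].
  rewrite -l1 (reindex_onto enum_rank (fun k : 'I_#|I| => enum_val k)) /=; last first.
    by move=> i _; rewrite enum_valK.
  by apply: eq_bigl => k; rewrite enum_rankK eqxx.
apply: continuous_compact.
  apply: continuous_subspaceT; apply: continuous_sum => i.
  by apply: continuous_scalel; exact: coord_continuous.
have Ic : compact [set l : 'rV[R]_#|I| | forall i, `[0, 1]%classic (l ord0 i)].
  by apply: (@rV_compact R _ (fun=> `[0, 1]%classic)) => i; exact: segment_compact.
apply: (subclosed_compact _ Ic); last by move=> l [].
apply: closedI.
  by apply: compact_closed => //; exact: norm_hausdorff.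
apply: (@preimage_closed _ _ (fun l : 'rV[R]_#|I| => \sum_i l ord0 i) [set 1]);
  last exact: closed_eq.
by move=> l _; apply: (@continuous_sum R _ R^o) => i; exact: coord_continuous.
Qed.

End Hull.

(** * Polytopes *)

Lemma lt_conv (R : realType) (t a b c : R) : 0 < t < 1 -> a < c -> b <= c ->
  a + t * (b - a) < c.
Proof. by move=> *; nra. Qed.

Lemma fin_min (R : realType) (I : finType) (f : I -> R) : (forall i, 0 < f i) ->
  exists2 d, 0 < d & forall i, d <= f i.
Proof.
move=> f0; exists (\big[Num.min/1]_i f i); last by move=> i; exact: bigmin_le.
by apply: lt_bigmin => // i _; exact: f0.
Qed.

(** Makes a radius uniform over the finitely many facets or chain types. *)
Lemma fin_radius (R : realType) (I : finType) (P : I -> R -> Prop) :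
  (forall i r r', r' <= r -> P i r -> P i r') ->
  (forall i, exists2 r, 0 < r & P i r) ->
  exists2 r, 0 < r & forall i, P i r.
Proof.
move=> Pm h; have [f hf] := choice (fun i => let: ex_intro2 r r0 p := h i in
  ex_intro (fun r => 0 < r /\ P i r) r (conj r0 p)).
have [i|d d0 hd] := @fin_min R I f; first by have [] := hf i.
by exists d => // i; apply: Pm (hd i) _; have [] := hf i.
Qed.

(* Irredundance makes any three normals at a common point independent. *)
Record polytope (R : realType) := Polytope {
  facet : finType;
  normal : facet -> 'rV[R]_3;
  height : facet -> R;
  center : 'rV[R]_3;
  normal1 : forall j, normal j ∙ normal j = 1;
  center_lt : forall j, normal j ∙ center < height j;
  irredundant : forall j, exists2 q, normal j ∙ q = height j &
    forall i, i != j -> normal i ∙ q < height i;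
  bounded : exists M : R, forall x, (forall j, normal j ∙ x <= height j) ->
    enorm x <= M }.

Definition body (R : realType) (P : polytope R) : set 'rV[R]_3 :=
  [set x | forall j, normal j ∙ x <= height (p := P) j].

(** * Irredundant half-space description of a convex hull *)

Section HalfSpaces.
Variable R : realType.
Local Notation V := 'rV[R]_3.
Variables (I : finType) (v : I -> V) (o : V).
Let K := convex_hull (range v).
Hypothesis Ko : interior K o.

Let Kc : compact K. Proof. exact: convex_hull_compact. Qed.
Let Kconv : forall x y (t : R), 0 <= t <= 1 -> K x -> K y -> K (x + t *: (y - x)).
Proof. by move=> *; apply: convex_hull_convex. Qed.
Let Kx : K o. Proof. exact: interior_subset. Qed.
Let K0 : K !=set0. Proof. by exists o. Qed.

Definition exposes (nc : V * R) (W : {set I}) : Prop :=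
  [/\ nc.1 ∙ nc.1 = 1, forall i, nc.1 ∙ v i <= nc.2 &
    forall i, (i \in W) = (nc.1 ∙ v i == nc.2)].

(** Only finitely many vertex sets W occur; one half-space chosen for each of them gives a finite
    family without any theory of faces. *)
Definition exposed := {W : {set I} | `[< exists nc, exposes nc W >]}.

Definition exposing (W : exposed) : V * R :=
  sval (cid (elimT (asboolP _) (valP W))).

Lemma exposingP (W : exposed) : exposes (exposing W) (val W).
Proof. by rewrite /exposing; case: cid. Qed.

Lemma exposing_le (W : exposed) x : K x -> (exposing W).1 ∙ x <= (exposing W).2.
Proof.
have [_ h _] := exposingP W.
move=> /convex_hullE[l [l0 l1 ->]]; set n := (exposing W).1.
have E r : n ∙ (\sum_(i <- r) l i *: v i) = \sum_(i <- r) l i * (n ∙ v i).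
  by elim: r => [|i r ih]; rewrite ?big_nil ?dotp0r// !big_cons !dotE ih.
rewrite E -[leRHS]mul1r -l1 mulr_suml; apply: ler_sum => i _.
exact: ler_wpM2l (h i).
Qed.

(** A point of K on the plane of [nc] has weight zero outside W, so it lies on every plane that
    touches K at W, in particular on the chosen one. *)
Lemma exposing_eq (W : exposed) nc x : exposes nc (val W) -> K x ->
  nc.1 ∙ x = nc.2 -> (exposing W).1 ∙ x = (exposing W).2.
Proof.
have [_ _ h] := exposingP W.
move=> [_ hle hW] /convex_hullE[l [l0 l1 ->]]; set n := (exposing W).1.
have E m r : m ∙ (\sum_(i <- r) l i *: v i) = \sum_(i <- r) l i * (m ∙ v i).
  by elim: r => [|i r ih]; rewrite ?big_nil ?dotp0r// !big_cons !dotE ih.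
rewrite !E => e.
have H : \sum_i l i * (nc.2 - nc.1 ∙ v i) = 0.
  rewrite (eq_bigr (fun i => l i * nc.2 - l i * (nc.1 ∙ v i))); last first.
    by move=> i _; rewrite mulrBr.
  by rewrite sumrB e -mulr_suml l1 mul1r subrr.
rewrite -[RHS]mul1r -l1 mulr_suml; apply: eq_bigr => i _.
have H0 k : true -> 0 <= l k * (nc.2 - nc.1 ∙ v k).
  by move=> _; rewrite mulr_ge0 ?subr_ge0.
have /eqP : l i * (nc.2 - nc.1 ∙ v i) = 0 := psumr_eq0P H0 H isT.
rewrite mulf_eq0 => /orP[/eqP ->|]; first by rewrite !mul0r.
by rewrite subr_eq0 eq_sym -hW h => /eqP <-.
Qed.

Lemma exposing_supports (W : exposed) : supports K (exposing W).1 (exposing W).2.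
Proof.
split=> [|x]; last exact: exposing_le.
have [h _ _] := exposingP W; apply/eqP => e.
by move: h; rewrite e dotp0l => /eqP; rewrite eq_sym oner_eq0.
Qed.

Lemma exposing_center (W : exposed) : (exposing W).1 ∙ o < (exposing W).2.
Proof.
rewrite ltNge; apply/negP => h.
exact: (supports_not_interior (exposing_supports W) h).
Qed.

Lemma outer_exposed p : ~ K p -> exists W : exposed,
  (exposing W).1 ∙ nproj Kc K0 p = (exposing W).2.
Proof.
move=> nKp; set q := nproj Kc K0 p.
have Kq : K q by apply: nproj_in.
have pq : p - q != 0.
  by apply/eqP => /eqP; rewrite subr_eq0 => /eqP e; apply: nKp; rewrite e.
pose n := (enorm (p - q))^-1 *: (p - q).
have e0 : 0 < enorm (p - q) by rewrite enorm_gt0.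
pose W : {set I} := [set i | n ∙ v i == n ∙ q]%SET.
have ex : exposes (n, n ∙ q) W.
  split=> /=.
  - by rewrite /n dotpZl dotpZr -enorm_sqr expr2; field; rewrite gt_eqF.
  - move=> i; rewrite -subr_ge0 -dotpB /n dotpZl.
    rewrite (_ : _ ∙ (q - v i) = - ((p - q) ∙ (v i - q))); last first.
      by rewrite -dotpNr opprB.
    rewrite mulr_ge0 ?invr_ge0 ?enorm_ge0// oppr_ge0.
    by apply: nproj_obtuse => //; apply: sub_convex_hull; exists i.
  - by move=> i; rewrite inE.
have hW : `[< exists nc, exposes nc W >] by apply/asboolP; exists (n, n ∙ q).
exists (exist _ W hW); exact: (@exposing_eq (exist _ W hW) _ _ ex).
Qed.

(** The half-space chosen for the projection of a point outside K need not separate that point, so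
    projecting p alone proves nothing. On the segment from o to p, however, every chosen half-space
    keeps a slack of at least (1 - t) d at parameter t, so a point there outside K is at distance at
    least (1 - t) d from K. Just after the last parameter in K this is absurd. *)
Lemma hull_halfspaces p :
  (forall W, (exposing W).1 ∙ p <= (exposing W).2) -> K p.
Proof.
move=> hp; apply: contrapT => nKp.
have [d d0 hd] := fin_min (fun W => (etrans (subr_gt0 _ _) (exposing_center W))).
pose c (t : R) := o + t *: (p - o).
pose T : set R := [set t | 0 <= t <= 1 /\ K (c t)].
have T0 : T 0 by rewrite /T /= lexx ler01 /c scale0r addr0.
have Tb : has_ubound T by exists 1 => t [/andP[]].
have Ts : has_sup T by split => //; exists 0.
pose s := sup T.
have s0 : 0 <= s by apply: ub_le_sup.
have s1 : s <= 1 by apply: ge_sup; [exists 0|move=> t [/andP[]]].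
have Lp : 0 < enorm (p - o).
  by rewrite enorm_gt0 subr_eq0; apply/eqP => e; apply: nKp; rewrite e.
have cL t u : enorm (c t - c u) = `|t - u| * enorm (p - o).
  rewrite -enormZ; congr enorm; apply: vecP; rewrite /c !coE; ring.
have far t : 0 <= t <= 1 -> ~ K (c t) -> (1 - t) * d <= enorm (c t - nproj Kc K0 (c t)).
  move=> t01 nK; have [W hW] := outer_exposed nK.
  set q := nproj _ _ _ in hW *; have [n1 _ _] := exposingP W.
  apply: (@le_trans _ _ ((exposing W).1 ∙ (q - c t))).
    rewrite dotpB hW /c !dotE.
    have := hp W; have := hd W => /=; nra.
  rewrite enormB; apply: le_trans (cauchy _ _) _.
  by rewrite /enorm n1 sqrtr1 mul1r.
have s_lt1 : s < 1.
  rewrite ltNge; apply/negP => ge1; have {ge1} se : s = 1 by apply/le_anti; rewrite s1.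
  apply: nKp; rewrite (_ : p = c 1); last by rewrite /c scale1r addrC subrK.
  apply: (K_closed Kc) => A /nbhs_enorm[r r0 hr].
  have [t [t01 Kt] ht] := sup_adherent (divr_gt0 r0 Lp) Ts.
  exists (c t); split => //; apply: hr; rewrite cL -ltr_pdivlMr//.
  rewrite -/s se in ht; rewrite ler0_norm ?opprB//; last by lra.
  by lra.
pose L := enorm (p - o).
(* The point at s + e is within 2 e L of K but at distance at least (1 - s - e) d; this e makes the
   first number smaller. *)
pose e := (1 - s) * d / (4 * (L + d)).
have Ld : 0 < L + d by rewrite addr_gt0.
have e0 : 0 < e by rewrite !(divr_gt0, mulr_gt0)// subr_gt0.
have eL : e * (4 * (L + d)) = (1 - s) * d.
  by rewrite /e; field; rewrite gt_eqF.
have e1 : e < 1 - s.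
  have h1 : 0 < e * L by exact: mulr_gt0.
  have h2 : 0 < e * d by exact: mulr_gt0.
  rewrite -(ltr_pM2r d0); nra.
have [t [t01 Kt] ht] := sup_adherent e0 Ts.
rewrite -/s in ht.
have ts : t <= s by apply: ub_le_sup => //; split.
have ns : ~ K (c (s + e)).
  move=> Ks; have : s + e <= s by apply: ub_le_sup => //; split => //; lra.
  by lra.
have := far (s + e) _ ns; rewrite (_ : 0 <= s + e <= 1); last by lra.
move=> /(_ isT); apply/negP; rewrite -ltNge.
apply: le_lt_trans (nproj_le Kc K0 (c (s + e)) Kt) _.
rewrite cL ger0_norm; last by lra.
have h2 : 0 < e * d by exact: mulr_gt0.
have h1 : 0 < e * L by exact: mulr_gt0.
have : (s + e - t) * L <= 2 * e * L by rewrite ler_wpM2r ?enorm_ge0//; lra.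
rewrite -/L; nra.
Qed.

(** In a minimal subfamily that still cuts out K, each W has a point p violating its half-space
    alone; the segment from o to p meets the plane of W at a point strictly inside all other
    half-spaces. *)
Lemma hull_polytope : exists P : polytope R, body P = K.
Proof.
pose good (A : {set exposed}) :=
  `[< forall p, (forall W, W \in A -> (exposing W).1 ∙ p <= (exposing W).2) -> K p >].
have gT : good [set: exposed]%SET.
  by apply/asboolP => p h; apply: hull_halfspaces => W; apply: h; rewrite inE.
have [A Am _] := minset_exists (P := good) gT.
have /asboolP gA := minsetp Am.
have out (W : {W | W \in A}) : exists2 p, ~ K p &
    forall W', W' \in A -> W' != val W -> (exposing W').1 ∙ p <= (exposing W').2.
  apply: contrapT => H.
  have gAW : good (A :\ val W).
    apply/asboolP => p hp; apply: contrapT => nK; apply: H; exists p => // W' W'A W'W.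
    by apply: hp; rewrite !inE W'W.
  have := minsetinf Am gAW (subsetDl _ _) => e.
  have WA : (val W \in A :\ val W) = (val W \in A) by rewrite e.
  by move: WA; rewrite (valP W) !inE eqxx.
have n1 (W : {W | W \in A}) : (exposing (val W)).1 ∙ (exposing (val W)).1 = 1.
  by have [] := exposingP (val W).
have KE x : K x <-> forall W : {W | W \in A}, (exposing (val W)).1 ∙ x <= (exposing (val W)).2.
  split=> [Kxx W|h]; first exact: exposing_le.
  by apply: gA => W WA; have := h (exist _ W WA).
have irr (W : {W | W \in A}) : exists2 q, (exposing (val W)).1 ∙ q = (exposing (val W)).2 &
    forall W' : {W | W \in A}, W' != W -> (exposing (val W')).1 ∙ q < (exposing (val W')).2.
  have [p nK hp] := out W.
  set n := (exposing (val W)).1; set h := (exposing (val W)).2.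
  have nph : h < n ∙ p.
    rewrite ltNge; apply/negP => le; apply: nK; apply/KE => W'.
    by have [->//|ne] := eqVneq W' W; apply: hp => //; exact: valP.
  have noh : n ∙ o < h by exact: exposing_center.
  pose t := (h - n ∙ o) / (n ∙ p - n ∙ o).
  have D0 : 0 < n ∙ p - n ∙ o by rewrite subr_gt0 (lt_trans noh).
  have t0 : 0 < t by rewrite divr_gt0// subr_gt0.
  have t1 : t < 1 by rewrite ltr_pdivrMr// mul1r ltrD2r.
  exists (o + t *: (p - o)).
    rewrite !dotE /t; field; rewrite gt_eqF//; lra.
  move=> W' ne; rewrite dotpDr dotpZr dotpB; apply: lt_conv; rewrite ?t0//.
    exact: exposing_center.
  exact: hp (val W') (valP W') ne.
have [M hM] : exists M : R, forall x, K x -> enorm x <= M.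
  have /continuous_subspaceT ec := @continuous_enorm R.
  have [c _ h] := compact_EVT_max K0 Kc (ec K).
  by exists (enorm c) => x Kxx; apply: h; exact: mem_set.
exists (@Polytope R {W | W \in A} _ _ o n1 (fun W => exposing_center (val W)) irr
  (ex_intro _ M (fun x h => hM x ((KE x).2 h)))).
by apply/seteqP; split => x /KE.
Qed.

End HalfSpaces.

(** * Intrinsic distance on a polytope *)

Section Surface.
Variables (R : realType) (P : polytope R).
Local Notation V := 'rV[R]_3.
Local Notation J := (facet P).
Local Notation n := (@normal R P).
Local Notation h := (@height R P).
Local Notation K := (body P).
Local Notation o := (center P).
Implicit Types (x y z p q u v : V) (i j k : J).

Definition surface : set V := boundary K.
Local Notation S := surface.

Definition face j : set V := [set x | K x /\ n j ∙ x = h j].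

Lemma normal_neq0 j : n j != 0.
Proof. by rewrite -dotp_gt0 normal1. Qed.

Lemma enorm_normal j : enorm (n j) = 1.
Proof. by rewrite /enorm normal1 sqrtr1. Qed.

Lemma body_center : K o. Proof. by move=> j; rewrite ltW ?center_lt. Qed.

Lemma body_neq0 : K !=set0. Proof. by exists o; exact: body_center. Qed.

Lemma body_convex x y (t : R) : 0 <= t <= 1 -> K x -> K y -> K (x + t *: (y - x)).
Proof.
by move=> t01 Kx Ky j; have := Kx j; have := Ky j; rewrite !dotE; nra.
Qed.

Lemma closed_le_dotp u (c : R) : closed [set x : V | u ∙ x <= c].
Proof.
rewrite (_ : [set x | _] = (fun x : V => x ∙ u) @^-1` [set t | t <= c]).
  apply: preimage_closed; last exact: closed_le.
  by move=> x _; exact: continuous_dotp.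
by apply/seteqP; split => x /=; rewrite dotpC.
Qed.

Lemma closed_eq_dotp u (c : R) : closed [set x : V | u ∙ x = c].
Proof.
rewrite (_ : [set x | _] = (fun x : V => x ∙ u) @^-1` [set c]).
  apply: preimage_closed; last exact: closed_eq.
  by move=> x _; exact: continuous_dotp.
by apply/seteqP; split => x /=; rewrite dotpC.
Qed.

Lemma body_compact : compact K.
Proof.
apply: bounded_closed_compact; last first.
  rewrite (_ : K = \bigcap_j [set x | n j ∙ x <= h j]).
    by apply: closed_bigI => j _; exact: closed_le_dotp.
  by apply/seteqP; split=> [x Kx j _|x Kx j]; [exact: Kx|exact: Kx j I].
have [M hM] := bounded P; exists M; split; first exact: num_real.
move=> c Mc x Kx; apply: le_trans (norm_le_enorm _) _.
by apply: le_trans (hM x Kx) _; exact: ltW.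
Qed.

Lemma facet_supports j : supports K (n j) (h j).
Proof. by split; [exact: normal_neq0|move=> x Kx; exact: Kx]. Qed.

Lemma surfaceP x : S x <-> K x /\ exists j, n j ∙ x = h j.
Proof.
split=> [/(boundaryE body_compact)[Kx nx]|[Kx [j jx]]]; last first.
  by apply: (supports_boundary body_compact (facet_supports j)) => //; rewrite jx.
split => //; apply: contrapT => H; apply: nx.
have gap j : 0 < h j - n j ∙ x.
  rewrite subr_gt0 lt_def Kx andbT; apply/eqP => e; apply: H; by exists j.
have [d d0 hd] := fin_min gap; apply/nbhs_enorm; exists d => // y yx j.
have := cauchy (n j) (y - x); rewrite enorm_normal mul1r dotpB.
have := hd j; lra.
Qed.

Lemma surface_face x : S x -> exists j, face j x.
Proof. by move=> /surfaceP[Kx [j jx]]; exists j. Qed.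

Lemma face_surface j x : face j x -> S x.
Proof. by move=> [Kx jx]; apply/surfaceP; split => //; exists j. Qed.

Lemma surface_body x : S x -> K x. Proof. by case/surfaceP. Qed.

Definition pr := nproj body_compact body_neq0.

Lemma prE x : K x -> pr x = x. Proof. exact: nproj_id. Qed.

Lemma conn_pr j p q : h j <= n j ∙ p -> h j <= n j ∙ q ->
  conn S (pr p) (pr q) (enorm (p - q)).
Proof.
move=> hp hq; apply: conn_halfspace (facet_supports j) hp hq _ => //.
exact: body_convex.
Qed.

Lemma conn_face j p q : face j p -> face j q -> conn S p q (enorm (p - q)).
Proof.
move=> [Kp jp] [Kq jq]; rewrite -{1}(prE Kp) -{1}(prE Kq).
by apply: (@conn_pr j); rewrite ?jp ?jq.
Qed.

(** If u and v are parallel, any nonzero vector orthogonal to u will do, and one of two products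
    with basis vectors is nonzero. *)
Lemma perp2 u v : u != 0 -> exists2 t : V, t != 0 & u ∙ t = 0 /\ v ∙ t = 0.
Proof.
move=> u0; have [c0|] := eqVneq (cross u v) 0; last first.
  by exists (cross u v) => //; split; rewrite dotpC ?cross_orthol ?cross_orthor.
have H w : v ∙ cross u w = 0.
  rewrite (_ : v ∙ cross u w = - (cross u v ∙ w)); last first.
    by rewrite /cross !coE; ring.
  by rewrite c0 dotp0l oppr0.
have [e|] := eqVneq (cross u (vec 1 0 0)) 0; last first.
  by exists (cross u (vec 1 0 0)) => //; split=> //; rewrite dotpC cross_orthol.
have [e'|] := eqVneq (cross u (vec 0 1 0)) 0; last first.
  by exists (cross u (vec 0 1 0)) => //; split=> //; rewrite dotpC cross_orthol.
move: (congr1 (@co2 R) e) (congr1 (@co1 R) e) (congr1 (@co2 R) e').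
rewrite /cross !coE => e1 e2 e3; case/eqP: u0; apply: vecP; rewrite ?coE; lra.
Qed.

(** Otherwise the line through o in direction t would stay in the bounded solid. *)
Lemma normals_unbounded (t : V) : t != 0 -> exists l, n l ∙ t != 0.
Proof.
move=> t0; apply: contrapT => H; have [M hM] := bounded P.
have nt l : n l ∙ t = 0 by apply/eqP/negPn/negP => e; apply: H; exists l.
have e0 : 0 < enorm t by rewrite enorm_gt0.
pose c := (`|M| + enorm o + 1) / enorm t.
have c0 : 0 <= c by rewrite divr_ge0 ?enorm_ge0// !addr_ge0 ?enorm_ge0.
have : enorm (o + c *: t) <= M.
  by apply: hM => j; rewrite !dotE nt mulr0 addr0 ltW ?center_lt.
have := enorm_dist3 (c *: t) (c *: t + o) 0; rewrite subr0.
rewrite (_ : c *: t - (c *: t + o) = - o); last by apply: vecP; rewrite !coE; ring.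
rewrite enormN subr0 (addrC _ o) enormZ ger0_norm// /c mulfVK ?gt_eqF//.
have := ler_norm M; lra.
Qed.

(** Finiteness of the intrinsic distance. Move x and y along a direction t parallel to both facet
    planes until they reach the plane of a facet l transversal to t, and join them there: the three
    segments lie in supporting planes, so they project to the surface. *)
Lemma conn_faces_bound i j : exists C : R, forall x y, face i x -> face j y ->
  conn S x y C.
Proof.
have [t t0 [it jt]] := perp2 (n j) (normal_neq0 i).
have [l lt0] := normals_unbounded t0; have [M hM] := bounded P.
pose c x := (h l - n l ∙ x) / (n l ∙ t).
pose B := (`|h l| + M) / `|n l ∙ t| * enorm t.
have cB x : K x -> enorm (c x *: t) <= B.
  move=> Kx; rewrite enormZ /c normrM normfV ler_wpM2r ?enorm_ge0//.
  rewrite ler_wpM2r ?invr_ge0//; apply: le_trans (ler_normB _ _) _.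
  rewrite lerD2l; apply: le_trans (hM x Kx).
  have := cauchy (n l) x; have := cauchyN (n l) x.
  by rewrite enorm_normal mul1r ler_norml => -> ->.
have lc x : n l ∙ (x + c x *: t) = h l.
  by rewrite /c !dotE; field.
exists (B + (2 * M + 2 * B) + B) => x y [Kx ix] [Ky jy].
rewrite -(prE Kx) -(prE Ky).
apply: (@conn_trans _ _ _ (pr (y + c y *: t))).
  apply: (@conn_trans _ _ _ (pr (x + c x *: t))).
    apply: (@conn_le _ _ _ _ (enorm (x - (x + c x *: t)))).
      by rewrite opprD addNKr enormN cB.
    by apply: (@conn_pr i); rewrite ?dotE ?it ix ?mulr0 ?addr0.
  apply: (@conn_le _ _ _ _ (enorm ((x + c x *: t) - (y + c y *: t)))).
    have := enorm_triangle (x + c x *: t) (- (y + c y *: t)); rewrite enormN.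
    have := enorm_triangle x (c x *: t); have := enorm_triangle y (c y *: t).
    have := hM x Kx; have := hM y Ky; have := cB x Kx; have := cB y Ky; lra.
  by apply: (@conn_pr l); rewrite lc.
apply: (@conn_le _ _ _ _ (enorm ((y + c y *: t) - y))).
  by rewrite addrAC subrr add0r cB.
by apply: (@conn_pr j); rewrite ?dotE ?jt jy ?mulr0 ?addr0.
Qed.

Lemma surface_conn_bound : exists2 C : R, 0 <= C & forall x y, S x -> S y -> conn S x y C.
Proof.
have [f hf] := choice (fun ij : J * J => conn_faces_bound ij.1 ij.2).
exists (\sum_ij `|f ij|) => [|x y /surface_face[i ix] /surface_face[j jy]].
  by rewrite sumr_ge0.
apply: conn_le (hf (i, j) x y ix jy).
apply: le_trans (ler_norm _) _.
by rewrite (bigD1 (i, j))//= lerDl sumr_ge0.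
Qed.

Definition dist x y : R := rho S x y.

Lemma dist_fin x y : S x -> S y -> intrinsic_dist S x y = (dist x y)%:E.
Proof.
by move=> Sx Sy; have [C _ hC] := surface_conn_bound; exact: rhoE (hC _ _ Sx Sy).
Qed.

Lemma dist_ub : exists C : R, forall x y, S x -> S y -> dist x y <= C.
Proof.
have [C _ hC] := surface_conn_bound; exists C => x y Sx Sy.
exact: rho_le (hC _ _ Sx Sy).
Qed.

Lemma dist_triangle x y z : S x -> S y -> S z -> dist x z <= dist x y + dist y z.
Proof.
move=> Sx Sy Sz; have [C _ hC] := surface_conn_bound.
exact: rho_triangle (hC _ _ Sx Sy) (hC _ _ Sy Sz).
Qed.

Lemma dist_sym x y : S x -> S y -> dist y x = dist x y.
Proof.
by move=> Sx Sy; have [C _ hC] := surface_conn_bound; exact: rho_sym (hC _ _ Sx Sy).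
Qed.

Lemma dist_ge_enorm x y : S x -> S y -> enorm (x - y) <= dist x y.
Proof.
by move=> Sx Sy; have [C _ hC] := surface_conn_bound; exact: le_rho (hC _ _ Sx Sy).
Qed.

Lemma dist_le x y r : conn S x y r -> dist x y <= r. Proof. exact: rho_le. Qed.

Lemma dist_face j x y : face j x -> face j y -> dist x y = enorm (x - y).
Proof.
move=> jx jy; apply/le_anti; rewrite dist_le ?dist_ge_enorm//=.
- exact: face_surface jx.
- exact: face_surface jy.
exact: conn_face jx jy.
Qed.

Lemma facet_local x : exists2 r : R, 0 < r &
  forall y, enorm (y - x) < r -> forall j, n j ∙ y = h j -> h j <= n j ∙ x.
Proof.
pose Q j r := forall y, enorm (y - x) < r -> n j ∙ y = h j -> h j <= n j ∙ x.
have [||r r0 hr] := @fin_radius R J Q.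
- by move=> j r r' rr H y yx; apply: H; apply: lt_le_trans rr.
- move=> j; have [hx|hx] := leP (h j) (n j ∙ x); first by exists 1.
  exists (h j - n j ∙ x); first by rewrite subr_gt0.
  move=> y yx jy; have := cauchy (n j) (y - x).
  rewrite enorm_normal mul1r dotpB jy; lra.
by exists r => // y yx j; exact: hr.
Qed.

Lemma face_local x : K x -> exists2 r : R, 0 < r &
  forall y, enorm (y - x) < r -> forall j, n j ∙ y = h j -> n j ∙ x = h j.
Proof.
move=> Kx; have [r r0 hr] := facet_local x; exists r => // y yx j jy.
by apply/le_anti; rewrite (Kx j) (hr y yx j jy).
Qed.

(** Facets that pass near x pass through x, so a nearby surface point shares a facet with x. *)
Lemma dist_local x : S x -> exists2 r : R, 0 < r &
  forall y, S y -> enorm (y - x) < r -> dist x y = enorm (x - y).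
Proof.
move=> Sx; have Kx := surface_body Sx; have [r r0 hr] := face_local Kx.
exists r => // y /surfaceP[Ky [j jy]] yx; apply: (@dist_face j); split => //.
exact: hr jy.
Qed.

Lemma dist_lipschitz x y x' y' : S x -> S y -> S x' -> S y' ->
  `|dist x y - dist x' y'| <= dist x x' + dist y y'.
Proof.
move=> Sx Sy Sx' Sy'; rewrite ler_norml.
have := dist_triangle Sx Sx' Sy; have := dist_triangle Sx' Sy' Sy.
have := dist_triangle Sx' Sx Sy'; have := dist_triangle Sx Sy Sy'.
rewrite (dist_sym Sx Sx') (dist_sym Sy Sy').
by move=> a b c d; apply/andP; split; lra.
Qed.

Lemma surface_compact : compact S.
Proof.
apply: (subclosed_compact _ body_compact); last by move=> x /surface_body.
rewrite (_ : S = \bigcup_(j in [set: J]) face j).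
  apply: closed_bigcup; first exact: finite_finset.
  move=> j _; apply: closedI; last exact: closed_eq_dotp.
  exact: (K_closed body_compact).
apply/seteqP; split=> [x /surface_face[j jx]|x [j _ jx]]; first by exists j.
exact: face_surface jx.
Qed.

Lemma face_closed j : closed (face j).
Proof. by apply: closedI; [exact: (K_closed body_compact)|exact: closed_eq_dotp]. Qed.

End Surface.

(** * Shortest paths as chains *)

Section Chains.
Variables (R : realType) (P : polytope R).
Local Notation V := 'rV[R]_3.
Local Notation J := (facet P).
Local Notation n := (@normal R P).
Local Notation h := (@height R P).
Local Notation S := (surface P).
Local Notation face := (@face R P).
Local Notation dist := (@dist R P).
Implicit Types (x y p q u v : V) (z : nat -> V) (i j : J) (s : nat -> J).

Definition is_chain m s (z : nat -> V) :=
  forall k, (k < m)%N -> face (s k) (z k) /\ face (s k) (z k.+1).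

Definition clen m (z : nat -> V) : R := \sum_(0 <= k < m) enorm (z k.+1 - z k).

Definition inj_below m s := forall k l, (k < m)%N -> (l < m)%N -> s k = s l -> k = l.

Lemma dist_xx x : S x -> dist x x = 0.
Proof.
by move=> /surface_face[j jx]; rewrite (dist_face jx jx) subrr enorm0.
Qed.

Lemma chain_surface (m k : nat) s z : is_chain m s z -> (0 < m)%N -> (k <= m)%N -> S (z k).
Proof.
move=> ch m0; rewrite leq_eqVlt => /orP[/eqP ->|km]; last first.
  by have [f _] := ch k km; exact: face_surface f.
by case: m m0 ch => // m _ ch; have [_ f] := ch m (ltnSn _); exact: face_surface f.
Qed.

Lemma chain_dist (m a b : nat) s z : is_chain m s z -> (0 < m)%N -> (a <= b)%N -> (b <= m)%N ->
  dist (z a) (z b) <= \sum_(a <= k < b) enorm (z k.+1 - z k).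
Proof.
move=> ch m0; elim: b => [|b ih] ab bm.
  by move: ab; rewrite leqn0 => /eqP ->; rewrite big_geq// dist_xx//; apply: chain_surface ch _ _.
move: ab; rewrite leq_eqVlt => /orP[/eqP ->|ab].
  by rewrite big_geq// dist_xx//; apply: chain_surface ch _ _.
rewrite big_nat_recr//=.
have Sk k : (k <= m)%N -> S (z k) by apply: chain_surface ch _.
apply: le_trans (dist_triangle (Sk a _) (Sk b _) (Sk b.+1 _)) _; try lia.
apply: lerD; first by apply: ih; lia.
by have [f f'] := ch b bm; rewrite (dist_face f f') enormB.
Qed.

Lemma chain_dist0 m s z : is_chain m s z -> (0 < m)%N -> dist (z 0%N) (z m) <= clen m z.
Proof. by move=> ch m0; apply: chain_dist ch _ _ _. Qed.

Fixpoint timed_chain (g : R -> V) (a : R) (l : seq (J * R)) : Prop :=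
  if l is (j, t) :: l' then face j (g a) /\ face j (g t) /\ timed_chain g t l'
  else True.

Lemma timed_chainP (g : R -> V) a l j0 k : timed_chain g a l -> (k < size l)%N ->
  face (nth j0 (map fst l) k) (g (nth 1 (a :: map snd l) k)) /\
  face (nth j0 (map fst l) k) (g (nth 1 (a :: map snd l) k.+1)).
Proof.
elim: l a k => [|[j t] l ih] a [|k] //= [fa [ft ch]] kl; first by [].
exact: ih.
Qed.

Lemma psum_clen (g : R -> V) a (ts : seq R) :
  psum g a ts = clen (size ts) (fun k => g (nth 1 (a :: ts) k)).
Proof.
rewrite /clen; elim: ts a => [|t ts ih] a; first by rewrite big_nil.
by rewrite big_nat_recl //= ih.
Qed.

(* Each facet is left for good at the last time the curve visits it, so a curve
   dominates a chain meeting every facet at most once. *)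
Lemma timed_chain_exists (g : R -> V) (A : {set J}) (a : R) :
  {within `[0, 1], continuous g} -> 0 <= a <= 1 ->
  (forall t, a < t <= 1 -> exists2 j, j \in A & face j (g t)) ->
  exists l, [/\ uniq (map fst l), {subset map fst l <= A},
    path <%R a (map snd l), last a (map snd l) = 1 & timed_chain g a l].
Proof.
move=> /within01P gc.
have fcl j (T : set R) (b : R) : 0 <= b <= 1 ->
    (forall t, T t -> 0 <= t <= 1 /\ face j (g t)) ->
    (forall e, 0 < e -> exists2 t, T t & `|t - b| < e) -> face j (g b).
  move=> b01 hT hb; apply: face_closed => B /nbhs_enorm[r r0 hr].
  have [d d0 hd] := gc b b01 r r0; have [t Tt tb] := hb d d0.
  have [t01 ft] := hT t Tt.
  by exists (g t); split => //; apply: hr; apply: hd.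
elim: {A}_.+1 {-2}A (ltnSn #|A|) a => // N ih A AN a a01 cov.
have [a1|a1] := leP 1 a.
  have ae : a = 1 by apply/le_anti; rewrite a1; case/andP: a01 => _ ->.
  by exists [::]; split.
(* Finitely many facets cover the times after a, so one of them is visited at times arbitrarily
   close to a, and by closedness at a itself. *)
have [j jA hj] : exists2 j, j \in A & forall e, 0 < e ->
    exists2 t, a < t <= 1 /\ face j (g t) & t < a + e.
  apply: contrapT => H.
  have [||e e0 he] := @fin_radius R J (fun j e => j \in A ->
      forall t, a < t <= 1 -> face j (g t) -> a + e <= t).
  - by move=> j r r' rr H' jA t ta f; apply: le_trans (H' jA t ta f); rewrite lerD2l.
  - move=> j; apply: contrapT => Hj; apply: H.
    have jA : j \in A.
      by apply/negPn/negP => nA; apply: Hj; exists 1 => // jA; rewrite jA in nA.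
    exists j => // e e0; apply: contrapT => H2; apply: Hj; exists e => // _ t ta f.
    by rewrite leNgt; apply/negP => te; apply: H2; exists t.
  pose t := Num.min 1 (a + e / 2).
  have ta : a < t by rewrite lt_min a1 ltrDl divr_gt0.
  have t1 : t <= 1 by rewrite ge_min lexx.
  have te : t <= a + e / 2 by rewrite ge_min lexx orbT.
  have [|j jA f] := cov t; first by rewrite ta.
  by have := he j jA t _ f; rewrite ta t1 => /(_ isT); lra.
have fa : face j (g a).
  apply: (fcl j [set t | a < t <= 1 /\ face j (g t)]) => //.
    by move=> t [ta f]; split => //; lra.
  by move=> e e0; have [t Tt te] := hj e e0; exists t => //; case: Tt => ta _;
    rewrite ger0_norm; lra.
pose T := [set t | a < t <= 1 /\ face j (g t)].
have [t0 Tt0 _] := hj 1 ltr01.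
have Tub : has_ubound T by exists 1 => t [/andP[]].
have Ts : has_sup T by split => //; exists t0.
pose b := sup T.
have b1 : b <= 1 by apply: ge_sup; [exists t0|move=> t [/andP[]]].
have t0b : t0 <= b by apply: ub_le_sup.
have ab : a < b by apply: lt_le_trans t0b; case: Tt0 => /andP[].
have fb : face j (g b).
  apply: (fcl j T); first by lra.
    by move=> t [ta f]; split => //; lra.
  move=> e e0; have [t Tt te] := sup_adherent e0 Ts; exists t => //.
  have tb : t <= b by apply: ub_le_sup.
  by rewrite ler0_norm; rewrite -/b in te; lra.
(* After b the curve never meets facet j again, so the other facets of A cover the rest. *)
have [|||l [ul lA pl ll chl]] := ih (A :\ j)%SET _ b.
- by move: AN; rewrite (cardsD1 j A) jA add1n ltnS.
- by lra.
- move=> t tb; have [|j' j'A f] := cov t; first by lra.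
  exists j' => //; rewrite !inE j'A andbT; apply/eqP => e.
  have : t <= b by apply: ub_le_sup => //; split; [lra|rewrite -e].
  lra.
exists ((j, b) :: l); split => //=.
- rewrite ul andbT; apply/negP => /lA; by rewrite !inE eqxx.
- move=> j'; rewrite inE => /orP[/eqP ->//|/lA]; by rewrite !inE => /andP[].
- by rewrite ab.
Qed.

Lemma curve_chain x y r : x != y -> conn S x y r ->
  exists m s z, [/\ (0 < m)%N && (m <= #|J|)%N, inj_below m s, is_chain m s z,
    z 0%N = x /\ z m = y & clen m z <= r].
Proof.
move=> xy [g [gc g0 g1 gS] /curve_lengthP lg].
have [||l [ul _ pl ll ch]] := @timed_chain_exists g [set: J]%SET 0 gc.
- by rewrite lexx ler01.
- move=> t t01; have /surface_face[j f] : S (g t).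
    by apply: gS; exists t => //=; rewrite in_itv /=; lra.
  by exists j; rewrite ?inE.
case: l ul pl ll ch => [|[j0 t0] l'] ul pl ll ch.
  by move: ll => /= /eqP; rewrite eq_sym oner_eq0.
set l := (j0, t0) :: l' in ul pl ll ch.
exists (size l), (nth j0 (map fst l)), (fun k => g (nth 1 (0 :: map snd l) k)).
have sl : size (map snd l) = size l by rewrite size_map.
split.
- by rewrite -(size_map fst) -(card_uniqP ul) max_card andbT (card_uniqP ul).
- move=> k k' kl kl' e; apply/eqP; rewrite -(nth_uniq j0 _ _ ul) ?size_map//.
  by rewrite e.
- by move=> k kl; apply: timed_chainP.
- split; first by rewrite [LHS]/= g0.
  have e1 : nth 1 (0 :: map snd l) (size (map snd l)) = 1.
    by rewrite -[size _]/((size (0 :: map snd l)).-1) nth_last /last -/(last 0 _) ll.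
  by rewrite -sl e1.
- by rewrite -sl -psum_clen; apply: lg.
Qed.

End Chains.

Section OptimalChains.
Variables (R : realType) (P : polytope R).
Local Notation V := 'rV[R]_3.
Local Notation J := (facet P).
Local Notation S := (surface P).
Local Notation face := (@face R P).
Local Notation dist := (@dist R P).
Local Notation Z := (prod_topology (fun _ : nat => V)).
Implicit Types (x y p q u v : V) (z : nat -> V) (i j : J) (s : nat -> J).

Lemma dist_le_clen m s z x y : @is_chain R P m s z -> (0 < m)%N -> z 0%N = x ->
  z m = y -> dist x y <= clen m z.
Proof. by move=> ch m0 <- <-; apply: chain_dist0 ch m0. Qed.

(** Sequences carry the product topology, and even the entries beyond m are kept on the surface, so
    that Tychonoff's theorem gives compactness. *)
Definition chain_space m s : set Z :=
  [set z : Z | (forall k, S (z k)) /\ @is_chain R P m s z].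

Lemma coord_vec_continuous (k : nat) : continuous (fun z : Z => z k : V).
Proof. by move=> z; exact: (@proj_continuous _ (fun _ => V)). Qed.

Lemma closed_coord (k : nat) (A : set V) : closed A -> closed [set z : Z | A (z k)].
Proof.
move=> cA; apply: (@preimage_closed _ _ (fun z : Z => z k) A) => // z _.
exact: coord_vec_continuous.
Qed.

Lemma chain_space_compact m s : compact (chain_space m s).
Proof.
have Sc : compact [set z : Z | forall k, S (z k)].
  by apply: (@tychonoff _ (fun _ : nat => V) (fun _ => S)) => k; exact: surface_compact.
apply: (subclosed_compact _ Sc); last by move=> z [].
rewrite (_ : chain_space m s = (\bigcap_k [set z : Z | S (z k)]) `&`
  \bigcap_(k in [set k | (k < m)%N])
    ([set z : Z | face (s k) (z k)] `&` [set z : Z | face (s k) (z k.+1)])).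
  apply: closedI.
    apply: closed_bigI => k _; apply: closed_coord.
    by apply: compact_closed; [exact: norm_hausdorff|exact: surface_compact].
  by apply: closed_bigI => k _; apply: closedI; apply: closed_coord; exact: face_closed.
apply/seteqP; split=> z [h1 h2]; split.
- by move=> k _; exact: h1.
- by move=> k /h2.
- by move=> k; exact: h1.
- by move=> k /h2.
Qed.

Lemma continuous_enorm_coord (f : Z -> V) : continuous f ->
  continuous (fun z : Z => enorm (f z)).
Proof.
move=> fc z; apply: (@continuous_comp Z V R f (@enorm R)); first exact: fc.
exact: continuous_enorm.
Qed.

Lemma continuous_clen m : continuous (clen m : Z -> R).
Proof.
apply: (@continuous_sum R Z R^o) => k; apply: continuous_enorm_coord.
exact: (continuous_sub (@coord_vec_continuous k.+1) (@coord_vec_continuous k)).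
Qed.

Lemma chain_space_min m s (F : Z -> R) (A : set Z) : continuous F -> closed A ->
  (chain_space m s `&` A) !=set0 ->
  exists2 c, (chain_space m s `&` A) c &
    forall z, (chain_space m s `&` A) z -> F c <= F z.
Proof.
move=> Fc cA ne.
have cc : compact (chain_space m s `&` A).
  by apply: compact_closedI => //; exact: chain_space_compact.
have [c cD hc] := compact_EVT_min ne cc (continuous_subspaceT Fc).
exists c; first exact: set_mem.
by move=> z zD; apply: hc; exact: mem_set.
Qed.

(** The number of legs and the facet sequence, padded to a fixed length: chains through distinct
    facets have finitely many types. *)
Definition ctype := ('I_#|J|.+1 * {ffun 'I_#|J|.+1 -> J})%type.
Definition tlen (t : ctype) : nat := t.1.
Definition tfac (t : ctype) (k : nat) : J := t.2 (inord k).

(* [chain_of t x y z]: the points z 0 = x, ..., z (tlen t) = y form a chain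
   through pairwise distinct facets; the other values of z are irrelevant. *)
Definition chain_of (t : ctype) x y z := [/\ (0 < tlen t)%N,
  inj_below (tlen t) (tfac t), chain_space (tlen t) (tfac t) z, z 0%N = x & z (tlen t) = y].

Definition opt_chain (t : ctype) x y z := chain_of t x y z /\ clen (tlen t) z = dist x y.

Lemma chain_of_exists x y m s z : (0 < m)%N -> (m <= #|J|)%N -> inj_below m s ->
  @is_chain R P m s z -> z 0%N = x -> z m = y ->
  exists t z', chain_of t x y z' /\ clen (tlen t) z' = clen m z.
Proof.
move=> m0 mJ inj ch z0 zm.
have mJ' : (m < #|J|.+1)%N by [].
exists (Ordinal mJ', [ffun k : 'I_#|J|.+1 => s k]), (fun k => if (k <= m)%N then z k else y).
set t := (_, _) : ctype.
have tk k : (k < m)%N -> tfac t k = s k.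
  by move=> km; rewrite /tfac ffunE inordK//; lia.
split; last first.
  by apply: eq_big_nat => k /andP[_ km]; rewrite /tlen /= in km *; rewrite km ltnW.
split => //=.
- by move=> k l kl ll; rewrite !tk//; apply: inj.
- split=> [k|k km].
    case: ifPn => [km|_]; first exact: chain_surface ch m0 km.
    by rewrite -zm; apply: chain_surface ch m0 _.
  by rewrite /tlen /= in km; rewrite tk// km ltnW//; exact: ch.
- by rewrite /tlen /= leqnn.
Qed.

Lemma chain_of_dist t x y z : chain_of t x y z -> dist x y <= clen (tlen t) z.
Proof. by move=> [t0 _ [_ ch] z0 zm]; apply: dist_le_clen ch t0 z0 zm. Qed.

(** For each type the length attains its minimum. If no minimum were the distance, they would all
    exceed it by some e > 0, against a curve of length at most [dist x y + e / 2] and the chain it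
    dominates. *)
Lemma opt_chain_exists x y : S x -> S y -> x != y -> exists t z, opt_chain t x y z.
Proof.
move=> Sx Sy xy; apply: contrapT => H.
pose Q (t : ctype) (e : R) := forall z, chain_of t x y z -> dist x y + e <= clen (tlen t) z.
have [||e e0 he] := @fin_radius R ctype Q.
- by move=> t r r' rr Hr z ch; apply: le_trans (Hr z ch); rewrite lerD2l.
- move=> t.
  have [[inj t0]|ninj] := pselect (inj_below (tlen t) (tfac t) /\ (0 < tlen t)%N); last first.
    by exists 1 => // z [t0 inj _ _ _]; case: ninj.
  pose A : set Z := [set z : Z | z 0%N = x] `&` [set z : Z | z (tlen t) = y].
  have cA : closed A.
    apply: closedI; apply: (@closed_coord _ [set _]);
    by apply: compact_closed; [exact: norm_hausdorff|exact: compact_set1].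
  have [ne|em] := pselect ((chain_space (tlen t) (tfac t) `&` A) !=set0); last first.
    by exists 1 => // z [_ _ cz zx zy]; case: em; exists z.
  have [c [cc [cx cy]] hc] := chain_space_min (@continuous_clen (tlen t)) cA ne.
  have cht : chain_of t x y c by split.
  have lt : dist x y < clen (tlen t) c.
    rewrite lt_def (chain_of_dist cht) andbT; apply/eqP => e; apply: H.
    by exists t, c.
  exists (clen (tlen t) c - dist x y); first by rewrite subr_gt0.
  move=> z [_ _ cz zx zy]; rewrite addrC subrK; apply: (hc z).
  by split.
have [C _ hC] := surface_conn_bound P.
have cn : conn S x y (dist x y + e / 2).
  by apply: (rho_conn (hC _ _ Sx Sy)); rewrite divr_gt0.
have [m [s [z [/andP[m0 mJ] inj ch [z0 zm] hz]]]] := curve_chain xy cn.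
have [t [z' [ct e']]] := chain_of_exists m0 mJ inj ch z0 zm.
have := he t z' ct; rewrite e' => h1; have := le_trans h1 hz; lra.
Qed.

(** The function G vanishes exactly on the optimal chains of type t from x to y. If there are none,
    its minimum on the compact chain space is positive, which excludes optimal chains of type t
    between nearby points. *)
Lemma opt_type_local x y : S x -> S y ->
  exists2 r : R, 0 < r & forall x' y', S x' -> S y' -> enorm (x' - x) < r ->
    enorm (y' - y) < r -> forall t z', opt_chain t x' y' z' -> exists z, opt_chain t x y z.
Proof.
move=> Sx Sy.
have [r1 r10 hr1] := dist_local Sx; have [r2 r20 hr2] := dist_local Sy.
pose Q (t : ctype) (r : R) := forall x' y', S x' -> S y' -> enorm (x' - x) < r ->
    enorm (y' - y) < r -> forall z', opt_chain t x' y' z' -> exists z, opt_chain t x y z.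
suff [r r0 hr] : exists2 r, 0 < r & forall t, Q t r.
  by exists r => // x' y' Sx' Sy' xx yy t; exact: hr.
apply: fin_radius => [t r r' rr H x' y' Sx' Sy' xx yy|t].
  by apply: H => //; apply: lt_le_trans rr.
have [ex|nex] := pselect (exists z, opt_chain t x y z); first by exists 1.
have [[inj t0]|ninj] := pselect (inj_below (tlen t) (tfac t) /\ (0 < tlen t)%N); last first.
  by exists 1 => // x' y' _ _ _ _ z [[t0 inj _ _ _] _]; case: ninj.
pose G (z : Z) : R := enorm (z 0%N - x) + enorm (z (tlen t) - y) + `|clen (tlen t) z - dist x y|.
have Gc : continuous G.
  apply: (@continuous_add R Z R^o); first apply: (@continuous_add R Z R^o).
  - apply: (@continuous_enorm_coord (fun z : Z => z 0%N - x)).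
    exact: (continuous_sub (@coord_vec_continuous 0%N) (@cst_continuous Z V x)).
  - apply: (@continuous_enorm_coord (fun z : Z => z (tlen t) - y)).
    exact: (continuous_sub (@coord_vec_continuous _) (@cst_continuous Z V y)).
  apply: continuous_norm.
  exact: (@continuous_sub R Z R^o _ _ (@continuous_clen _) (@cst_continuous Z R _)).
have [ne|em] := pselect ((chain_space (tlen t) (tfac t) `&` setT) !=set0); last first.
  by exists 1 => // x' y' _ _ _ _ z [[_ _ cz _ _] _]; case: em; exists z.
have [c [cc _] hc] := chain_space_min Gc closedT ne.
have G0 : 0 < G c.
  rewrite lt_def; apply/andP; split; last by rewrite !addr_ge0 ?enorm_ge0.
  apply/eqP => Gc0; apply: nex; exists c.
  have a := enorm_ge0 (c 0%N - x); have b := enorm_ge0 (c (tlen t) - y).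
  have d := normr_ge0 (clen (tlen t) c - dist x y); rewrite /G in Gc0.
  have ea : enorm (c 0%N - x) = 0 by lra.
  have eb : enorm (c (tlen t) - y) = 0 by lra.
  have ed : `|clen (tlen t) c - dist x y| = 0 by lra.
  split; last by apply/eqP; rewrite -subr_eq0 -normr_eq0 ed.
  by split => //; apply/eqP; rewrite -subr_eq0 -enorm_eq0 ?ea ?eb.
(* On an optimal chain from x' to y', G is at most twice the sum of the two displacements, hence the
   factor 4. *)
exists (Num.min (Num.min r1 r2) (G c / 4)).
  by rewrite !lt_min r10 r20 divr_gt0.
move=> x' y' Sx' Sy'; rewrite !lt_min => /andP[/andP[x1 _] xc] /andP[/andP[_ y2] yc].
move=> z [[_ _ cz zx zy] zl]; exfalso.
have := hc z (conj cz I); rewrite /G zx zy zl.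
have := dist_lipschitz Sx Sy Sx' Sy'; rewrite (hr1 x')// (hr2 y')//.
rewrite (enormB x) (enormB y) (distrC (dist x' y')); rewrite /G in xc yc; lra.
Qed.

End OptimalChains.

(** * Straightness of shortest paths across edges *)

Section Rotation.
Variable R : realType.
Local Notation V := 'rV[R]_3.
Implicit Types (a b u v w x : V).

Definition coV := (coD, coN, coZ).

(** For unit vectors with a != - b, the rotation that takes b to a and fixes the vectors orthogonal
    to both. *)
Definition rot a b v : V := v - ((a + b) ∙ v / (1 + a ∙ b)) *: (a + b)
  + (2 * (b ∙ v)) *: a.

Lemma rotD a b u v : rot a b (u + v) = rot a b u + rot a b v.
Proof. by apply: vecP; rewrite /rot !dotE !coV; ring. Qed.

Lemma rotZ a b (c : R) v : rot a b (c *: v) = c *: rot a b v.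
Proof. by apply: vecP; rewrite /rot !dotE !coV; ring. Qed.

Lemma rot_fix a b v : a ∙ v = 0 -> b ∙ v = 0 -> rot a b v = v.
Proof.
move=> av bv; rewrite /rot dotpDl av bv addr0 mul0r mulr0 !scale0r subr0 addr0.
by [].
Qed.

Section Unit.
Variables a b : V.
Hypotheses (a1 : a ∙ a = 1) (b1 : b ∙ b = 1) (ab : 1 + a ∙ b != 0).

Lemma rot_dot u v : rot a b u ∙ rot a b v = u ∙ v.
Proof.
rewrite /rot !dotE (dotpC b a) (dotpC u a) (dotpC u b) a1 b1.
by field.
Qed.

Lemma rot_map : rot a b b = a.
Proof.
apply: vecP; rewrite /rot !dotE b1 !coV; field => //.
Qed.

Lemma rot_inv v : rot b a (rot a b v) = v.
Proof.
apply: vecP; rewrite /rot !dotE (dotpC b a) a1 b1 !coV; field;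
  by rewrite ?(addrC (a ∙ b)).
Qed.

Definition refl w v : V := v - (2 * (w ∙ v) / (w ∙ w)) *: w.

Lemma refl_cross w u v : w != 0 ->
  cross (refl w u) (refl w v) = - refl w (cross u v).
Proof.
rewrite -dotp_eq0 /refl => w0.
have e (c d : R) : cross (u - c *: w) (v - d *: w)
  = cross u v - d *: cross u w + c *: cross v w.
  by apply: vecP; rewrite /cross !(coD, coN, coZ, co_vec); ring.
rewrite e.
have e2 : (w ∙ w) *: cross u v = (w ∙ cross u v) *: w
   + (w ∙ u) *: cross w v - (w ∙ v) *: cross w u.
  by apply: vecP; rewrite /cross !coE; ring.
rewrite (crossC u w) (crossC v w).
have fin (N T p q X A B W : R) : N != 0 -> N * X = T * W + p * B - q * A ->
    X - 2 * q / N * - A + 2 * p / N * - B = - (X - 2 * T / N * W).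
  move=> N0 eX; have -> : X = (T * W + p * B - q * A) / N by rewrite -eX mulrC mulKf.
  by field.
by apply: vecP; rewrite !coV; apply: fin => //;
  [have := congr1 (@co0 R) e2|have := congr1 (@co1 R) e2|have := congr1 (@co2 R) e2];
  rewrite !coV.
Qed.

Lemma rot_refl v : rot a b v = refl (a + b) (refl b v).
Proof.
have e : (a + b) ∙ (a + b) = 2 * (1 + a ∙ b).
  by rewrite !dotE (dotpC b a) a1 b1; ring.
apply: vecP; rewrite /rot /refl e !dotE b1 !coV; field => //.
Qed.

(** The rotation is a product of two reflections, and each of them reverses cross products. *)
Lemma rot_cross u v : rot a b (cross u v) = cross (rot a b u) (rot a b v).
Proof.
have b0 : b != 0 by rewrite -dotp_gt0 b1.
have ab0 : a + b != 0.
  rewrite -dotp_eq0 !dotE (dotpC b a) a1 b1.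
  by rewrite (_ : _ + _ = 2 * (1 + a ∙ b)) ?mulf_neq0 ?pnatr_eq0//; ring.
rewrite !rot_refl !refl_cross// /refl.
by apply: vecP; rewrite !dotE !coV; ring.
Qed.

End Unit.

Lemma orth_triple u v w x : triple u v w != 0 -> x ∙ u = 0 -> x ∙ v = 0 -> x ∙ w = 0 ->
  x = 0.
Proof.
move=> t0 xu xv xw; have := cross_triple u v w x; rewrite xu xv xw !scale0r !addr0.
by move=> /eqP; rewrite scaler_eq0 (negbTE t0) => /eqP.
Qed.

Lemma triple_gram u v w : triple u v w ^+ 2 =
  (u ∙ u) * ((v ∙ v) * (w ∙ w) - (v ∙ w) ^+ 2)
  - (u ∙ v) * ((u ∙ v) * (w ∙ w) - (v ∙ w) * (u ∙ w))
  + (u ∙ w) * ((u ∙ v) * (v ∙ w) - (v ∙ v) * (u ∙ w)).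
Proof. by rewrite /triple /cross !coE; ring. Qed.

Lemma enorm_collinear u v : u != 0 -> v != 0 -> enorm (u + v) = enorm u + enorm v ->
  (enorm v)^-1 *: v = (enorm u)^-1 *: u.
Proof.
rewrite -!enorm_gt0 => u0 v0 e.
have uv : u ∙ v = enorm u * enorm v.
  have := enorm_sqr (u + v); rewrite e sqrrD !enorm_sqr !dotE (dotpC v u); lra.
apply/eqP; rewrite -subr_eq0 -dotp_eq0 !dotE (dotpC v u) uv -!enorm_sqr.
by apply/eqP; field; rewrite !gt_eqF.
Qed.

(** Chooses a scale e at which a quadratic error e^2 c is beaten by a linear gain e a. *)
Lemma small_pos (a b c : R) : 0 < a -> 0 < b -> exists e, [/\ 0 < e, e <= b & e * c < a].
Proof.
move=> a0 b0; have c0 : 0 < `|c| + 1 by rewrite ltr_wpDl.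
exists (Num.min b (a / (2 * (`|c| + 1)))).
set e := Num.min _ _.
have e0 : 0 < e by rewrite lt_min b0 divr_gt0// mulr_gt0.
have ea : e * (2 * (`|c| + 1)) <= a.
  by rewrite -ler_pdivlMr ?mulr_gt0// ge_min lexx orbT.
split => //; first by rewrite ge_min lexx.
have := ler_norm c; nra.
Qed.

End Rotation.

Section Bend.
Variables (R : realType) (P : polytope R).
Local Notation V := 'rV[R]_3.
Local Notation J := (facet P).
Local Notation n := (@normal R P).
Local Notation h := (@height R P).
Local Notation o := (center P).
Local Notation S := (surface P).
Local Notation face := (@face R P).
Local Notation dist := (@dist R P).
Implicit Types (x y p q u v : V) (i j k : J).

Lemma normal_center i p : n i ∙ p = h i -> n i ∙ (o - p) < 0.
Proof. by move=> ip; rewrite dotpB ip subr_lt0 center_lt. Qed.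

(** With opposite normals at p, the center would be strictly on both sides of the same plane. This
    makes [rot] available across every edge. *)
Lemma normal_opp i j p : n i ∙ p = h i -> n j ∙ p = h j -> 1 + n i ∙ n j != 0.
Proof.
move=> /normal_center ip /normal_center jp; apply/eqP => e.
have : (n i + n j) ∙ (n i + n j) == 0.
  by rewrite !dotE !normal1 (dotpC (n j)); apply/eqP; lra.
rewrite dotp_eq0 => /eqP e2; move: ip jp.
have -> : n j = - n i by apply/eqP; rewrite -addr_eq0 addrC e2.
by rewrite dotpNl; lra.
Qed.

Lemma normal_inj i j : n i = n j -> i = j.
Proof.
move=> e; apply/eqP/negPn/negP => ij.
have [q iq hq] := irredundant i; have [q' jq hq'] := irredundant j.
have := hq j; rewrite eq_sym ij => /(_ isT); have := hq' i ij.
rewrite -e iq; rewrite -e in jq; rewrite jq; lra.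
Qed.

Lemma cross_normal i j p : i != j -> n i ∙ p = h i -> n j ∙ p = h j ->
  cross (n i) (n j) != 0.
Proof.
move=> ij ip jp; rewrite -dotp_eq0 cross_sqr !normal1 mulr1.
have c1 := normal_opp ip jp; apply/eqP => e.
have : (1 + n i ∙ n j) * (1 - n i ∙ n j) = 0 by rewrite -e; ring.
move/eqP; rewrite mulf_eq0 (negbTE c1) /= => /eqP c2.
have : (n i - n j) ∙ (n i - n j) == 0.
  by rewrite !dotE !normal1 (dotpC (n j)); apply/eqP; lra.
rewrite dotp_eq0 subr_eq0 => /eqP /normal_inj e'; by rewrite e' eqxx in ij.
Qed.

(** Take a dependence a n_i + b n_j + c n_k = 0 with c > 0 and evaluate it at the irredundance
    witnesses. The one of j gives a < 0, then the one of k gives b > 0, and the one of i is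
    contradicted, since b and c are both positive. *)
Lemma triple_normal i j k p : i != j -> j != k -> k != i ->
  n i ∙ p = h i -> n j ∙ p = h j -> n k ∙ p = h k -> triple (n i) (n j) (n k) != 0.
Proof.
move=> ij jk ki ip jp kp; apply/eqP => t0.
set t := cross (n i) (n j).
(* Cramer's coefficients of t; the last one is t ∙ t > 0. *)
pose a := triple t (n j) (n k); pose b := triple (n i) t (n k); pose c := triple (n i) (n j) t.
have rel : a *: n i + b *: n j + c *: n k = 0.
  by rewrite -triple_expand t0 scale0r.
have c0 : 0 < c by rewrite /c /triple -/t dotp_gt0 (cross_normal ij ip jp).
have ev q : a * (n i ∙ (q - p)) + b * (n j ∙ (q - p)) + c * (n k ∙ (q - p)) = 0.
  by have := congr1 (fun v => v ∙ (q - p)) rel; rewrite !dotpDl !dotpZl dotp0l.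
have [q qk hk] := irredundant k.
have [r rj hj] := irredundant j.
have [s si hi] := irredundant i.
have := ev q; have := ev r; have := ev s; rewrite !dotpB qk rj si ip jp kp.
rewrite !subrr !mulr0 => e1 e2 e3.
have neg i' q' : n i' ∙ q' < h i' -> n i' ∙ q' - h i' < 0 by rewrite subr_lt0.
have h1 : n i ∙ q - h i < 0 by apply/neg/hk; rewrite eq_sym.
have h2 : n j ∙ q - h j < 0 by apply/neg/hk.
have h3 : n i ∙ r - h i < 0 by apply/neg/hj.
have h4 : n k ∙ r - h k < 0 by apply/neg/hj; rewrite eq_sym.
have h5 : n j ∙ s - h j < 0 by apply/neg/hi; rewrite eq_sym.
have h6 : n k ∙ s - h k < 0 by apply/neg/hi.
have a0 : a < 0.
  rewrite ltNge; apply/negP => a0; have := mulr_ge0_le0 a0 (ltW h3).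
  have : c * (n k ∙ r - h k) < 0 by rewrite pmulr_rlt0.
  lra.
have b0 : 0 < b.
  rewrite ltNge; apply/negP => b0; have := mulr_le0 b0 (ltW h2).
  have : 0 < a * (n i ∙ q - h i) by rewrite nmulr_rgt0.
  lra.
have : b * (n j ∙ s - h j) < 0 by rewrite pmulr_rlt0.
have : c * (n k ∙ s - h k) < 0 by rewrite pmulr_rlt0.
lra.
Qed.

Lemma dist_conn_pr x y (r : R) : body P x -> body P y -> conn S (pr P x) (pr P y) r ->
  dist x y <= r.
Proof. by move=> Kx Ky; rewrite (prE Kx) (prE Ky); exact: dist_le. Qed.

Variables (i j : J) (x p y : V).
Hypotheses (ij : i != j) (ix : face i x) (ip : face i p) (jp : face j p) (jy : face j y).
Hypotheses (xp : x != p) (yp : y != p).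
Hypothesis short : dist x y = enorm (x - p) + enorm (p - y).
Variables al be : V.
Hypotheses (alE : al = (enorm (x - p))^-1 *: (x - p))
  (beE : be = (enorm (y - p))^-1 *: (y - p)).
Let t : V := cross (n i) (n j).

Let xp0 : x - p != 0. Proof. by rewrite subr_eq0. Qed.
Let yp0 : y - p != 0. Proof. by rewrite subr_eq0. Qed.
Let lx : 0 < enorm (x - p). Proof. by rewrite enorm_gt0. Qed.
Let ly : 0 < enorm (y - p). Proof. by rewrite enorm_gt0. Qed.

Let ial : n i ∙ al = 0.
Proof. by rewrite alE dotpZr dotpB (proj2 ix) (proj2 ip) subrr mulr0. Qed.
Let jbe : n j ∙ be = 0.
Proof. by rewrite beE dotpZr dotpB (proj2 jy) (proj2 jp) subrr mulr0. Qed.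
Let al1 : al ∙ al = 1.
Proof. by rewrite alE dotpZr dotpZl -enorm_sqr; field; rewrite gt_eqF. Qed.
Let be1 : be ∙ be = 1.
Proof. by rewrite beE dotpZr dotpZl -enorm_sqr; field; rewrite gt_eqF. Qed.
Let kal k : n k ∙ p = h k -> n k ∙ al <= 0.
Proof.
move=> kp; rewrite alE dotpZr dotpB kp; apply: mulr_ge0_le0; first by rewrite invr_ge0 ltW.
by rewrite subr_le0; have [+ _] := ix; apply.
Qed.
Let kbe k : n k ∙ p = h k -> n k ∙ be <= 0.
Proof.
move=> kp; rewrite beE dotpZr dotpB kp; apply: mulr_ge0_le0; first by rewrite invr_ge0 ltW.
by rewrite subr_le0; have [+ _] := jy; apply.
Qed.

Let legx v : enorm (x - (p + v)) <= enorm (x - p) - al ∙ v + (v ∙ v) / (2 * enorm (x - p)).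
Proof.
have := enorm_add_le (- v) xp0; rewrite !dotpNr dotpNl opprK.
rewrite (_ : x - p - v = x - (p + v)); last by rewrite opprD addrA.
rewrite (_ : - ((x - p) ∙ v) / _ = - (al ∙ v))//.
by rewrite alE dotpZl mulNr mulrC.
Qed.
Let legy v : enorm (p + v - y) <= enorm (p - y) - be ∙ v + (v ∙ v) / (2 * enorm (p - y)).
Proof.
have := enorm_add_le (- v) yp0; rewrite !dotpNr dotpNl opprK.
rewrite (_ : y - p - v = y - (p + v)); last by rewrite opprD addrA.
rewrite (enormB y) (enormB p y) (_ : - ((y - p) ∙ v) / _ = - (be ∙ v))//.
by rewrite beE dotpZl mulNr mulrC.
Qed.

(** Here al and be point from p to x and to y. Sliding p by a vector u along the edge line changes
    the length by - (al + be) ∙ u to first order. The slid point may leave the edge, since the legs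
    are projected. *)
Lemma bend_tangent : (al + be) ∙ t = 0.
Proof.
apply/eqP/negPn/negP => ne.
have [u [iu ju pos]] : exists u, [/\ n i ∙ u = 0, n j ∙ u = 0 & 0 < (al + be) ∙ u].
  have [lt|ge] := ltP 0 ((al + be) ∙ t).
    by exists t; rewrite lt (dotpC (n i)) (dotpC (n j)) /t cross_orthol cross_orthor.
  exists (- t); rewrite !dotpNr (dotpC (n i)) (dotpC (n j)) /t cross_orthol cross_orthor.
  by rewrite oppr0 oppr_gt0 lt_neqAle ne ge.
pose C := (u ∙ u) / (2 * enorm (x - p)) + (u ∙ u) / (2 * enorm (p - y)).
have [e [e0 _ eC]] := small_pos C pos ltr01.
have : dist x y <= enorm (x - (p + e *: u)) + enorm (p + e *: u - y).
  apply: (dist_conn_pr (proj1 ix) (proj1 jy)).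
  apply: (@conn_trans _ _ _ (pr P (p + e *: u))).
    by apply: (@conn_pr _ _ i); rewrite ?(proj2 ix)// !dotE iu (proj2 ip) mulr0 addr0.
  by apply: (@conn_pr _ _ j); rewrite ?(proj2 jy)// !dotE ju (proj2 jp) mulr0 addr0.
have := legx (e *: u); have := legy (e *: u); rewrite !(dotpZr e) !(dotpZl e) short.
move: pos eC; rewrite /C dotpDl.
set c1 := _ / (2 * enorm (x - p)); set c2 := _ / (2 * enorm (p - y)).
have -> : e * (e * (u ∙ u)) / (2 * enorm (x - p)) = e * (e * c1) by rewrite /c1 !mulrA.
have -> : e * (e * (u ∙ u)) / (2 * enorm (p - y)) = e * (e * c2) by rewrite /c2 !mulrA.
move=> pos eC l1 l2 l3.
have : 0 <= e * (e * (c1 + c2) - (al ∙ u + be ∙ u)) by lra.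
by rewrite pmulr_rge0// leNgt subr_lt0 eC.
Qed.

(* If p lies on a third facet, the path can be shortened by cutting across it. *)
Lemma bend_normal k : n k ∙ p = h k -> n k ∙ t = 0.
Proof.
move=> kp; apply/eqP/negPn/negP => ne.
have [u [iu ju ku abu tu]] : exists u, [/\ n i ∙ u = 0, n j ∙ u = 0, 0 < n k ∙ u,
    (al + be) ∙ u = 0 & forall v, v ∙ u = 0 -> v ∙ t = 0].
  have it : n i ∙ t = 0 by rewrite dotpC cross_orthol.
  have jt : n j ∙ t = 0 by rewrite dotpC cross_orthor.
  have [lt|ge] := ltP 0 (n k ∙ t); first by exists t; rewrite bend_tangent.
  exists (- t); rewrite !dotpNr it jt bend_tangent oppr0; split => //.
    by rewrite oppr_gt0 lt_neqAle ne ge.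
  by move=> v; rewrite dotpNr => /eqP; rewrite oppr_eq0 => /eqP.
(* The size s is such that u + s al and u + s be still point beyond the plane of k. *)
have [s1 [s10 _ h1]] := small_pos (- (n k ∙ al)) ku ltr01.
have [s [s0 ss h2]] := small_pos (- (n k ∙ be)) ku s10.
have k1 : 0 <= n k ∙ (u + s *: al).
  rewrite !dotE; have := kal kp; nra.
have k2 : 0 <= n k ∙ (u + s *: be) by rewrite !dotE; nra.
(* If al and be were opposite, be would be orthogonal to the three independent normals. *)
have lt2 : enorm (al - be) < 2.
  rewrite ltNge; apply/negP => ge2.
  have : 4 <= (al - be) ∙ (al - be).
    by rewrite -enorm_sqr; have := enorm_ge0 (al - be); nra.
  rewrite !dotE al1 be1 (dotpC be) => ge4.
  have : (al + be) ∙ (al + be) == 0.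
    rewrite eq_le dotp_ge0 andbT !dotE al1 be1 (dotpC be); lra.
  rewrite dotp_eq0 addr_eq0 => /eqP alN.
  have ib : n i ∙ be = 0 by have := ial; rewrite alN dotpNr => /eqP; rewrite oppr_eq0 => /eqP.
  have kb : n k ∙ be = 0.
    by apply/le_anti; rewrite kbe//= -oppr_le0 -dotpNr -alN kal.
  have b0 : be = 0.
    apply: (@orth_triple _ (n i) (n j) (n k)); rewrite 1?dotpC//.
    by rewrite /triple -/t dotpC.
  by move: be1; rewrite b0 dotp0l => /eqP; rewrite eq_sym oner_eq0.
(* The shortcut leaves the plane of i at p + e v1 and reaches the plane of j at p + e v2. To first
   order the two legs lose 2 e s together, as (al + be) ∙ u = 0, while the cut costs e s |al - be| <
   2 e s. *)
pose v1 := u + s *: al; pose v2 := u + s *: be.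
pose C := (v1 ∙ v1) / (2 * enorm (x - p)) + (v2 ∙ v2) / (2 * enorm (p - y)).
have [e [e0 _ eC]] := small_pos C (mulr_gt0 s0 (etrans (subr_gt0 _ _) lt2)) ltr01.
have : dist x y <= enorm (x - (p + e *: v1)) + enorm ((p + e *: v1) - (p + e *: v2))
    + enorm (p + e *: v2 - y).
  apply: (dist_conn_pr (proj1 ix) (proj1 jy)).
  apply: (@conn_trans _ _ _ (pr P (p + e *: v2))).
    apply: (@conn_trans _ _ _ (pr P (p + e *: v1))).
      apply: (@conn_pr _ _ i); rewrite ?(proj2 ix)//.
      by rewrite /v1 !dotE iu ial (proj2 ip) mulr0 !addr0 mulr0 addr0.
    by apply: (@conn_pr _ _ k); rewrite dotpDr kp dotpZr lerDl mulr_ge0// ltW.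
  apply: (@conn_pr _ _ j); rewrite ?(proj2 jy)//.
  by rewrite /v2 !dotE ju jbe (proj2 jp) mulr0 !addr0 mulr0 addr0.
have -> : p + e *: v1 - (p + e *: v2) = (e * s) *: (al - be).
  by apply: vecP; rewrite /v1 /v2 !coV; ring.
rewrite enormZ gtr0_norm ?mulr_gt0//.
have := legx (e *: v1); have := legy (e *: v2); rewrite !(dotpZr e) !(dotpZl e) short.
have -> : al ∙ v1 = al ∙ u + s by rewrite /v1 !dotE al1 mulr1.
have -> : be ∙ v2 = be ∙ u + s by rewrite /v2 !dotE be1 mulr1.
move: abu eC; rewrite /C dotpDl; set c1 := _ / (2 * enorm (x - p)); set c2 := _ / (2 * enorm (p - y)).
have -> : e * (e * (v1 ∙ v1)) / (2 * enorm (x - p)) = e * (e * c1) by rewrite /c1 !mulrA.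
have -> : e * (e * (v2 ∙ v2)) / (2 * enorm (p - y)) = e * (e * c2) by rewrite /c2 !mulrA.
move=> abu eC l1 l2 l3.
have : 0 <= e * (e * (c1 + c2) - s * (2 - enorm (al - be))).
  have : be ∙ u = - (al ∙ u) by lra.
  move=> bu; rewrite bu in l1; lra.
by rewrite pmulr_rge0// leNgt subr_lt0 eC.
Qed.

(** The components along the edge cancel by [bend_tangent]. By the Gram determinant n_j ∙ al and n_i
    ∙ be then have the same square; both are nonpositive by convexity, hence equal. So the sum of
    the two vectors is orthogonal to n_i, n_j and t. *)
Lemma bend_rot : rot (n i) (n j) be = - al.
Proof.
have c1 := normal_opp (proj2 ip) (proj2 jp).
have tn0 := cross_normal ij (proj2 ip) (proj2 jp).
have it : n i ∙ t = 0 by rewrite dotpC cross_orthol.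
have jt : n j ∙ t = 0 by rewrite dotpC cross_orthor.
have gram (a b w : V) : a ∙ a = 1 -> b ∙ b = 1 -> w ∙ w = 1 -> a ∙ w = 0 ->
    (cross a b ∙ w) ^+ 2 = 1 - (a ∙ b) ^+ 2 - (b ∙ w) ^+ 2.
  by move=> a1 b1 w1 aw; have := triple_gram a b w; rewrite /triple a1 b1 w1 aw => ->; ring.
have ga := gram _ _ _ (normal1 i) (normal1 j) al1 ial.
have gb := gram _ _ _ (normal1 j) (normal1 i) be1 jbe.
have bt : (al + be) ∙ t = 0 := bend_tangent.
have E : n j ∙ al = n i ∙ be.
  have ja := kal (proj2 jp); have ib := kbe (proj2 ip).
  have sq : (n j ∙ al) ^+ 2 = (n i ∙ be) ^+ 2.
    move: ga gb; rewrite (crossC (n j)) -/t dotpNl sqrrN (dotpC (n j) (n i)).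
    have -> : t ∙ be = - (t ∙ al) by move: bt; rewrite dotpC dotpDr; lra.
    by rewrite sqrrN; lra.
  have : (n j ∙ al - n i ∙ be) * (n j ∙ al + n i ∙ be) = 0.
    by rewrite -subr_sqr sq subrr.
  by move/eqP; rewrite mulf_eq0 => /orP[/eqP|/eqP]; lra.
apply/eqP; rewrite -addr_eq0; apply/eqP.
apply: (@orth_triple _ (n i) (n j) t); first by rewrite /triple dotp_eq0.
- have := rot_dot (normal1 i) (normal1 j) c1 be (n j).
  rewrite (rot_map (normal1 j) c1) => r1.
  by rewrite dotpDl r1 (dotpC be) jbe (dotpC al) ial addr0.
- rewrite dotpDl /rot !dotE (dotpC (n i) (n j)) normal1 (dotpC al (n j)) E jbe.
  rewrite (dotpC be (n j)) jbe; field.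
  by rewrite dotpC.
have := rot_dot (normal1 i) (normal1 j) c1 be t.
rewrite (rot_fix it jt) => rt.
by rewrite dotpDl rt addrC -dotpDl.
Qed.

End Bend.

Section Geodesics.
Variables (R : realType) (P : polytope R).
Local Notation V := 'rV[R]_3.
Local Notation J := (facet P).
Local Notation n := (@normal R P).
Local Notation h := (@height R P).
Local Notation o := (center P).
Local Notation S := (surface P).
Local Notation face := (@face R P).
Local Notation dist := (@dist R P).
Implicit Types (x y p q u v : V) (z : nat -> V) (i j : J) (s : nat -> J) (t : ctype P).

Definition dir z (k : nat) : V := (enorm (z k.+1 - z k))^-1 *: (z k.+1 - z k).

Lemma dir_scale z k : z k != z k.+1 -> enorm (z k.+1 - z k) *: dir z k = z k.+1 - z k.
Proof.
move=> zk; rewrite /dir scalerA mulfV ?scale1r//.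
by rewrite enorm_eq0 subr_eq0 eq_sym.
Qed.

Lemma dir1 z k : z k != z k.+1 -> dir z k ∙ dir z k = 1.
Proof.
move=> zk; have l0 : 0 < enorm (z k.+1 - z k) by rewrite enorm_gt0 subr_eq0 eq_sym.
by rewrite /dir dotpZl dotpZr -enorm_sqr; field; rewrite gt_eqF.
Qed.

(** The rotation clause is straightness in the unfolding; the strict inequality is transversality to
    the edge, needed as a denominator in [slide]. *)
Definition geodesic (m : nat) s z := [/\ (0 < m)%N /\ inj_below m s, is_chain m s z,
  forall k, (k < m)%N -> z k != z k.+1,
  forall k, (k.+1 < m)%N -> forall i, n i ∙ z k.+1 = h i -> i = s k \/ i = s k.+1 &
  forall k, (k.+1 < m)%N -> rot (n (s k)) (n (s k.+1)) (dir z k.+1) = dir z k /\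
    0 < n (s k.+1) ∙ dir z k].

Lemma opt_sub t x y z a b : opt_chain t x y z -> (a <= b)%N -> (b <= tlen t)%N ->
  dist (z a) (z b) = \sum_(a <= k < b) enorm (z k.+1 - z k).
Proof.
move=> [[t0 _ [Sz ch] z0 zm] e] ab bt.
apply/le_anti; rewrite (chain_dist ch)//=.
have := e; rewrite /clen (@big_cat_nat _ _ _ a)//=; last by lia.
rewrite (@big_cat_nat _ _ _ b a (tlen t))//=.
have ca := chain_dist ch t0 (leq0n a) (leq_trans ab bt).
have cb := chain_dist ch t0 bt (leqnn _).
have := dist_triangle (Sz 0%N) (Sz a) (Sz (tlen t)).
have := dist_triangle (Sz a) (Sz b) (Sz (tlen t)).
rewrite -z0 -zm; lra.
Qed.

Lemma opt_add t x y z a b c : opt_chain t x y z -> (a <= b)%N -> (b <= c)%N ->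
  (c <= tlen t)%N -> dist (z a) (z c) = dist (z a) (z b) + dist (z b) (z c).
Proof.
move=> oz ab bc ct; rewrite !(opt_sub oz)//; try lia.
by rewrite -big_cat_nat.
Qed.

(** An optimal chain may have zero legs. Those at y are cut off; one before y would make the path
    pass through a point of three facets, which [bend_normal] excludes, or would put a second facet
    at x. *)
Lemma opt_geodesic t x y z : x != y -> (forall i, n i ∙ x = h i -> i = tfac t 0) ->
  opt_chain t x y z -> exists m, [/\ (m <= tlen t)%N, geodesic m (tfac t) z,
    clen m z = dist x y & forall k, (m <= k)%N -> (k <= tlen t)%N -> z k = y].
Proof.
move=> xy Nx oz; have [[t0 inj [Sz ch] z0 zT] e] := oz.
have ex : exists k, z k == y by exists (tlen t); rewrite zT.
pose m := ex_minn ex.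
have zm : z m = y by rewrite /m; case: ex_minnP => k /eqP.
have mmin k : z k = y -> (m <= k)%N by move=> zk; rewrite /m; case: ex_minnP => l _; apply; rewrite zk.
have mT : (m <= tlen t)%N by exact: mmin.
have m0 : (0 < m)%N by rewrite lt0n; apply/eqP => e0; move: xy; rewrite -z0 -zm e0 eqxx.
set s := tfac t.
have legd k : (k < tlen t)%N -> dist (z k) (z k.+1) = enorm (z k - z k.+1).
  by move=> kt; have [f f'] := ch k kt; exact: dist_face f f'.
have neq k l : (k < tlen t)%N -> (l < tlen t)%N -> k <> l -> s k != s l.
  by move=> kt lt kl; apply/eqP => /inj; auto.
have nz k : (k < m)%N -> z k != z k.+1.
  elim/ltn_ind: k => k ih km; apply/eqP => zk.
  have k1m : (k.+1 < m)%N.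
    rewrite ltnNge; apply/negP => mk; have : k.+1 = m by lia.
    by move=> ek; have := mmin k; rewrite zk ek zm => /(_ erefl); lia.
  case: k ih km zk k1m => [|k] ih km zk k1m.
    have [f _] := ch 1%N (leq_trans k1m mT); have := Nx (s 1%N).
    rewrite -z0 zk (proj2 f) => /(_ erefl) /eqP; apply/negP.
    by apply: neq; lia.
  have zky : z k.+1 <> y by move=> /mmin; lia.
  have exl : exists l, (k.+1 <= l)%N && (z l.+1 != z k.+1).
    exists m.-1; rewrite prednK// zm; apply/andP; split; first by lia.
    by apply/eqP => e'; apply: zky.
  (* The next nonzero leg: the path bends at z (k + 1) from facet s k to facet s l, and facet s (k +
     1) is a third one there. *)
  pose l := ex_minn exl.
  have [lk zl lmin] : [/\ (k.+1 <= l)%N, z l.+1 != z k.+1 &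
      forall l', (k.+1 <= l')%N -> z l'.+1 != z k.+1 -> (l <= l')%N].
    rewrite /l; case: ex_minnP => l' /andP[a b] c; split => // l'' a' b'.
    by apply: c; rewrite a' b'.
  have lk1 : (k.+1 < l)%N.
    by rewrite ltn_neqAle lk andbT; apply/eqP => el; move: zl; rewrite -el zk eqxx.
  have lm : (l.+1 <= m)%N.
    have := lmin m.-1; rewrite prednK// zm => H.
    have : (l <= m.-1)%N by apply: H; [lia|apply/eqP => e'; apply: zky].
    by lia.
  have zlk : z l = z k.+1.
    apply/eqP/negPn/negP => ne; have := lmin l.-1; rewrite prednK; last by lia.
    by move=> /(_ _ ne); lia.
  have lT : (l < tlen t)%N by lia.
  have [fk fk1] := ch k (ltn_trans (ltnSn _) (leq_trans km mT)).
  have [fk2 _] := ch k.+1 (leq_trans km mT).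
  have [fl fl1] := ch l lT; rewrite -/s in fk fk1 fk2 fl fl1.
  have short : dist (z k) (z l.+1) = enorm (z k - z k.+1) + enorm (z k.+1 - z l.+1).
    rewrite (@opt_add t x y z k k.+1)//; try lia.
    rewrite legd; last by lia.
    by congr (_ + _); rewrite -zlk legd.
  have kl : s k != s l by apply: neq; lia.
  rewrite zlk in fl.
  have zk' : z k != z k.+1 by apply: ih; lia.
  have := bend_normal fk fk1 fl fl1 zk' zl short erefl erefl (proj2 fk2).
  move/eqP; apply/negP; rewrite dotpC.
  apply: (triple_normal kl _ _ (proj2 fk1) (proj2 fl) (proj2 fk2));
    apply: neq; lia.
have inner k : (k.+1 < m)%N -> [/\ s k != s k.+1, face (s k) (z k), face (s k) (z k.+1),
   face (s k.+1) (z k.+1) & face (s k.+1) (z k.+2)] /\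
   dist (z k) (z k.+2) = enorm (z k - z k.+1) + enorm (z k.+1 - z k.+2).
  move=> km; have [f1 f2] := ch k (leq_trans (ltnW km) mT).
  have [f3 f4] := ch k.+1 (leq_trans km mT); split.
    by split => //; apply: neq; lia.
  by rewrite (@opt_add t x y z k k.+1)// ?legd//; lia.
have bar k : (k.+1 < m)%N -> forall i, n i ∙ z k.+1 = h i -> i = s k \/ i = s k.+1.
  move=> km i iz; have [[ss f1 f2 f3 f4] sh] := inner k km.
  have z2 : z k.+2 != z k.+1 by rewrite eq_sym nz.
  have bn := bend_normal f1 f2 f3 f4 (nz k (ltnW km)) z2 sh erefl erefl iz.
  have [->|i1] := eqVneq i (s k); first by left.
  have [->|i2] := eqVneq i (s k.+1); first by right.
  have := triple_normal ss _ i1 (proj2 f2) (proj2 f3) iz.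
  by rewrite eq_sym i2 /triple dotpC bn eqxx => /(_ isT).
exists m; split => //; last first.
- move=> k mk kT; have := opt_sub oz mk kT; rewrite zm => dk.
  have : dist y (z k) = 0.
    have := opt_add oz mk kT (leqnn _); rewrite zm zT.
    have Sy : S y by rewrite -zT.
    have d1 : 0 <= dist y (z k) := rho_ge0 _ _ _.
    have d2 : 0 <= dist (z k) y := rho_ge0 _ _ _.
    by rewrite (dist_xx Sy); lra.
  have := dist_ge_enorm (Sz m) (Sz k); rewrite zm => /[swap] ->.
  move=> le0; apply/eqP; rewrite eq_sym -subr_eq0 -enorm_eq0.
  by rewrite eq_le le0 enorm_ge0.
- by rewrite /clen -(opt_sub oz)// z0 zm.
split => //.
- by split => // k l km lm; apply: inj; lia.
- by move=> k km; apply: ch; lia.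
move=> k km; have [[ss f1 f2 f3 f4] sh] := inner k km.
have z1 := nz k (ltnW km); have z2 := nz k.+1 km; split.
  have z2' : z k.+2 != z k.+1 by rewrite eq_sym.
  rewrite /dir (bend_rot ss f1 f2 f3 f4 z1 z2' sh erefl erefl).
  by rewrite -scalerN opprB enormB.
(* Transversality holds because z k is not on the next facet: by hypothesis when it is x, otherwise
   because it lies on its two facets only. *)
rewrite /dir dotpZr mulr_gt0 ?invr_gt0 ?enorm_gt0 ?subr_eq0 1?eq_sym//.
rewrite dotpB (proj2 f3) subr_gt0 lt_neqAle (proj1 f1) andbT; apply/eqP => hk.
case: k km ss f1 f2 f3 f4 sh z1 z2 hk => [|k] km ss f1 f2 f3 f4 sh z1 z2 hk.
  by move: hk; rewrite z0 => /Nx e1; move: ss; rewrite e1 eqxx.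
have [e1|e1] := bar k (ltnW km) _ hk; last by move: ss; rewrite e1 eqxx.
by have := neq k k.+2; rewrite e1 eqxx => H; apply/notF/H; lia.
Qed.

End Geodesics.

(** * Unfolding *)

Section Transport.
Variables (R : realType) (P : polytope R).
Local Notation V := 'rV[R]_3.
Local Notation J := (facet P).
Local Notation n := (@normal R P).
Local Notation h := (@height R P).
Local Notation S := (surface P).
Local Notation face := (@face R P).
Local Notation dist := (@dist R P).
Implicit Types (x y p q u v : V) (z : nat -> V) (i j : J) (s : nat -> J) (t : ctype P).

(* Unfolding: [tr s k] carries vectors of the plane of facet s k to the plane of
   facet s 0, rotating about the successive edges. *)
Fixpoint tr s (k : nat) v : V :=
  if k is k'.+1 then tr s k' (rot (n (s k')) (n (s k)) v) else v.

Lemma trD s k u v : tr s k (u + v) = tr s k u + tr s k v.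
Proof. by elim: k u v => //= k ih u v; rewrite rotD ih. Qed.

Lemma trZ s k (c : R) v : tr s k (c *: v) = c *: tr s k v.
Proof. by elim: k v => //= k ih v; rewrite rotZ ih. Qed.

Lemma trN s k v : tr s k (- v) = - tr s k v.
Proof. by rewrite -scaleN1r trZ scaleN1r. Qed.

Lemma trB s k u v : tr s k (u - v) = tr s k u - tr s k v.
Proof. by rewrite trD trN. Qed.

Lemma tr0 s k : tr s k 0 = 0.
Proof. by have := trZ s k 0 0; rewrite !scale0r. Qed.

Definition no_opp (m : nat) s := forall k, (k.+1 < m)%N -> 1 + n (s k) ∙ n (s k.+1) != 0.

Lemma chain_no_opp m s z : is_chain m s z -> no_opp m s.
Proof.
move=> ch k km; have [_ [_ f1]] := ch k (ltnW km); have [[_ f2] _] := ch k.+1 km.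
exact: (normal_opp f1 f2).
Qed.

Lemma tr_dot m s k u v : no_opp m s -> (k < m)%N -> tr s k u ∙ tr s k v = u ∙ v.
Proof.
move=> no; elim: k u v => //= k ih u v km.
by rewrite ih ?(ltnW km)// rot_dot ?normal1//; exact: no.
Qed.

Lemma enorm_tr m s k v : no_opp m s -> (k < m)%N -> enorm (tr s k v) = enorm v.
Proof. by move=> no km; rewrite /enorm (tr_dot _ _ no). Qed.

Lemma tr_cross m s k u v : no_opp m s -> (k < m)%N ->
  tr s k (cross u v) = cross (tr s k u) (tr s k v).
Proof.
move=> no; elim: k u v => //= k ih u v km.
by rewrite rot_cross ?normal1// ?ih ?(ltnW km)//; exact: no.
Qed.

Lemma tr_normal m s k : no_opp m s -> (k < m)%N -> tr s k (n (s k)) = n (s 0%N).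
Proof.
move=> no; elim: k => //= k ih km.
by rewrite rot_map ?normal1// ?ih ?(ltnW km)//; exact: no.
Qed.

Lemma geodesic_no_opp m s z : @geodesic R P m s z -> no_opp m s.
Proof. by move=> [_ ch _ _ _]; exact: chain_no_opp ch. Qed.

Lemma geodesic_dir m s z k : @geodesic R P m s z -> (k < m)%N -> tr s k (dir z k) = dir z 0.
Proof.
move=> [_ _ _ _ g]; elim: k => //= k ih km.
by have [-> _] := g k km; rewrite ih// ltnW.
Qed.

(* In the unfolding along the facets of z, the chain z' is a path between the
   displaced endpoints, so it is at least as long as the straight segment. *)
Lemma chain_unfold_ge m s z z' : is_chain m.+1 s z -> is_chain m.+1 s z' ->
  enorm (\sum_(0 <= k < m.+1) tr s k (z k.+1 - z k) + tr s m (z' m.+1 - z m.+1)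
    - (z' 0%N - z 0%N)) <= clen m.+1 z'.
Proof.
move=> ch ch'; have no := chain_no_opp ch.
have E l : (l <= m)%N -> \sum_(0 <= k < l.+1) tr s k (z k.+1 - z k)
    + tr s l (z' l.+1 - z l.+1) - (z' 0%N - z 0%N)
    = \sum_(0 <= k < l.+1) tr s k (z' k.+1 - z' k).
  elim: l => [_|l ih lm].
    by rewrite !big_nat1 /=; apply: vecP; rewrite !coV; ring.
  (* Both vertices lie on the line common to the two facet planes, which the rotation fixes. *)
  have fx : rot (n (s l)) (n (s l.+1)) (z' l.+1 - z l.+1) = z' l.+1 - z l.+1.
    have [_ [_ a1]] := ch l (ltnW lm); have [_ [_ a2]] := ch' l (ltnW lm).
    have [[_ a3] _] := ch l.+1 lm; have [[_ a4] _] := ch' l.+1 lm.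
    by rewrite rot_fix// dotpB ?a1 ?a2 ?a3 ?a4 subrr.
  have st : tr s l.+1 (z' l.+2 - z' l.+1) = tr s l.+1 (z l.+2 - z l.+1)
      + tr s l.+1 (z' l.+2 - z l.+2) - tr s l (z' l.+1 - z l.+1).
    have -> : tr s l (z' l.+1 - z l.+1) = tr s l.+1 (z' l.+1 - z l.+1) by rewrite /= fx.
    by rewrite -trD -trB; congr tr; apply: vecP; rewrite !coV; ring.
  rewrite (big_nat_recr l.+1)// [RHS](big_nat_recr l.+1)// -ih ?st; last by lia.
  move: (tr s l.+1 _) (tr s l.+1 _) (tr s l _) (\sum_(0 <= k < l.+1) _) => a1 a2 a3 a4.
  by apply: vecP; rewrite /= !coV; ring.
rewrite (E m (leqnn m)); apply: le_trans (enorm_sum _ _) _.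
rewrite le_eqVlt; apply/orP; left; apply/eqP; apply: eq_big_nat => k /andP[_ km].
exact: enorm_tr no km.
Qed.

Lemma geodesic_unfold m s z : @geodesic R P m s z ->
  \sum_(0 <= k < m) tr s k (z k.+1 - z k) = clen m z *: dir z 0.
Proof.
move=> g; have [_ _ nz _ _] := g.
rewrite /clen scaler_suml; apply: eq_big_nat => k /andP[_ km].
by rewrite -(geodesic_dir g km) -trZ dir_scale// nz.
Qed.

(* The facets of t visited only by trailing zero legs do not affect vectors tangent
   at the endpoint, see [trT_tangent]. *)
Definition trT t v : V := tr (tfac t) (tlen t).-1 v.

Definition tangent y v := forall i, n i ∙ y = h i -> n i ∙ v = 0.

(** The facets of the trailing legs contain y, so the rotations between them fix vectors tangent at
    y. *)
Lemma trT_tangent t m z y v : (0 < m)%N -> (m <= tlen t)%N ->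
  is_chain (tlen t) (tfac t) z -> (forall k, (m <= k)%N -> (k <= tlen t)%N -> z k = y) ->
  tangent y v -> trT t v = tr (tfac t) m.-1 v.
Proof.
move=> m0 mT ch zy ty; rewrite /trT.
have H k : (m.-1 <= k)%N -> (k < tlen t)%N -> tr (tfac t) k v = tr (tfac t) m.-1 v.
  elim: k => [|k ih] mk kt; first by move: mk; rewrite leqn0 => /eqP ->.
  have [e|ne] := eqVneq k.+1 m.-1; first by rewrite e.
  rewrite -(ih _ (ltnW kt)); last by lia.
  rewrite /= rot_fix//.
    by apply: ty; have [_ [_ f]] := ch k (ltnW kt); rewrite -(zy k.+1)//; lia.
  by apply: ty; have [[_ f] _] := ch k.+1 kt; rewrite -(zy k.+1)//; lia.
by apply: H; lia.
Qed.

Lemma opt_unfold t x y z m : opt_chain t x y z -> (m <= tlen t)%N ->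
  @geodesic R P m (tfac t) z -> clen m z = dist x y ->
  (forall k, (m <= k)%N -> (k <= tlen t)%N -> z k = y) ->
  forall x' y' z', chain_of t x' y' z' ->
    enorm (dist x y *: dir z 0 + trT t (y' - y) - (x' - x)) <= clen (tlen t) z'.
Proof.
move=> [[t0 _ [_ ch] z0 zT] _] mT g cl zy x' y' z' [_ _ [_ ch'] z'0 z'T].
have := geodesic_unfold g; rewrite cl => <-.
have -> : \sum_(0 <= k < m) tr (tfac t) k (z k.+1 - z k)
    = \sum_(0 <= k < tlen t) tr (tfac t) k (z k.+1 - z k).
  rewrite (@big_cat_nat _ _ _ m 0 (tlen t))//=.
  rewrite [X in _ = _ + X]big1_seq ?addr0// => k /andP[_].
  rewrite mem_index_iota => /andP[mk kt].
  by rewrite !zy ?subrr ?tr0//; lia.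
rewrite /trT -z'0 -z'T -z0 -zT; move: ch ch' t0; set s := tfac t.
case: (tlen t) => // l ch ch' _; exact: chain_unfold_ge.
Qed.

End Transport.

(** * Upper bound on the length of a displaced path *)

Section Variation.
Variables (R : realType) (P : polytope R).
Local Notation V := 'rV[R]_3.
Local Notation J := (facet P).
Local Notation n := (@normal R P).
Local Notation h := (@height R P).
Local Notation K := (body P).
Local Notation S := (surface P).
Local Notation face := (@face R P).
Local Notation dist := (@dist R P).
Local Notation tangent := (@tangent R P).
Implicit Types (x y p q u v : V) (z : nat -> V) (i j : J) (s : nat -> J) (t : ctype P).

Section UpperBound.
Variables (m : nat) (s : nat -> J) (z : nat -> V).
Hypothesis g : @geodesic R P m.+1 s z.

Let no : no_opp m.+1 s. Proof. exact: geodesic_no_opp g. Qed.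
Let no' k : (k < m)%N -> 1 + n (s k.+1) ∙ n (s k) != 0.
Proof. by move=> km; rewrite dotpC; apply: no. Qed.
Let ch : is_chain m.+1 s z. Proof. by case: g. Qed.
Let nz k : (k <= m)%N -> z k != z k.+1. Proof. by case: g => _ _ H _ _; exact: H. Qed.
Let len k := enorm (z k.+1 - z k).
Let len0 k : (k <= m)%N -> 0 < len k.
Proof. by move=> km; rewrite /len enorm_gt0 subr_eq0 eq_sym nz. Qed.

Let ndir k : (k <= m)%N -> n (s k) ∙ dir z k = 0.
Proof.
by move=> km; have [[_ a] [_ b]] := ch km; rewrite /dir dotpZr dotpB a b subrr mulr0.
Qed.
Let dir_next k : (k < m)%N -> rot (n (s k.+1)) (n (s k)) (dir z k) = dir z k.+1.
Proof.
move=> km; have [_ _ _ _ H] := g; have [<- _] := H k km.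
by rewrite rot_inv ?normal1//; exact: no.
Qed.
Let trans k : (k < m)%N -> 0 < n (s k.+1) ∙ dir z k.
Proof. by move=> km; have [_ _ _ _ H] := g; have [] := H k km. Qed.

Variable xi0 : V.
Hypothesis xiP : n (s 0%N) ∙ xi0 = 0.

(** The displacement of the starting point carried to the plane of s k, inversely to [tr]. *)
Fixpoint xi (k : nat) : V :=
  if k is k'.+1 then rot (n (s k)) (n (s k')) (xi k') else xi0.

(** The displaced path runs parallel to the old one in the unfolding; this is the shift along it
    that brings the displaced vertex onto the line of the edge. *)
Definition slide (k : nat) : R :=
  if k is k'.+1 then - (n (s k) ∙ xi k') / (n (s k) ∙ dir z k') else 0.

Arguments slide : simpl never.

Let q k := z k + xi k + slide k *: dir z k.

Let xi_perp k : (k <= m)%N -> n (s k) ∙ xi k = 0.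
Proof.
elim: k => // k ih km.
have := rot_dot (normal1 (s k.+1)) (normal1 (s k)) (no' km) (n (s k)) (xi k).
by rewrite (rot_map (normal1 (s k)) (no' km)) /= => ->; apply: ih; exact: ltnW.
Qed.

Let tr_xi k : (k <= m)%N -> tr s k (xi k) = xi0.
Proof.
elim: k => // k ih km.
by rewrite /= rot_inv ?normal1 ?no'// ih// ltnW.
Qed.

Lemma enorm_xi k : (k <= m)%N -> enorm (xi k) = enorm xi0.
Proof. by move=> km; rewrite -(tr_xi km) (enorm_tr _ no). Qed.

Let q_next k : (k < m)%N -> q k.+1 = z k.+1 + (xi k + slide k.+1 *: dir z k).
Proof.
move=> km; set u := xi k + _.
have u1 : n (s k) ∙ u = 0.
  by rewrite /u dotpDr dotpZr xi_perp ?ndir ?mulr0 ?addr0// ltnW.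
have u2 : n (s k.+1) ∙ u = 0.
  by rewrite /u dotpDr dotpZr /slide; field; rewrite gt_eqF// trans.
rewrite /q -addrA -(rot_fix u2 u1) /u rotD rotZ dir_next//.
Qed.

Let q_plane k : (k <= m)%N -> n (s k) ∙ q k = h (s k).
Proof.
move=> km; have [[_ a] _] := ch km.
by rewrite /q !dotpDr dotpZr a xi_perp// ndir// mulr0 !addr0.
Qed.

Let q_plane' k : (k < m)%N -> n (s k) ∙ q k.+1 = h (s k).
Proof.
move=> km; have [_ [_ a]] := ch (ltnW km : (k < m.+1)%N).
by rewrite q_next// !dotpDr dotpZr a xi_perp ?ndir ?mulr0 ?addr0// ltnW.
Qed.

Variable d : R.
Hypothesis d_len : forall k, (k <= m)%N -> d <= len k / 4.
Hypothesis small : forall k, (k <= m)%N -> `|slide k| < d.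

Let conn_q k : (k <= m)%N -> conn S (pr P (q 0%N)) (pr P (q k))
  (\sum_(0 <= l < k) len l + slide k).
Proof.
elim: k => [_|k ih km].
  rewrite big_geq// addr0 -(enorm0 R) -(subrr (q 0%N)).
  by apply: (@conn_pr _ _ (s 0%N)); rewrite q_plane.
rewrite big_nat_recr//=.
apply: conn_le (conn_trans (ih (ltnW km)) (_ : conn _ _ (pr P (q k.+1)) (len k + slide k.+1 - slide k))).
  by rewrite le_eqVlt; apply/orP; left; apply/eqP; ring.
have e : q k.+1 - q k = (len k + slide k.+1 - slide k) *: dir z k.
  rewrite q_next// /q scalerBl scalerDl dir_scale ?nz ?(ltnW km)//.
  by move: (slide k.+1) => c; apply: vecP; rewrite !coV; ring.
have pos : 0 <= len k + slide k.+1 - slide k.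
  have l0 := len0 (ltnW km); have dl := d_len (ltnW km).
  have := small (ltnW km); have := small km.
  by rewrite !ltr_norml => /andP[s1 s2] /andP[s3 s4]; lra.
apply: conn_le (conn_pr (j := s k) _ _); last by rewrite q_plane'.
  rewrite enormB e enormZ ger0_norm// /enorm dir1 ?sqrtr1 ?mulr1//.
  by rewrite nz// ltnW.
by rewrite q_plane// ltnW.
Qed.

(** Up to q m the new path is parallel to the geodesic, so its length changes exactly by [slide m];
    only the last leg turns towards the displaced end, and [enorm_add_le] bounds it. The vertices q
    k may leave the facets, since the path is projected. *)
Lemma variation_upper eta : n (s m) ∙ eta = 0 -> K (z 0%N + xi0) -> K (z m.+1 + eta) ->
  dist (z 0%N + xi0) (z m.+1 + eta) <= clen m.+1 z + dir z 0 ∙ (tr s m eta - xi0)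
    + (len m)^-1 * ((tr s m eta - xi0) ∙ (tr s m eta - xi0)).
Proof.
move=> me Kx Ky; apply: dist_conn_pr Kx Ky _.
have q0 : q 0%N = z 0%N + xi0 by rewrite /q scale0r addr0.
have lm := len0 (leqnn m).
have := small (leqnn m); rewrite ltr_norml => /andP[sm1 sm2].
have dm := d_len (leqnn m).
set v := tr s m eta - xi0; pose v' := eta - xi m.
have tv : tr s m v' = v by rewrite /v' trB tr_xi.
have vv : v' ∙ v' = v ∙ v by rewrite -tv (tr_dot _ _ no).
have dv : dir z m ∙ v' = dir z 0 ∙ v.
  by rewrite -tv -(geodesic_dir g (ltnSn m)) (tr_dot _ _ no).
pose L := len m - slide m.
have L0 : 0 < L by rewrite /L; lra.
have d1 := dir1 (nz (leqnn m)).
have nd : enorm (L *: dir z m) = L.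
  by rewrite enormZ gtr0_norm// /enorm d1 sqrtr1 mulr1.
have Lne : L *: dir z m != 0 by rewrite -enorm_gt0 nd.
have e : z m.+1 + eta - q m = L *: dir z m + v'.
  rewrite /q /v' /L scalerBl dir_scale ?nz//.
  by apply: vecP; rewrite !coV; ring.
have ub := enorm_add_le v' Lne; rewrite nd dotpZl dv vv -e in ub.
have [_ [_ a]] := ch (ltnSn m).
apply: conn_le (conn_trans (_ : conn _ _ (pr P (q m)) _)
  (conn_pr (P := P) (j := s m) (p := q m) (q := z m.+1 + eta) _ _)); last 3 first.
- by rewrite -q0; exact: conn_q.
- by rewrite q_plane.
- by rewrite dotpDr a me addr0.
rewrite enormB /clen big_nat_recr//= -/(len m).
(* The slide is less than a quarter of the last leg, so 2 L is at least [len m]. *)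
have i2 : (v ∙ v) / (2 * L) <= (len m)^-1 * (v ∙ v).
  rewrite mulrC ler_wpM2r ?dotp_ge0// lef_pV2 ?posrE ?mulr_gt0//.
  rewrite /L; lra.
have i1 : L * (dir z 0 ∙ v) / L = dir z 0 ∙ v by field; rewrite gt_eqF.
rewrite i1 /L in ub; move: ub i2; rewrite /L /len.
set X := \sum_(0 <= i < m) _; lra.
Qed.

End UpperBound.

Lemma variation_upper_local (m : nat) s z : @geodesic R P m.+1 s z ->
  exists2 r : R, 0 < r & exists2 C : R, 0 <= C & forall xi eta, enorm xi < r ->
    n (s 0%N) ∙ xi = 0 -> n (s m) ∙ eta = 0 -> K (z 0%N + xi) -> K (z m.+1 + eta) ->
    dist (z 0%N + xi) (z m.+1 + eta) <= clen m.+1 z + dir z 0 ∙ (tr s m eta - xi)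
      + C * ((tr s m eta - xi) ∙ (tr s m eta - xi)).
Proof.
move=> g; have [_ _ nz _ H] := g.
have len0 k : (k <= m)%N -> 0 < enorm (z k.+1 - z k).
  by move=> km; rewrite enorm_gt0 subr_eq0 eq_sym nz.
have [|d d0 hd] := @fin_min R 'I_m.+1 (fun k => enorm (z k.+1 - z k) / 4).
  by move=> k; rewrite divr_gt0// len0// -ltnS.
pose Q (k : 'I_m.+1) r := forall xi0, enorm xi0 < r -> `|slide s z xi0 k| < d.
have [||r r0 hr] := @fin_radius R 'I_m.+1 Q.
- by move=> k r r' rr h0 xi0 lt; apply: h0; apply: lt_le_trans rr.
- case=> -[|k] /= km; first by exists 1 => // xi0 _; rewrite /= normr0.
  have [_ t0] := H k km.
  exists (d * (n (s k.+1) ∙ dir z k)); first by rewrite mulr_gt0.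
  move=> xi0; rewrite -ltr_pdivrMr// => lt; apply: le_lt_trans lt.
  rewrite /slide normrM normfV normrN (gtr0_norm t0) ler_pM2r ?invr_gt0//.
  rewrite -(enorm_xi g xi0 (ltnW km)).
  rewrite ler_norml; have := cauchy (n (s k.+1)) (xi s xi0 k).
  by have := cauchyN (n (s k.+1)) (xi s xi0 k); rewrite enorm_normal mul1r => -> ->.
exists r => //; exists (enorm (z m.+1 - z m))^-1; first by rewrite invr_ge0 enorm_ge0.
move=> xi0 eta xr x0 e0 Kx Ky; apply: (variation_upper g x0 (d := d)) => // k km.
  exact: (hd (Ordinal (km : (k < m.+1)%N))).
exact: (hr (Ordinal (km : (k < m.+1)%N))).
Qed.

End Variation.

(** * Displacing a pair that realises the diameter *)

Section Key.
Variables (R : realType) (P : polytope R).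
Local Notation V := 'rV[R]_3.
Local Notation J := (facet P).
Local Notation n := (@normal R P).
Local Notation h := (@height R P).
Local Notation K := (body P).
Local Notation S := (surface P).
Local Notation face := (@face R P).
Local Notation dist := (@dist R P).
Local Notation tangent := (@tangent R P).
Implicit Types (x y p q u v w : V) (z : nat -> V) (i j : J) (s : nat -> J) (t : ctype P).

(** Facets through y stay tight along a tangent vector, and the others keep some slack when it is
    short. *)
Lemma tangent_surface y : S y -> exists2 r : R, 0 < r &
  forall v, enorm v < r -> tangent y v -> S (y + v).
Proof.
move=> Sy; have Ky := surface_body Sy; have [r r0 hr] := face_local Ky.
have [||r' r'0 hr'] := @fin_radius R J (fun i r => forall v, enorm v < r ->
    n i ∙ y < h i -> n i ∙ (y + v) < h i).
- by move=> i a b ba H v vb; apply: H; apply: lt_le_trans ba.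
- move=> i; have [lt|ge] := ltP (n i ∙ y) (h i); last first.
    by exists 1 => // v _ /lt_le_trans /(_ ge); rewrite ltxx.
  exists (h i - n i ∙ y); first by rewrite subr_gt0.
  move=> v vr _; rewrite dotpDr; have := cauchy (n i) v.
  by rewrite enorm_normal mul1r; lra.
exists r' => // v vr tv; have [j [_ jy]] := surface_face Sy.
apply/surfaceP; split; last by exists j; rewrite dotpDr jy tv// addr0.
move=> i; have [e|ne] := eqVneq (n i ∙ y) (h i); first by rewrite dotpDr e tv// addr0.
by apply/ltW/hr' => //; rewrite lt_neqAle ne Ky.
Qed.

(* w is the initial unit direction of a shortest path of type t from x to y. *)
Definition seg x y t w := exists z m, [/\ opt_chain t x y z,
  (m <= tlen t)%N /\ @geodesic R P m (tfac t) z, clen m z = dist x y,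
  forall k, (m <= k)%N -> (k <= tlen t)%N -> z k = y & w = dir z 0].

(** For a point of the solid: it lies in the relative interior of the facet j. *)
Definition simple_at x j := n j ∙ x = h j /\ forall i, n i ∙ x = h i -> i = j.

Section Pair.
Variables (x y : V) (j0 : J).
Hypotheses (Sx : S x) (Sy : S y) (xy : x != y) (xj : simple_at x j0).

Lemma opt_chain_first t z : opt_chain t x y z -> tfac t 0 = j0.
Proof.
move=> [[t0 _ [_ ch] z0 _] _]; have [[_ f] _] := ch 0%N t0.
by case: xj => _; apply; rewrite -z0.
Qed.

Lemma seg_exists t z : opt_chain t x y z -> exists w, seg x y t w.
Proof.
move=> oz; have [|m [mT g cl zy]] := opt_geodesic xy _ oz.
  by rewrite (opt_chain_first oz); case: xj.
by exists (dir z 0), z, m.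
Qed.

Lemma seg_first t w : seg x y t w -> tfac t 0 = j0.
Proof. by move=> [z [m [oz _ _ _ _]]]; exact: opt_chain_first oz. Qed.

Lemma seg_dir t w : seg x y t w -> w ∙ w = 1 /\ n j0 ∙ w = 0.
Proof.
move=> sg; have e0 := seg_first sg; have [z [m [oz [mT g] _ _ ->]]] := sg.
have [[m0 _] ch nz _ _] := g; split; first by rewrite dir1// nz.
have [[_ a] [_ b]] := ch 0%N m0; rewrite e0 in a b.
by rewrite /dir dotpZr dotpB a b subrr mulr0.
Qed.

Lemma seg_no_opp t w : seg x y t w -> no_opp (tlen t) (tfac t).
Proof. by move=> [z [m [[[_ _ [_ ch] _ _] _] _ _ _ _]]]; exact: chain_no_opp ch. Qed.

Lemma seg_tlen t w : seg x y t w -> (0 < tlen t)%N.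
Proof. by move=> [z [m [[[? _ _ _ _] _] _ _ _ _]]]. Qed.

Lemma trT_dot t w u v : seg x y t w -> trT t u ∙ trT t v = u ∙ v.
Proof.
move=> sg; rewrite /trT (tr_dot _ _ (seg_no_opp sg))//.
by rewrite ltn_predL (seg_tlen sg).
Qed.

Lemma seg_lower t w x' y' z' : seg x y t w -> chain_of t x' y' z' ->
  enorm (dist x y *: w + trT t (y' - y) - (x' - x)) <= clen (tlen t) z'.
Proof.
by move=> [z [m [oz [mT g] cl zy ->]]]; exact: (opt_unfold oz mT g cl zy).
Qed.

Lemma seg_upper t w : seg x y t w -> exists2 r : R, 0 < r & exists2 C : R, 0 <= C &
  forall xi eta, enorm xi < r -> tangent x xi -> tangent y eta -> K (x + xi) -> K (y + eta) ->
  dist (x + xi) (y + eta) <= dist x y + w ∙ (trT t eta - xi)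
      + C * ((trT t eta - xi) ∙ (trT t eta - xi)).
Proof.
move=> sg; have e0 := seg_first sg; have [z [m [oz [mT g] cl zy ->]]] := sg.
have [[m0 _] ch _ _ _] := g; have [[_ _ [_ chT] z0 _] _] := oz.
case: m m0 mT g cl zy ch => // m _ mT g cl zy ch.
have zm : z m.+1 = y by apply: zy.
have [r r0 [C C0 H]] := variation_upper_local g.
exists r => //; exists C => // xi0 eta xr tx ty Kx Ky.
rewrite (trT_tangent (ltn0Sn m) mT chT zy ty) /= -cl.
have := H xi0 eta xr; rewrite z0 zm; apply => //.
  by apply: tx; rewrite e0; case: xj.
by apply: ty; have [_ [_]] := ch m (ltnSn m); rewrite zm.
Qed.

Variable D : R.
Hypotheses (D0 : 0 < D) (Dxy : dist x y = D)
  (Dmax : forall x' y', S x' -> S y' -> dist x' y' <= D).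

(* If (x + xi, y + eta) also realises the diameter D, then some shortest paths
   from x to y carry eta to xi, and their directions positively span the plane:
   otherwise the lower bound, evaluated at the farther pair (x + l xi, y + l eta + zeta),
   would exceed D. *)
Lemma directions_spread : exists2 r : R, 0 < r & forall xi eta,
  enorm xi < r -> enorm eta < r -> tangent x xi -> tangent y eta ->
  dist (x + xi) (y + eta) = D ->
  (exists t w, seg x y t w /\ trT t eta = xi) /\
  forall zeta, tangent y zeta -> zeta != 0 ->
    exists t w, [/\ seg x y t w, trT t eta = xi & w ∙ trT t zeta < 0].
Proof.
(* One direction, radius and constant per type, so that radii and constants can be made uniform;
   types without a shortest path get dummy values. *)
have up t : exists wrC : V * R * R, 0 < wrC.1.2 /\ 0 <= wrC.2 /\
    ((exists w, seg x y t w) -> seg x y t wrC.1.1 /\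
    forall xi eta, enorm xi < wrC.1.2 -> tangent x xi -> tangent y eta -> K (x + xi) -> K (y + eta) ->
    dist (x + xi) (y + eta) <= dist x y + wrC.1.1 ∙ (trT t eta - xi)
      + wrC.2 * ((trT t eta - xi) ∙ (trT t eta - xi))).
  have [[w sg]|nsg] := pselect (exists w, seg x y t w); last first.
    by exists (0, 1, 0) => /=; split => //; split => // sg; case: nsg.
  have [r r0 [C C0 H]] := seg_upper sg.
  by exists (w, r, C) => /=; split => //; split => // _; split.
have [f hf] := choice up.
pose W t := (f t).1.1; pose C := \sum_t (f t).2.
have Cge t : (f t).2 <= C.
  rewrite /C (bigD1 t)//= lerDl sumr_ge0// => t' _.
  by have [_ []] := hf t'.
have C0 : 0 <= C by rewrite sumr_ge0// => t' _; have [_ []] := hf t'.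
have [|r1 r10 hr1] := fin_min (f := fun t => (f t).1.2); first by move=> t; have [] := hf t.
have [r2 r20 hr2] := opt_type_local Sx Sy.
have [r3 r30 hr3] := tangent_surface Sx.
have [r4 r40 hr4] := tangent_surface Sy.
have dxy : 0 < enorm (x - y) by rewrite enorm_gt0 subr_eq0.
pose r5 := enorm (x - y) / 4.
have r50 : 0 < r5 by rewrite divr_gt0.
(* The upper bound at (xi, eta) gives w ∙ v >= - C (v ∙ v) for v = trT t eta - xi; with this lam, |D
   w + lam v|^2 exceeds D^2 by at least 2 lam (v ∙ v). *)
pose lam := 2 * D * C + 2.
have lam0 : 0 < lam by rewrite /lam ltr_wpDl// mulr_ge0// mulr_ge0// ltW.
have [rr [rr0 rr2 rr3 [rr4 rr5]]] : exists rr, [/\ 0 < rr, rr <= r2, rr <= r3 & rr <= r4 /\ rr <= r5].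
  exists (Num.min (Num.min r2 r3) (Num.min r4 r5)).
  by rewrite !lt_min r20 r30 r40 r50 !ge_min !lexx !orbT.
exists (Num.min (Num.min r1 rr) (rr / (2 * lam))).
  by rewrite !lt_min r10 rr0 divr_gt0// mulr_gt0.
move=> xi eta; rewrite !lt_min => /andP[/andP[xi1 xi2] xi3] /andP[/andP[et1 et2] et3] tx ty Dxe.
have tgZ p (c : R) v : tangent p v -> tangent p (c *: v).
  by move=> tv i ip; rewrite dotpZr tv// mulr0.
have tgD p u v : tangent p u -> tangent p v -> tangent p (u + v).
  by move=> tu tv i ip; rewrite dotpDr tu// tv// addr0.
have Sxi : S (x + xi) by apply: hr3 => //; apply: lt_le_trans rr3.
have Seta : S (y + eta) by apply: hr4 => //; apply: lt_le_trans rr4.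
rewrite ltr_pdivlMr ?mulr_gt0// in xi3; rewrite ltr_pdivlMr ?mulr_gt0// in et3.
have [v vE] : exists v : ctype P -> V, forall t, v t = trT t eta - xi by exists (fun t => trT t eta - xi).
have first_order t : (exists w, seg x y t w) -> seg x y t (W t) /\
    D ^+ 2 + 2 * lam * (v t ∙ v t) <=
    (D *: W t + lam *: v t) ∙ (D *: W t + lam *: v t).
  move=> /(proj2 (proj2 (hf t)))[sg H]; split => //.
  have := H xi eta _ tx ty (surface_body Sxi) (surface_body Seta).
  rewrite Dxe Dxy => /(_ (lt_le_trans xi1 (hr1 t))).
  rewrite -/(W t) -(vE t) => h1.
  have vv := dotp_ge0 (v t).
  have h2 := ler_wpM2r vv (Cge t).
  have [w1 _] := seg_dir sg.
  rewrite !dotE w1 (dotpC (v t) (W t)).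
  have h3 : 0 <= W t ∙ v t + C * (v t ∙ v t).
    by rewrite -(lerD2l D) addr0 addrA; apply: le_trans h1 _; rewrite lerD2l.
  have h4 := mulr_ge0 (mulr_ge0 (ltW lam0) (ltW D0)) h3.
  rewrite -subr_ge0.
  rewrite [X in 0 <= X](_ : _ = 2 * (lam * D * (W t ∙ v t + C * v t ∙ v t))); last first.
    by rewrite /lam; ring.
  by rewrite mulr_ge0.
(* An optimal type for the farther pair is also optimal for (x, y), so its unfolded length bounds
   the distance of that pair from below, and this distance is at most D. *)
have far zeta : tangent y zeta -> enorm zeta <= rr / 2 ->
    exists t, seg x y t (W t) /\ (D *: W t + lam *: v t + trT t zeta) ∙
      (D *: W t + lam *: v t + trT t zeta) <= D ^+ 2.
  move=> tz zr.
  pose x' := x + lam *: xi; pose y' := y + (lam *: eta + zeta).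
  have lx : enorm (lam *: xi) < rr by rewrite enormZ gtr0_norm//; lra.
  have ly : enorm (lam *: eta + zeta) < rr.
    apply: le_lt_trans (enorm_triangle _ _) _.
    by rewrite enormZ gtr0_norm//; lra.
  have Sx' : S x' by apply: hr3; [apply: lt_le_trans rr3|apply: tgZ].
  have Sy' : S y' by apply: hr4; [apply: lt_le_trans rr4|apply: tgD => //; apply: tgZ].
  have xy' : x' != y'.
    apply/eqP => e; have := enorm_dist3 x x' y.
    have -> : x' - y = lam *: eta + zeta by rewrite e /y' addrAC subrr add0r.
    have -> : x - x' = - (lam *: xi) by rewrite /x' opprD addNKr.
    by rewrite enormN; rewrite /r5 in rr5; lra.
  have [t [z' oz']] := opt_chain_exists Sx' Sy' xy'.
  have [z oz] : exists z, opt_chain t x y z.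
    apply: (hr2 x' y' Sx' Sy' _ _ t z' oz').
      by rewrite /x' addrAC subrr add0r; apply: lt_le_trans rr2.
    by rewrite /y' addrAC subrr add0r; apply: lt_le_trans rr2.
  have [sg _] := first_order t (seg_exists oz).
  exists t; split => //.
  have [ch' cl'] := oz'; have := seg_lower sg ch'; rewrite cl' Dxy.
  have -> : D *: W t + trT t (y' - y) - (x' - x) = D *: W t + lam *: v t + trT t zeta.
    have -> : y' - y = lam *: eta + zeta by rewrite /y' addrAC subrr add0r.
    have -> : x' - x = lam *: xi by rewrite /x' addrAC subrr add0r.
    rewrite vE /trT trD trZ; apply: vecP; rewrite !coV; ring.
  move=> le; have := le_trans le (Dmax Sx' Sy') => le'.
  by rewrite -enorm_sqr ler_pXn2r ?nnegrE ?enorm_ge0 ?(ltW D0).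
split.
  (* With zeta = 0, the excess 2 lam (v ∙ v) must vanish, so v = 0 for that type. *)
  have t0 : tangent y 0 by move=> i _; rewrite dotp0r.
  have z0 : enorm (0 : V) <= rr / 2 by rewrite enorm0 divr_ge0// ltW.
  have [t [sg le]] := far 0 t0 z0; exists t, (W t); split => //.
  have [_ ge] := first_order t (ex_intro _ _ sg).
  have tr00 : trT t (0 : V) = 0 by exact: tr0.
  rewrite tr00 addr0 in le.
  have : v t ∙ v t == 0.
    rewrite eq_le dotp_ge0 andbT.
    by have := le_trans ge le; rewrite gerDl pmulr_rle0// mulr_gt0.
  by rewrite dotp_eq0 vE subr_eq0 => /eqP.
move=> zeta tz zn0; apply: contrapT => H.
have zz : 0 < zeta ∙ zeta by rewrite dotp_gt0.
(* A short multiple of zeta makes every type too long: if v = 0 because w ∙ trT t zeta >= 0, and if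
   v != 0 because the excess outweighs the linear term. *)
have [||e e0 he] := @fin_radius R (ctype P) (fun t e => forall e', 0 < e' -> e' <= e ->
   seg x y t (W t) -> D ^+ 2 < (D *: W t + lam *: v t + trT t (e' *: zeta)) ∙
      (D *: W t + lam *: v t + trT t (e' *: zeta))).
- by move=> t a b ba Ha e' e'0 e'b; apply: Ha => //; apply: le_trans ba.
- move=> t; have [sg|nsg] := pselect (seg x y t (W t)); last first.
    by exists 1.
  have [_ ge] := first_order t (ex_intro _ _ sg).
  pose A := D *: W t + lam *: v t.
  have ex (e : R) : (A + trT t (e *: zeta)) ∙ (A + trT t (e *: zeta)) =
      A ∙ A + 2 * e * (A ∙ trT t zeta) + e * e * (zeta ∙ zeta).
    rewrite -(trT_dot zeta zeta sg) /trT trZ.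
    by move: (tr _ _ zeta) (A) => a b; rewrite !dotE (dotpC a b); ring.
  have [v0|vn0] := eqVneq (v t) 0.
    exists 1 => // e' e'0 _ _; rewrite ex.
    have AD : A = D *: W t by rewrite /A v0 scaler0 addr0.
    have [w1 _] := seg_dir sg.
    have pos : 0 <= W t ∙ trT t zeta.
      rewrite leNgt; apply/negP => lt; apply: H; exists t, (W t); split => //.
      by apply/eqP; rewrite -subr_eq0 -vE v0.
    rewrite AD !dotpZl !dotpZr w1 mulr1 -expr2.
    have a1 : 0 < e' * e' * (zeta ∙ zeta) by rewrite !mulr_gt0.
    have a2 : 0 <= 2 * e' * (D * (W t ∙ trT t zeta)).
      by rewrite !mulr_ge0// ltW.
    by rewrite -addrA ltrDl ltr_wpDl.
  have vv : 0 < 2 * lam * (v t ∙ v t) by rewrite !mulr_gt0// dotp_gt0.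
  have [e [e0 _ eA]] := small_pos (- 2 * (A ∙ trT t zeta)) vv ltr01.
  exists e => // e' e'0 e'e _; rewrite ex -/A; rewrite -/A in ge.
  have a1 : 0 < e' * e' * (zeta ∙ zeta) by rewrite !mulr_gt0.
  have [pos|neg] := leP 0 (A ∙ trT t zeta).
    rewrite -addrA (lt_le_trans (_ : _ < A ∙ A))//.
      by apply: lt_le_trans ge; rewrite ltrDl.
    by rewrite lerDl addr_ge0 ?(ltW a1)// !mulr_ge0// ltW.
  have := ler_wnM2r (ltW neg) e'e; lra.
pose e' := Num.min e (rr / (2 * enorm zeta)).
have ez : 0 < enorm zeta by rewrite enorm_gt0.
have e'0 : 0 < e' by rewrite lt_min e0 divr_gt0// mulr_gt0.
have [||t [sg le]] := far (e' *: zeta).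
- exact: tgZ.
- rewrite enormZ gtr0_norm// -ler_pdivlMr// (_ : rr / 2 / enorm zeta = rr / (2 * enorm zeta)).
    by rewrite ge_min lexx orbT.
  by rewrite invfM mulrA.
have := he t e' e'0 _ sg; rewrite ge_min lexx => /(_ isT) lt.
by have := lt_le_trans lt le; rewrite ltxx.
Qed.

End Pair.

End Key.

(** * Pairs of points at maximal distance *)

Section Generic.
Variables (R : realType) (P : polytope R).
Local Notation V := 'rV[R]_3.
Local Notation J := (facet P).
Local Notation n := (@normal R P).
Local Notation h := (@height R P).
Local Notation K := (body P).
Local Notation S := (surface P).
Local Notation face := (@face R P).
Local Notation dist := (@dist R P).
Local Notation tangent := (@tangent R P).
Implicit Types (x y p q u v w : V) (z : nat -> V) (i j : J) (s : nat -> J) (t : ctype P).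

(** Each line contains e1 + m e2 for at most one m: for two values the cross product of the vectors
    is a nonzero multiple of [cross e1 e2]. *)
Lemma avoid_lines (T : finType) (u : T -> V) (e1 e2 : V) : cross e1 e2 != 0 ->
  exists m : R, forall a c, e1 + m *: e2 != c *: u a.
Proof.
move=> e12.
have H a : exists m0, forall m, (exists c, e1 + m *: e2 = c *: u a) -> m = m0.
  have [[m0 [c0 h0]]|no] := pselect (exists m c, e1 + m *: e2 = c *: u a); last first.
    by exists 0 => m hm; case: no; exists m.
  exists m0 => m [c hm].
  have E : cross (e1 + m0 *: e2) (e1 + m *: e2) = 0.
    by rewrite h0 hm; apply: vecP; rewrite /cross !(coV, co_vec, co_0); ring.
  have E2 : cross (e1 + m0 *: e2) (e1 + m *: e2) = (m - m0) *: cross e1 e2.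
    by apply: vecP; rewrite /cross !(coV, co_vec); ring.
  by move: E2; rewrite E => /esym /eqP; rewrite scaler_eq0 (negbTE e12) orbF subr_eq0 => /eqP.
have [f hf] := choice H; exists (1 + \sum_a `|f a|) => a c; apply/eqP => e.
have := hf a _ (ex_intro _ c e); have := ler_norm (f a).
have : `|f a| <= \sum_a `|f a| by rewrite (bigD1 a)//= lerDl sumr_ge0.
lra.
Qed.

Lemma orth_plane u v w : cross u v != 0 -> w ∙ u = 0 -> w ∙ v = 0 ->
  exists c, w = c *: cross u v.
Proof.
move=> c0 wu wv; have t0 : 0 < cross u v ∙ cross u v by rewrite dotp_gt0.
exists (triple u v w / (cross u v ∙ cross u v)).
have e : (cross u v ∙ cross u v) *: w = triple u v w *: cross u v.
  have := cross_triple u v (cross u v) w; rewrite wu wv !scale0r !add0r.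
  by rewrite /triple (dotpC w).
by rewrite mulrC -scalerA -e scalerA mulVf ?scale1r// gt_eqF.
Qed.

Lemma dist_continuous x : S x -> {within S, continuous (dist x)}.
Proof.
move=> Sx; apply/subspace_continuousP => y Sy A /nbhs_ballP[e /= e0 hA].
have [r r0 hr] := dist_local Sy.
apply/nbhs_enorm; exists (Num.min r e); first by rewrite lt_min r0.
move=> y'; rewrite lt_min => /andP[yr ye] Sy'; apply: hA; rewrite /ball /=.
apply: le_lt_trans (dist_lipschitz Sx Sy Sx Sy') _.
by rewrite dist_xx// add0r hr// enormB.
Qed.

(** Closed strata: rank 1 is the whole surface, rank 2 the edges, rank 3 the vertices. The clause r
    < 4 empties rank 4, which ends the climb in [generic_disc]. *)
Definition rank_ge (r : nat) : set V := [set y | S y /\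
  [/\ (2 <= r)%N -> exists i j, [/\ i != j, n i ∙ y = h i & n j ∙ y = h j],
      (3 <= r)%N -> exists i j k, [/\ triple (n i) (n j) (n k) != 0, n i ∙ y = h i,
        n j ∙ y = h j & n k ∙ y = h k] & (r < 4)%N]].

Lemma closed_finite_union (T : finType) (A : T -> set V) (Q : T -> Prop) :
  (forall a, closed (A a)) -> closed [set y | exists2 a, Q a & A a y].
Proof.
move=> cA; rewrite (_ : [set y | _] = \bigcup_(a in Q) A a).
  by apply: closed_bigcup => //; exact: finite_finset.
by apply/seteqP; split=> y [a Qa Aa]; exists a.
Qed.

Lemma rank_ge_compact r : compact (rank_ge r).
Proof.
apply: (subclosed_compact _ (@surface_compact R P)); last by move=> y [].
have cS : closed S by apply: compact_closed; [exact: norm_hausdorff|exact: surface_compact].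
have c2 : closed [set y | exists i j, [/\ i != j, n i ∙ y = h i & n j ∙ y = h j]].
  rewrite (_ : [set y | _] = [set y | exists2 a : J * J, a.1 != a.2 &
    ([set y | n a.1 ∙ y = h a.1] `&` [set y | n a.2 ∙ y = h a.2]) y]).
    by apply: closed_finite_union => a; apply: closedI; exact: closed_eq_dotp.
  apply/seteqP; split=> y; first by move=> [i [j [ij iy jy]]]; exists (i, j).
  by move=> [[i j] /= ij [iy jy]]; exists i, j.
have c3 : closed [set y | exists i j k, [/\ triple (n i) (n j) (n k) != 0, n i ∙ y = h i,
        n j ∙ y = h j & n k ∙ y = h k]].
  rewrite (_ : [set y | _] = [set y | exists2 a : J * J * J,
    triple (n a.1.1) (n a.1.2) (n a.2) != 0 &
    (([set y | n a.1.1 ∙ y = h a.1.1] `&` [set y | n a.1.2 ∙ y = h a.1.2])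
       `&` [set y | n a.2 ∙ y = h a.2]) y]).
    by apply: closed_finite_union => a; apply: closedI; [apply: closedI|];
      exact: closed_eq_dotp.
  apply/seteqP; split=> y; first by move=> [i [j [k [ij iy jy ky]]]]; exists (i, j, k).
  by move=> [[[i j] k] /= ij [[iy jy] ky]]; exists i, j, k.
have [r4|r4] := ltnP r 4; last first.
  rewrite (_ : rank_ge r = set0); first exact: closed0.
  by apply/seteqP; split=> // y [_ [_ _]]; rewrite ltnNge r4.
have [r3|r3] := leqP 3 r.
  rewrite (_ : rank_ge r = S `&` [set y | exists i j, [/\ i != j, n i ∙ y = h i & n j ∙ y = h j]]
    `&` [set y | exists i j k, [/\ triple (n i) (n j) (n k) != 0, n i ∙ y = h i,
        n j ∙ y = h j & n k ∙ y = h k]]); first by apply: closedI => //; exact: closedI.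
  apply/seteqP; split=> y.
    by move=> [Sy [h2 h3 _]]; split; [split => //; apply: h2; lia|exact: h3].
  by move=> [[Sy h2] h3]; split.
have [r2|r2] := leqP 2 r.
  rewrite (_ : rank_ge r = S `&` [set y | exists i j, [/\ i != j, n i ∙ y = h i & n j ∙ y = h j]]).
    exact: closedI.
  apply/seteqP; split=> y.
    by move=> [Sy [h2 h3 _]]; split => //; apply: h2.
  by move=> [Sy h2]; split => //; split => //; rewrite leqNgt r3.
rewrite (_ : rank_ge r = S)//; apply/seteqP; split=> [y []//|y Sy].
by split => //; split => //; rewrite leqNgt ?r2 ?r3.
Qed.

(** Two points of the same stratum, with the facets of y' among those of y, differ by a tangent
    vector: it is 0 at a vertex, and along an edge a facet at y transversal to it would make y a
    vertex. *)
Lemma rank_ge_tangent r y y' : (0 < r)%N -> rank_ge r y -> ~ rank_ge r.+1 y -> rank_ge r y' ->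
  (forall i, n i ∙ y' = h i -> n i ∙ y = h i) -> tangent y (y' - y).
Proof.
move=> r0 [Sy [y2 y3 r4]] ny [Sy' [y'2 y'3 _]] sub.
have orth i : n i ∙ y' = h i -> n i ∙ (y' - y) = 0.
  by move=> iy'; rewrite dotpB iy' sub// subrr.
move=> k ky.
have [r3|r3] := leqP 3 r.
  have [i [j [l [t0 iy jy ly]]]] := y'3 r3.
  have -> : y' - y = 0; last by rewrite dotp0r.
  by apply: (orth_triple t0); rewrite dotpC orth.
have [r2|r2] := leqP 2 r.
  have [i [j [ij iy jy]]] := y'2 r2.
  have c0 := cross_normal ij iy jy.
  have o1 : (y' - y) ∙ n i = 0 by rewrite dotpC orth.
  have o2 : (y' - y) ∙ n j = 0 by rewrite dotpC orth.
  have [c ->] := orth_plane c0 o1 o2.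
  rewrite dotpZr; apply/eqP; rewrite mulf_eq0; apply/orP; right.
  apply/negPn/negP => t0; apply: ny; split => //; split; last by lia.
    by move=> _; exists i, j; rewrite ij !sub.
  by move=> _; exists i, j, k; split=> //; [by rewrite /triple dotpC|exact: sub|exact: sub].
have [i [_ iy']] := surface_face Sy'.
have [->|ki] := eqVneq k i; first exact: orth.
case: ny; split => //; split; [|by lia|by lia].
by move=> _; exists k, i; rewrite ki ky sub.
Qed.

Variable D : R.
Hypotheses (D0 : 0 < D) (Dmax : forall x y, S x -> S y -> dist x y <= D)
  (Dpartner : forall x, S x -> exists2 y, S y & dist x y = D).

Definition disc (j : J) (c : V) (rho : R) : set V :=
  [set x | n j ∙ x = h j /\ enorm (x - c) < rho].

Lemma disc_simple j c : S c -> simple_at c j -> exists2 rho, 0 < rho &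
  forall x, disc j c rho x -> S x /\ simple_at x j.
Proof.
move=> Sc [jc cj]; have [r r0 hr] := tangent_surface Sc.
have [r' r'0 hr'] := face_local (surface_body Sc).
exists (Num.min r r'); first by rewrite lt_min r0.
move=> x [jx]; rewrite lt_min => /andP[xr xr'].
split; last by split => // i ix; apply: cj; exact: hr' ix.
rewrite -(subrK c x) addrC; apply: hr => // i /cj ->.
by rewrite dotpB jx jc subrr.
Qed.

(** The maximum of the distance from x to E is less than D, and it changes by at most the
    displacement of x. *)
Lemma no_partner_open (E : set V) x : compact E -> E `<=` S -> S x ->
  (forall y, E y -> dist x y <> D) ->
  exists2 r, 0 < r & forall x', S x' -> enorm (x' - x) < r -> forall y, E y -> dist x' y <> D.
Proof.
move=> cE ES Sx no.
have [ne|em] := pselect (E !=set0); last first.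
  by exists 1 => // x' _ _ y Ey; case: em; exists y.
have dc : {within E, continuous (dist x)}.
  exact: continuous_subspaceW ES (dist_continuous Sx).
have [y0 y0E hy0] := compact_EVT_max ne cE dc.
have Ey0 := set_mem y0E.
have lt : dist x y0 < D.
  by rewrite lt_neqAle; apply/andP; split; [apply/eqP; exact: no|apply: Dmax => //; exact: ES].
have [r r0 hr] := dist_local Sx.
exists (Num.min r (D - dist x y0)); first by rewrite lt_min r0 subr_gt0.
move=> x' Sx'; rewrite lt_min => /andP[xr xD] y Ey e.
have := dist_triangle Sx' Sx (ES y Ey); rewrite (dist_sym Sx Sx') hr//.
have := hy0 y (mem_set Ey); rewrite e (enormB x); lra.
Qed.

(** Climb through the strata: either all points of the disc have partners of rank at least r + 1,
    and r is raised, or some point has none, and then a smaller disc around it has none either. *)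
Lemma generic_disc : exists j c rho r, [/\ 0 < rho, (0 < r)%N,
  forall x, disc j c rho x -> S x /\ simple_at x j, disc j c rho c &
  (forall x, disc j c rho x -> exists2 y, rank_ge r y & dist x y = D) /\
  forall x y, disc j c rho x -> rank_ge r.+1 y -> dist x y <> D].
Proof.
have e0 : vec 1 0 0 != 0 :> V.
  by apply/eqP => /(congr1 (@co0 R)) /eqP; rewrite !coE oner_eq0.
have [l _] := @normals_unbounded R P _ e0.
(* The irredundance witness is a relative interior point of the facet. *)
have [c lc hc] := irredundant l.
have Kc : K c.
  by move=> i; have [->|il] := eqVneq i l; [rewrite lc|rewrite ltW// hc].
have sc : simple_at c l.
  split => // i ic; apply/eqP/negPn/negP => il; have := hc i il; by rewrite ic ltxx.
have Sc : S c by apply: (@face_surface _ _ l).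
have [rho rho0 hrho] := disc_simple Sc sc.
pose Q r := exists c rho, [/\ 0 < rho, disc l c rho c, forall x, disc l c rho x -> S x /\ simple_at x l &
  forall x, disc l c rho x -> exists2 y, rank_ge r y & dist x y = D].
have Q1 : Q 1%N.
  exists c, rho; split => //; first by split => //; rewrite subrr enorm0.
  move=> x dx; have [Sx _] := hrho x dx; have [y Sy e] := Dpartner Sx.
  by exists y.
have step r : (0 < r)%N -> Q r -> (exists c rho, [/\ 0 < rho,
  forall x, disc l c rho x -> S x /\ simple_at x l, disc l c rho c &
  (forall x, disc l c rho x -> exists2 y, rank_ge r y & dist x y = D) /\
  forall x y, disc l c rho x -> rank_ge r.+1 y -> dist x y <> D]) \/ Q r.+1.
  move=> r0 [c' [rho' [rho'0 cc hS hp]]].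
  have [all|ex] := pselect (forall x, disc l c' rho' x ->
      exists2 y, rank_ge r.+1 y & dist x y = D).
    by right; exists c', rho'.
  left; have [x dx nox] : exists2 x, disc l c' rho' x &
      ~ exists2 y, rank_ge r.+1 y & dist x y = D.
    apply: contrapT => H; apply: ex => x dx; apply: contrapT => H2.
    by apply: H; exists x.
  have [Sx sx] := hS x dx.
  have [||d d0 hd] := no_partner_open (@rank_ge_compact r.+1) _ Sx.
  - by move=> y [].
  - by move=> y Ey e; apply: nox; exists y.
  have [lx xr] := dx.
  pose rho1 := Num.min d (rho' - enorm (x - c')).
  have sub y : disc l x rho1 y -> disc l c' rho' y.
    move=> [ly]; rewrite lt_min => /andP[_ yx]; split => //.
    by have := enorm_dist3 y x c'; lra.
  exists x, rho1; split.
  - by rewrite lt_min d0 subr_gt0.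
  - by move=> y /sub /hS.
  - by split => //; rewrite subrr enorm0 lt_min d0 subr_gt0.
  split=> [y /sub /hp//|y y' dy].
  have [_] := dy; rewrite lt_min => /andP[yd _].
  by apply: (hd y) => //; have [] := hS y (sub y dy).
have out r : (0 < r)%N -> (exists c rho, [/\ 0 < rho,
  forall x, disc l c rho x -> S x /\ simple_at x l, disc l c rho c &
  (forall x, disc l c rho x -> exists2 y, rank_ge r y & dist x y = D) /\
  forall x y, disc l c rho x -> rank_ge r.+1 y -> dist x y <> D]) ->
  exists j c rho r, [/\ 0 < rho, (0 < r)%N,
  forall x, disc j c rho x -> S x /\ simple_at x j, disc j c rho c &
  (forall x, disc j c rho x -> exists2 y, rank_ge r y & dist x y = D) /\
  forall x y, disc j c rho x -> rank_ge r.+1 y -> dist x y <> D].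
  by move=> r0 [c' [rho' [a b d e]]]; exists l, c', rho', r.
have [/out H|Q2] := step 1%N isT Q1; first exact: H.
have [/out H|Q3] := step 2 isT Q2; first exact: H.
have [/out H|[c' [rho' [_ cc _ hp]]]] := step 3 isT Q3; first exact: H.
by have [y [_ [_ _]]] := hp c' cc.
Qed.

End Generic.

(** * A pair that can be displaced at constant distance *)

Section ThreeSegments.
Variables (R : realType) (P : polytope R).
Local Notation V := 'rV[R]_3.
Local Notation J := (facet P).
Local Notation n := (@normal R P).
Local Notation h := (@height R P).
Local Notation K := (body P).
Local Notation S := (surface P).
Local Notation face := (@face R P).
Local Notation dist := (@dist R P).
Local Notation tangent := (@tangent R P).
Local Notation seg := (@seg R P).
Local Notation rank_ge := (@rank_ge R P).
Implicit Types (x y p q u v w : V) (z : nat -> V) (i j : J) (t : ctype P).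

(** A cluster point of the y as s tends to 0; the filter F consists of the sets that contain them
    for all small s. *)
Lemma approach (E : set V) (Q : R -> V -> Prop) : compact E ->
  (forall e, 0 < e -> exists s y, [/\ 0 < s, s < e, E y & Q s y]) ->
  exists2 y, E y & forall e, 0 < e -> exists s y', [/\ 0 < s, s < e, E y', Q s y' & enorm (y' - y) < e].
Proof.
move=> cE hQ.
pose F : set_system V := [set A | exists2 e, 0 < e & forall s y, 0 < s -> s < e -> E y -> Q s y -> A y].
have FF : Filter F.
  constructor.
  - by exists 1.
  - move=> A B [a a0 hA] [b b0 hB]; exists (Num.min a b); first by rewrite lt_min a0.
    move=> s y s0; rewrite lt_min => /andP[sa sb] Ey q.
    by split; [exact: (hA s)|exact: (hB s)].
  - by move=> A B AB [a a0 hA]; exists a => // s y s0 sa Ey q; apply: AB; exact: (hA s).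
have PF : ProperFilter F.
  apply: Build_ProperFilter => -[e e0 H].
  by have [s [y [s0 se Ey q]]] := hQ e e0; exact: (H s y).
have FE : F E by exists 1.
have [y [Ey cy]] := cE F PF FE.
exists y => // e e0.
have FA : F [set y' | exists s, [/\ 0 < s, s < e, E y' & Q s y']].
  by exists e => // s y' s0 se Ey' q; exists s.
have nB : nbhs y [set y' | enorm (y' - y) < e] by apply/nbhs_enorm; exists e.
have [y' [[s [s0 se Ey' q]] ye]] := cy _ _ FA nB.
by exists s, y'.
Qed.

Variable D : R.
Hypotheses (D0 : 0 < D) (Dmax : forall x y, S x -> S y -> dist x y <= D)
  (Dpartner : forall x, S x -> exists2 y, S y & dist x y = D).

(** Partners y' of c + s xi cluster at a partner y of c, in the stratum r of [generic_disc], so eta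
    = y' - y is tangent at y, and it has the length of s xi. Hence y is not a vertex; it is not on
    an edge either, as eta would follow the edge and xi its unfolded direction, which the choice of
    xi avoids. *)
Lemma moving_pair : exists x y j0 j1 xi eta, [/\ S x /\ S y, simple_at x j0 /\ simple_at y j1,
  dist x y = D, xi != 0 /\ (n j0 ∙ xi = 0 /\ n j1 ∙ eta = 0) &
  (exists t w, seg x y t w /\ trT t eta = xi) /\
  forall zeta, tangent y zeta -> zeta != 0 ->
    exists t w, [/\ seg x y t w, trT t eta = xi & w ∙ trT t zeta < 0]].
Proof.
have [j [c [rho [r [rho0 r0 hS cc [hp hno]]]]]] := generic_disc Dmax Dpartner.
have [Sc sc] := hS c cc.
have [e1 e10 [je1 _]] := perp2 (n j) (normal_neq0 j).
pose e2 := cross (n j) e1.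
have je2 : n j ∙ e2 = 0 by rewrite dotpC cross_orthol.
have c12 : cross e1 e2 != 0.
  have -> : cross e1 e2 = (e1 ∙ e1) *: n j.
    have : cross e1 (cross (n j) e1) = (e1 ∙ e1) *: n j - (n j ∙ e1) *: e1.
      by apply: vecP; rewrite /cross !coE; ring.
    by rewrite je1 scale0r subr0.
  by rewrite scaler_eq0 negb_or dotp_eq0 e10 normal_neq0.
(* All images of edge directions under unfoldings, over the finitely many types. *)
have [m hm] := avoid_lines (fun a : ctype P * (J * J) =>
  trT a.1 (cross (n a.2.1) (n a.2.2))) c12.
set xi := e1 + m *: e2 in hm.
have jxi : n j ∙ xi = 0 by rewrite dotpDr dotpZr je1 je2 mulr0 addr0.
have xi0 : xi != 0.
  apply/eqP => e; move: c12.
  have -> : e1 = - (m *: e2) by apply/eqP; rewrite -addr_eq0 -/xi e.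
  have -> : cross (- (m *: e2)) e2 = 0.
    by apply: vecP; rewrite /cross !(coV, co_vec, co_0); ring.
  by rewrite eqxx.
have xn0 : 0 < enorm xi by rewrite enorm_gt0.
have scale_disc s : 0 < s -> s < rho / enorm xi -> disc j c rho (c + s *: xi).
  move=> s0; rewrite ltr_pdivlMr// => sr; split.
    by rewrite dotpDr dotpZr jxi mulr0 addr0; case: sc.
  by rewrite addrAC subrr add0r enormZ gtr0_norm.
have [|y Ey hy] := approach (Q := fun s y => dist (c + s *: xi) y = D /\ s < rho / enorm xi)
    (@rank_ge_compact R P r).
  move=> e e0; pose s := Num.min e (rho / enorm xi) / 2.
  have m0 : 0 < Num.min e (rho / enorm xi) by rewrite lt_min e0 divr_gt0.
  have [se sr] : s < e /\ s < rho / enorm xi.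
    have : Num.min e (rho / enorm xi) <= e by rewrite ge_min lexx.
    have : Num.min e (rho / enorm xi) <= rho / enorm xi by rewrite ge_min lexx orbT.
    by rewrite /s; split; lra.
  have s0 : 0 < s by rewrite divr_gt0.
  have [y Ey dy] := hp _ (scale_disc s s0 sr).
  by exists s, y; split.
have Sy : S y by case: Ey.
have [rc rc0 hrc] := dist_local Sc; have [ry ry0 hry] := dist_local Sy.
have Dcy : dist c y = D.
  apply/le_anti; rewrite Dmax//=; apply/ler_addgt0Pr => e e0.
  pose e' := Num.min (e / 2) (Num.min ry (Num.min (rc / enorm xi) (e / (2 * enorm xi)))).
  have e'0 : 0 < e' by rewrite !lt_min ry0 !divr_gt0// mulr_gt0.
  have [s [y' [s0 se Ey' [dD sr] ye]]] := hy e' e'0.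
  have [Sx' _] := hS _ (scale_disc s s0 sr).
  have Sy' : S y' by case: Ey'.
  move: se ye; rewrite !lt_min => /and4P[_ _ s1 s2] /and4P[y1 y2 _ _].
  rewrite ltr_pdivlMr// in s1; rewrite ltr_pdivlMr ?mulr_gt0// in s2.
  have nx : enorm (c + s *: xi - c) = s * enorm xi.
    by rewrite addrAC subrr add0r enormZ gtr0_norm.
  have := dist_lipschitz Sc Sy Sx' Sy'; rewrite dD (hrc _ Sx') ?nx// (hry _ Sy')//.
  rewrite (enormB c) nx (enormB y) ler_norml => /andP[a _]; lra.
have nEy : ~ rank_ge r.+1 y by move=> /(hno c y cc); rewrite Dcy.
have cy : c != y.
  by apply/eqP => e; move: Dcy; rewrite e dist_xx// => e0; move: D0; rewrite -e0 ltxx.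
have [rk rk0 hk] := directions_spread Sc Sy cy sc D0 Dcy Dmax.
have [rf rf0 hf] := face_local (surface_body Sy).
pose e' := Num.min rk (Num.min rf (rk / enorm xi)).
have e'0 : 0 < e' by rewrite !lt_min rk0 rf0 divr_gt0.
have [s [y' [s0 se Ey' [dD sr] ye]]] := hy e' e'0.
move: se ye; rewrite !lt_min => /and3P[_ _ s1] /and3P[y1 y2 _].
rewrite ltr_pdivlMr// in s1.
pose eta := y' - y.
have teta : tangent y eta by apply: rank_ge_tangent Ey nEy Ey' _ => // i; exact: hf.
have txi : tangent c (s *: xi).
  by move=> i /(proj2 sc) ->; rewrite dotpZr jxi mulr0.
have xk : enorm (s *: xi) < rk by rewrite enormZ gtr0_norm.
have dk : dist (c + s *: xi) (y + eta) = D by rewrite /eta (addrC y) subrK.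
have [A B] := hk (s *: xi) eta xk y1 txi teta dk.
have [t [w [sg te]]] := A.
have eta_enorm : eta ∙ eta = (s *: xi) ∙ (s *: xi).
  by rewrite -te (trT_dot eta eta sg).
have sxi0 : s *: xi != 0 by rewrite scaler_eq0 negb_or gt_eqF.
have eta0 : eta != 0 by rewrite -dotp_gt0 eta_enorm dotp_gt0.
have [Sy1 [y2' y3' r4]] := Ey.
have r3 : (r < 3)%N.
  rewrite ltnNge; apply/negP => r3; have [i [k [l [t0 iy ky ly]]]] := y3' r3.
  case/eqP: eta0; apply: (orth_triple t0); rewrite dotpC; exact: teta.
have r2 : (r < 2)%N.
  rewrite ltnNge; apply/negP => r2; have [i [k [ik iy ky]]] := y2' r2.
  have o1 : eta ∙ n i = 0 by rewrite dotpC teta.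
  have o2 : eta ∙ n k = 0 by rewrite dotpC teta.
  have [d ed] := orth_plane (cross_normal ik iy ky) o1 o2.
  have := hm (t, (i, k)) (s^-1 * d); apply/negP; rewrite negbK /=.
  rewrite -scalerA /trT -trZ -ed -/(trT t eta) te scalerA mulVf ?scale1r//.
  by rewrite gt_eqF.
have [j1 [_ j1y]] := surface_face Sy.
have sy : simple_at y j1.
  split => // i iy; apply/eqP/negPn/negP => ne; apply: nEy; split => //; split.
  - by move=> _; exists i, j1.
  - by rewrite ltnS leqNgt r2.
  - exact: (leq_trans (n := 3)).
exists c, y, j, j1, (s *: xi), eta; split => //.
by split => //; split; [rewrite dotpZr jxi mulr0|exact: teta].
Qed.

(* Two rotations agreeing on a normal and on a tangent vector agree on the whole
   tangent plane. *)
Lemma trT_unique x y j0 j1 xi eta t w zeta : S y -> simple_at x j0 -> simple_at y j1 ->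
  x != y -> seg x y t w -> trT t eta = xi -> n j1 ∙ eta = 0 -> n j1 ∙ zeta = 0 ->
  xi ∙ xi *: trT t zeta = (zeta ∙ eta) *: xi + (zeta ∙ cross (n j1) eta) *: cross (n j0) xi.
Proof.
move=> Sy sx sy xy sg te je jz.
have no := seg_no_opp sg; have e0 := seg_first sx sg; have t0 := seg_tlen sg.
have tl : ((tlen t).-1 < tlen t)%N by rewrite ltn_predL.
have last1 : tfac t (tlen t).-1 = j1.
  have [z [m [[[_ _ [_ ch] _ zT] _] _ _ _ _]]] := sg.
  have [_ [_]] := ch _ tl; rewrite prednK// zT => /(proj2 sy) //.
have tn : trT t (n j1) = n j0 by rewrite /trT -last1 (tr_normal no tl) e0.
have tc : trT t (cross (n j1) eta) = cross (n j0) xi by rewrite /trT (tr_cross _ _ no tl) -!/(trT t _) tn te.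
have ee : eta ∙ eta = xi ∙ xi by rewrite -te (trT_dot eta eta sg).
(* Decomposition along eta and its quarter turn in the tangent plane at y. *)
have dec : (eta ∙ eta) *: zeta = (zeta ∙ eta) *: eta + (zeta ∙ cross (n j1) eta) *: cross (n j1) eta.
  have := cross_triple (n j1) eta (cross (n j1) eta) zeta.
  rewrite (dotpC zeta (n j1)) jz scale0r add0r.
  have -> : triple (n j1) eta (cross (n j1) eta) = eta ∙ eta.
    by rewrite /triple cross_sqr normal1 je expr0n subr0 mul1r.
  move=> ->; congr (_ *: _ + _ ).
  have -> : cross (cross (n j1) eta) (n j1) = (n j1 ∙ n j1) *: eta - (n j1 ∙ eta) *: n j1.
    by apply: vecP; rewrite /cross !coE; ring.
  by rewrite normal1 je scale1r scale0r subr0.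
by rewrite -ee /trT -trZ dec trD !trZ -!/(trT t _) te tc.
Qed.

End ThreeSegments.

(** * Crossing numbers *)

Section SignCount.
Variable R : realType.

(* Along a segment from p to q (in coordinates), count the entries into the open
   positive octant through the faces where the third, resp. second, coordinate
   vanishes. *)
Definition octant (p1 p2 p3 : R) : R := ((0 < p1) && (0 < p2) && (0 < p3))%:R.

Definition entry3 (p1 p2 p3 q1 q2 q3 : R) : R := Num.sg q3 *
  ((p3 * q3 < 0) && (0 < (q2 * p3 - q3 * p2) * p3) && (0 < (q1 * p3 - p1 * q3) * p3))%:R.

Definition entry2 (p1 p2 p3 q1 q2 q3 : R) : R := Num.sg q2 *
  ((p2 * q2 < 0) && ((q2 * p3 - q3 * p2) * p2 < 0) && (0 < (q1 * p2 - p1 * q2) * p2))%:R.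

Section Segment.
Variables p1 p2 p3 q1 q2 q3 : R.
Hypotheses (p20 : p2 != 0) (p30 : p3 != 0) (q20 : q2 != 0) (q30 : q3 != 0).
Let d := q2 * p3 - q3 * p2.
Hypothesis d0 : d != 0.

Lemma entry3E : entry3 p1 p2 p3 q1 q2 q3 = Num.sg q3 *
  (if 0 < p3 then (q3 < 0) && (0 < d) && (0 < q1 * p3 - p1 * q3)
   else (0 < q3) && (d < 0) && (q1 * p3 - p1 * q3 < 0))%:R.
Proof.
rewrite /entry3 -/d; case: ifPn => [h|]; first by rewrite pmulr_rlt0// !pmulr_lgt0.
rewrite -leNgt le_eqVlt (negbTE p30) /= => h.
by rewrite nmulr_rlt0// !nmulr_lgt0.
Qed.

Lemma entry2E : entry2 p1 p2 p3 q1 q2 q3 = Num.sg q2 *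
  (if 0 < p2 then (q2 < 0) && (d < 0) && (0 < q1 * p2 - p1 * q2)
   else (0 < q2) && (0 < d) && (q1 * p2 - p1 * q2 < 0))%:R.
Proof.
rewrite /entry2 -/d; case: ifPn => [h|].
  by rewrite pmulr_rlt0// pmulr_lgt0// pmulr_llt0.
rewrite -leNgt le_eqVlt (negbTE p20) /= => h.
by rewrite nmulr_rlt0// nmulr_lgt0// nmulr_llt0.
Qed.

(** The midpoint lies inside the face of the octant where the first coordinate vanishes. Neither
    entry term counts that crossing, whence the extra sign. *)
Lemma octant_cross : p1 + q1 = 0 -> q1 != 0 -> 0 < p2 + q2 -> 0 < p3 + q3 ->
  octant q1 q2 q3 - octant p1 p2 p3 =
  entry3 p1 p2 p3 q1 q2 q3 + entry2 p1 p2 p3 q1 q2 q3 + Num.sg q1.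
Proof.
move=> e q10 s2 s3; rewrite entry3E entry2E /octant.
have ep : p1 = - q1 by lra.
have c3 : q1 * p3 - p1 * q3 = q1 * (p3 + q3) by rewrite ep; ring.
have c2 : q1 * p2 - p1 * q2 = q1 * (p2 + q2) by rewrite ep; ring.
rewrite c3 c2 (pmulr_lgt0 _ s3) (pmulr_llt0 _ s3) (pmulr_lgt0 _ s2) (pmulr_llt0 _ s2) ep oppr_gt0.
case: (ltgtP p2 0) p20 => // hp2 _; case: (ltgtP q2 0) q20 => // hq2 _;
  try by have := ltrD hp2 hq2; rewrite addr0 ltNge (ltW s2).
all: case: (ltgtP p3 0) p30 => // hp3 _; case: (ltgtP q3 0) q30 => // hq3 _;
  try by have := ltrD hp3 hq3; rewrite addr0 ltNge (ltW s3).
all: case: (ltgtP d 0) d0 => // hd _; case: (ltgtP q1 0) q10 => // hq1 _ /=;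
rewrite ?(gtr0_sg hq2) ?(ltr0_sg hq2) ?(gtr0_sg hq3) ?(ltr0_sg hq3) ?(gtr0_sg hq1) ?(ltr0_sg hq1) ?mulr0 ?mulr1 ?subr0 ?sub0r ?addr0 ?add0r ?subrr ?addNr ?addrN //;
exfalso; move: hd; rewrite /d; clear c3 c2 ep; nra.
Qed.

Hypothesis H : forall l m, 0 <= l -> 0 <= m -> 0 < l + m -> l * p1 + m * q1 = 0 ->
  0 <= l * p2 + m * q2 -> 0 <= l * p3 + m * q3 -> False.

(** By [H] the segment avoids the face where the first coordinate vanishes. Two of its points with
    nonnegative second and third coordinates and first coordinates of opposite signs would have a
    combination on that face. *)
Lemma same_side l m l' m' : 0 <= l -> 0 <= m -> 0 < l + m ->
  0 <= l * p2 + m * q2 -> 0 <= l * p3 + m * q3 ->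
  0 <= l' -> 0 <= m' -> 0 < l' + m' ->
  0 <= l' * p2 + m' * q2 -> 0 <= l' * p3 + m' * q3 ->
  (0 < l * p1 + m * q1) = (0 < l' * p1 + m' * q1) /\
  (l * p1 + m * q1 < 0) = ~~ (0 < l' * p1 + m' * q1).
Proof.
have no a b : 0 <= a -> 0 <= b -> 0 < a + b ->
  0 <= a * p2 + b * q2 -> 0 <= a * p3 + b * q3 -> a * p1 + b * q1 != 0.
  by move=> a0 b0 ab h2 h3; apply/eqP => e; exact: (@H a b).
have opp a b a' b' : 0 <= a -> 0 <= b -> 0 < a + b ->
  0 <= a * p2 + b * q2 -> 0 <= a * p3 + b * q3 ->
  0 <= a' -> 0 <= b' -> 0 < a' + b' ->
  0 <= a' * p2 + b' * q2 -> 0 <= a' * p3 + b' * q3 ->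
  0 < a * p1 + b * q1 -> a' * p1 + b' * q1 < 0 -> False.
  move=> a0 b0 ab h2 h3 a0' b0' ab' h2' h3'.
  set c := a * p1 + b * q1; set c' := a' * p1 + b' * q1 => c0 c0'.
  have k0 : 0 <= - c' by lra.
  have k1 := ltW c0.
  apply: (@H (- c' * a + c * a') (- c' * b + c * b')).
  - by rewrite addr_ge0// mulr_ge0.
  - by rewrite addr_ge0// mulr_ge0.
  - have := mulr_gt0 c0 ab'; have := mulr_ge0 k0 (ltW ab); nra.
  - by rewrite /c /c'; ring.
  - by have := mulr_ge0 k0 h2; have := mulr_ge0 k1 h2'; lra.
  - by have := mulr_ge0 k0 h3; have := mulr_ge0 k1 h3'; lra.
move=> l0 m0 lm h2 h3 l0' m0' lm' h2' h3'.
have := no l m l0 m0 lm h2 h3; have := no l' m' l0' m0' lm' h2' h3'.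
have o1 := opp l m l' m' l0 m0 lm h2 h3 l0' m0' lm' h2' h3'.
have o2 := opp l' m' l m l0' m0' lm' h2' h3' l0 m0 lm h2 h3.
case: (ltgtP (l * p1 + m * q1) 0) => // c; case: (ltgtP (l' * p1 + m' * q1) 0) => // c' _ _.
  by case: (o2 c' c).
by case: (o1 c c').
Qed.

(** For each sign pattern, the first coordinates at the ends and at the points where the segment
    meets the other two coordinate planes are compared by [same_side]. *)
Lemma octant_move : octant q1 q2 q3 - octant p1 p2 p3 =
  entry3 p1 p2 p3 q1 q2 q3 + entry2 p1 p2 p3 q1 q2 q3.
Proof.
rewrite entry3E entry2E /octant.
have side l m l' m' : 0 <= l -> 0 <= m -> 0 < l + m ->
    0 <= l * p2 + m * q2 -> 0 <= l * p3 + m * q3 ->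
    0 <= l' -> 0 <= m' -> 0 < l' + m' ->
    0 <= l' * p2 + m' * q2 -> 0 <= l' * p3 + m' * q3 ->
    (0 < l * p1 + m * q1) = (0 < l' * p1 + m' * q1).
  by move=> *; have [] := @same_side l m l' m'.
(* Up to sign and scale, q3 p - p3 q is the point where the third coordinate vanishes, and q2 p - p2
   q the one for the second. *)
have a3 : (0 < q3 * p1 + - p3 * q1) = (q1 * p3 - p1 * q3 < 0).
  by rewrite -oppr_gt0; congr (0 < _); ring.
have b3 : (0 < - q3 * p1 + p3 * q1) = (0 < q1 * p3 - p1 * q3) by congr (0 < _); ring.
have a2 : (0 < q2 * p1 + - p2 * q1) = (q1 * p2 - p1 * q2 < 0).
  by rewrite -oppr_gt0; congr (0 < _); ring.
have b2 : (0 < - q2 * p1 + p2 * q1) = (0 < q1 * p2 - p1 * q2) by congr (0 < _); ring.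
have ep : (0 < 1 * p1 + 0 * q1) = (0 < p1) by rewrite mul1r mul0r addr0.
have eq : (0 < 0 * p1 + 1 * q1) = (0 < q1) by rewrite mul1r mul0r add0r.
have e32 : q3 * p2 + - p3 * q2 = - d by rewrite /d; ring.
have f32 : - q3 * p2 + p3 * q2 = d by rewrite /d; ring.
have e23 : q2 * p3 + - p2 * q3 = d by rewrite /d; ring.
have f23 : - q2 * p3 + p2 * q3 = - d by rewrite /d; ring.
have e33 : q3 * p3 + - p3 * q3 = 0 by ring.
have f33 : - q3 * p3 + p3 * q3 = 0 by ring.
have e22 : q2 * p2 + - p2 * q2 = 0 by ring.
have f22 : - q2 * p2 + p2 * q2 = 0 by ring.
have pp (a b : R) : 0 < a -> 0 < b -> 0 < a * b by move=> *; exact: mulr_gt0.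
have nn (a b : R) : a < 0 -> b < 0 -> 0 < a * b by move=> a0 b0; rewrite nmulr_rgt0.
have pn (a b : R) : 0 < a -> b < 0 -> a * b < 0 by move=> a0 b0; rewrite pmulr_rlt0.
have np (a b : R) : a < 0 -> 0 < b -> a * b < 0 by move=> a0 b0; rewrite pmulr_llt0.
case: (ltgtP p2 0) p20 => // hp2 _; case: (ltgtP q2 0) q20 => // hq2 _;
case: (ltgtP p3 0) p30 => // hp3 _; case: (ltgtP q3 0) q30 => // hq3 _;
rewrite ?(gtr0_sg hq2) ?(ltr0_sg hq2) ?(gtr0_sg hq3) ?(ltr0_sg hq3) /= ?andbF ?andbT ?mulr0 ?subr0 ?sub0r ?addr0 ?add0r //;
case: (ltgtP d 0) d0 => // hd _ /=; rewrite ?andbF ?mulr0 ?mul0r ?addr0 ?add0r ?subrr ?oppr0 //;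
try (exfalso; move: hd; rewrite /d;
  first [have := pp _ _ hq2 hp3|have := nn _ _ hq2 hp3|have := pn _ _ hq2 hp3|have := np _ _ hq2 hp3];
  first [have := pp _ _ hq3 hp2|have := nn _ _ hq3 hp2|have := pn _ _ hq3 hp2|have := np _ _ hq3 hp2];
  clear pp nn pn np side a3 b3 a2 b2 ep eq e32 f32 e23 f23 e33 f33 e22 f22; lra).
- by rewrite -a3 (side q3 (- p3) 0 1) ?e32 ?e33 ?eq ?mul1r//; clear side a3 b3 a2 b2 ep eq e32 f32 e23 f23 e33 f33 e22 f22; lra.
- by rewrite -a2 (side q2 (- p2) 0 1) ?e22 ?e23 ?eq ?mul1r//; clear side a3 b3 a2 b2 ep eq e32 f32 e23 f23 e33 f33 e22 f22; lra.
- by rewrite -b3 -a2 (side (- q3) p3 q2 (- p2)) ?f32 ?f33 ?e22 ?e23 ?mulN1r ?mul1r ?addNr//; clear side a3 b3 a2 b2 ep eq e32 f32 e23 f23 e33 f33 e22 f22; lra.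
- by rewrite -a2 (side q2 (- p2) 0 1) ?e22 ?e23 ?eq ?mul1r//; clear side a3 b3 a2 b2 ep eq e32 f32 e23 f23 e33 f33 e22 f22; lra.
- by rewrite -a3 -b2 (side q3 (- p3) (- q2) p2) ?e32 ?e33 ?f22 ?f23 ?mulN1r ?mul1r ?addrN//; clear side a3 b3 a2 b2 ep eq e32 f32 e23 f23 e33 f33 e22 f22; lra.
- by rewrite -b2 (side (- q2) p2 1 0) ?f22 ?f23 ?ep ?mulN1r//; clear side a3 b3 a2 b2 ep eq e32 f32 e23 f23 e33 f33 e22 f22; lra.
- by rewrite -b3 (side (- q3) p3 1 0) ?f32 ?f33 ?ep ?mulN1r//; clear side a3 b3 a2 b2 ep eq e32 f32 e23 f23 e33 f33 e22 f22; lra.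
- by rewrite -b2 (side (- q2) p2 1 0) ?f22 ?f23 ?ep ?mulN1r//; clear side a3 b3 a2 b2 ep eq e32 f32 e23 f23 e33 f33 e22 f22; lra.
- by rewrite -a3 (side q3 (- p3) 0 1) ?e32 ?e33 ?eq ?mul1r//; clear side a3 b3 a2 b2 ep eq e32 f32 e23 f23 e33 f33 e22 f22; lra.
- by rewrite -b3 (side (- q3) p3 1 0) ?f32 ?f33 ?ep ?mulN1r//; clear side a3 b3 a2 b2 ep eq e32 f32 e23 f23 e33 f33 e22 f22; lra.
- by rewrite -eq -ep (side 0 1 1 0) ?subrr//; clear side a3 b3 a2 b2 ep eq e32 f32 e23 f23 e33 f33 e22 f22; lra.
- by rewrite -eq -ep (side 0 1 1 0) ?subrr//; clear side a3 b3 a2 b2 ep eq e32 f32 e23 f23 e33 f33 e22 f22; lra.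
Qed.

End Segment.
End SignCount.

Section Winding.
Variable R : realType.
Local Notation V := 'rV[R]_3.
Implicit Types (a b p q r o x y : V) (z : nat -> V).

Section Cone.
Variable r : V.

(* Signed indicator of the cone spanned by r, a and b: its sum over the legs of a chain
   [wind] plays the role of a winding number in the central projection. *)
Definition ind a b p : R := Num.sg (triple r a b) *
  octant (triple p a b / triple r a b) (triple r p b / triple r a b) (triple r a p / triple r a b).

(* Signed crossing of the face spanned by r and a, when moving from p to q. *)
Definition xing a p q : R := Num.sg (triple r a q) *
  ((triple r a p * triple r a q < 0) && (0 < triple r q p * triple r a p) &&
   (0 < triple q a p * triple r a p))%:R.

Definition gen a b := triple r a b != 0.

Section Leg.
Variables a b p q : V.
Hypotheses (ab : gen a b) (ap : gen a p) (aq : gen a q) (bp : gen b p) (bq : gen b q)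
  (pq : gen p q).
Let s := triple r a b.
Let p1 := triple p a b / s. Let p2 := triple r p b / s. Let p3 := triple r a p / s.
Let q1 := triple q a b / s. Let q2 := triple r q b / s. Let q3 := triple r a q / s.

Let pE : p = p1 *: r + p2 *: a + p3 *: b.
Proof.
have := triple_expand r a b p => e.
have -> : p = s^-1 *: (triple r a b *: p) by rewrite scalerA mulVf ?scale1r.
by rewrite e; apply: vecP; rewrite /p1 /p2 /p3 !coV; ring.
Qed.
Let qE : q = q1 *: r + q2 *: a + q3 *: b.
Proof.
have := triple_expand r a b q => e.
have -> : q = s^-1 *: (triple r a b *: q) by rewrite scalerA mulVf ?scale1r.
by rewrite e; apply: vecP; rewrite /q1 /q2 /q3 !coV; ring.
Qed.

Let det_rot u v w : triple u w v = - triple u v w :> R.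
Proof. by rewrite /triple /cross !coE; ring. Qed.
Let s0 : s != 0. Proof. exact: ab. Qed.
Let p30 : p3 != 0. Proof. by rewrite mulf_neq0 ?invr_eq0. Qed.
Let q30 : q3 != 0. Proof. by rewrite mulf_neq0 ?invr_eq0. Qed.
Let p20 : p2 != 0.
Proof. by rewrite mulf_neq0 ?invr_eq0// det_rot oppr_eq0. Qed.
Let q20 : q2 != 0.
Proof. by rewrite mulf_neq0 ?invr_eq0// det_rot oppr_eq0. Qed.

Let rqp : triple r q p = s * (q2 * p3 - q3 * p2).
Proof. by rewrite {1}pE {1}qE /s /triple /cross !coE; ring. Qed.
Let qap : triple q a p = s * (q1 * p3 - p1 * q3).
Proof. by rewrite {1}pE {1}qE /s /triple /cross !coE; ring. Qed.
Let qbp : triple q b p = - s * (q1 * p2 - p1 * q2).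
Proof. by rewrite {1}pE {1}qE /s /triple /cross !coE; ring. Qed.
Let rap : triple r a p = s * p3. Proof. by rewrite /p3 mulrC divfK. Qed.
Let raq : triple r a q = s * q3. Proof. by rewrite /q3 mulrC divfK. Qed.
Let rbp : triple r b p = - s * p2.
Proof. by rewrite det_rot /p2 mulNr mulrC divfK. Qed.
Let rbq : triple r b q = - s * q2.
Proof. by rewrite det_rot /q2 mulNr mulrC divfK. Qed.

Let d0 : q2 * p3 - q3 * p2 != 0.
Proof.
by move: pq; rewrite /gen det_rot rqp oppr_eq0 mulf_eq0 negb_or => /andP[].
Qed.

Let ss : 0 < s * s. Proof. by rewrite -expr2 exprn_even_gt0. Qed.

Let xing_a : xing a p q = Num.sg s * entry3 p1 p2 p3 q1 q2 q3.
Proof.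
rewrite /xing /entry3 rap raq rqp qap sgrM.
have e (u v : R) : s * u * (s * v) = s * s * (u * v) by ring.
by rewrite !e (pmulr_rlt0 _ ss) !(pmulr_rgt0 _ ss) mulrA.
Qed.
Let xing_b : xing b p q = - (Num.sg s * entry2 p1 p2 p3 q1 q2 q3).
Proof.
rewrite /xing /entry2 rbp rbq rqp qbp.
have -> : Num.sg (- s * q2) = - (Num.sg s * Num.sg q2) by rewrite mulNr sgrN sgrM.
have -> : - s * p2 * (- s * q2) = s * s * (p2 * q2) by ring.
have -> : s * (q2 * p3 - q3 * p2) * (- s * p2) = s * s * - ((q2 * p3 - q3 * p2) * p2) by ring.
have -> : - s * (q1 * p2 - p1 * q2) * (- s * p2) = s * s * ((q1 * p2 - p1 * q2) * p2) by ring.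
by rewrite (pmulr_rlt0 _ ss) !(pmulr_rgt0 _ ss) oppr_gt0 mulNr mulrA.
Qed.

(** In the basis (r, a, b) the cone is the positive octant and the hypothesis says that its face
    spanned by a and b is not crossed. Each remaining term involves only one end of the leg ab, so
    the terms telescope along a chain. *)
Lemma ind_move : (forall l m c d, 0 <= l -> 0 <= m -> 0 < l + m -> 0 <= c -> 0 <= d ->
    l *: p + m *: q <> c *: a + d *: b) ->
  ind a b q - ind a b p = xing a p q - xing b p q.
Proof.
move=> H; rewrite xing_a xing_b opprK /ind -/s -mulrBr -/p1 -/p2 -/p3 -/q1 -/q2 -/q3.
rewrite -mulrDr octant_move// => l m l0 m0 lm e1 e2 e3.
apply: (H l m _ _ l0 m0 lm e2 e3); rewrite pE qE.
have -> (x1 x2 x3 y1 y2 y3 : R) : l *: (x1 *: r + x2 *: a + x3 *: b) + m *: (y1 *: r + y2 *: a + y3 *: b) =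
  (l * x1 + m * y1) *: r + (l * x2 + m * y2) *: a + (l * x3 + m * y3) *: b.
  by rewrite !scalerDr !scalerA !scalerDl addrACA (addrACA (_ *: r)).
by rewrite e1 scale0r add0r.
Qed.

Lemma ind_cross (c d : R) : 0 < c -> 0 < d -> p + q = c *: a + d *: b -> triple q a b != 0 ->
  ind a b q - ind a b p = xing a p q - xing b p q + Num.sg (triple q a b).
Proof.
move=> c0 d0' e qab; rewrite xing_a xing_b opprK /ind -/s -mulrBr -/p1 -/p2 -/p3 -/q1 -/q2 -/q3.
have -> : Num.sg (triple q a b) = Num.sg s * Num.sg q1.
  by rewrite -sgrM /q1 mulrC divfK.
have e1 : triple (p + q) a b = 0 by rewrite e /triple /cross !coE; ring.
have e2 : triple r (p + q) b = c * s by rewrite e /s /triple /cross !coE; ring.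
have e3 : triple r a (p + q) = d * s by rewrite e /s /triple /cross !coE; ring.
have tD1 : triple (p + q) a b = triple p a b + triple q a b by rewrite /triple /cross !coE; ring.
have tD2 : triple r (p + q) b = triple r p b + triple r q b by rewrite /triple /cross !coE; ring.
have tD3 : triple r a (p + q) = triple r a p + triple r a q by rewrite /triple /cross !coE; ring.
have t1 : p1 + q1 = 0 by rewrite /p1 /q1 -mulrDl -tD1 e1 mul0r.
have t2 : p2 + q2 = c by rewrite /p2 /q2 -mulrDl -tD2 e2 mulfK.
have t3 : p3 + q3 = d by rewrite /p3 /q3 -mulrDl -tD3 e3 mulfK.
rewrite -!mulrDr octant_cross ?t2 ?t3//.
by rewrite mulf_neq0// invr_eq0.
Qed.

End Leg.

Definition wind (m : nat) z p : R := \sum_(0 <= k < m) ind (z k) (z k.+1) p.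

(** Homogeneous form of the disjointness of the segments pq and ab in the central projection. *)
Definition clear p q a b := forall l m c d, 0 <= l -> 0 <= m -> 0 < l + m -> 0 <= c -> 0 <= d ->
    l *: p + m *: q <> c *: a + d *: b.

Lemma wind_move_eps (m : nat) z p q (e : nat -> R) :
  (forall k, (k < m)%N -> ind (z k) (z k.+1) q - ind (z k) (z k.+1) p =
     xing (z k) p q - xing (z k.+1) p q + e k) ->
  wind m z q - wind m z p = xing (z 0%N) p q - xing (z m) p q + \sum_(0 <= k < m) e k.
Proof.
move=> H; rewrite /wind -sumrB.
rewrite (eq_big_nat _ _ (F2 := fun k => xing (z k) p q - xing (z k.+1) p q + e k)) => [|k /andP[_ km]]; last exact: H.
rewrite big_split /=; congr (_ + _).
rewrite -[LHS]opprK -sumrN (eq_bigr (fun k => xing (z k.+1) p q - xing (z k) p q)).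
  by rewrite telescope_sumr// opprB.
by move=> k _; rewrite opprB.
Qed.

Definition gen_chain (m : nat) z := forall k, (k < m)%N -> gen (z k) (z k.+1).
Definition gen_point (m : nat) z p := forall k, (k <= m)%N -> gen (z k) p.

Lemma wind_move (m : nat) z p q : gen_chain m z -> gen_point m z p -> gen_point m z q ->
  gen p q -> (forall k, (k < m)%N -> clear p q (z k) (z k.+1)) ->
  wind m z q - wind m z p = xing (z 0%N) p q - xing (z m) p q.
Proof.
move=> gz gp gq pq H; rewrite (wind_move_eps (e := fun=> 0)); first by rewrite big1 ?addr0.
move=> k km; rewrite addr0; apply: ind_move; [exact: gz|apply: gp|apply: gq|apply: gp|apply: gq| |exact: H] => //;
  exact: ltnW.
Qed.

Lemma wind_cross (m : nat) z p q (c d : R) : gen_chain m.+1 z -> gen_point m.+1 z p -> gen_point m.+1 z q ->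
  gen p q -> (forall k, (0 < k)%N -> (k <= m)%N -> clear p q (z k) (z k.+1)) ->
  0 < c -> 0 < d -> p + q = c *: z 0%N + d *: z 1%N -> triple q (z 0%N) (z 1%N) != 0 ->
  wind m.+1 z q - wind m.+1 z p = xing (z 0%N) p q - xing (z m.+1) p q
   + Num.sg (triple q (z 0%N) (z 1%N)).
Proof.
move=> gz gp gq pq H c0 d0 e t0.
rewrite (wind_move_eps (e := fun k => if k == 0%N then Num.sg (triple q (z 0%N) (z 1%N)) else 0)).
  by rewrite big_nat_recl//= big1 ?addr0.
case=> [|k] km /=.
  by apply: (ind_cross _ _ _ _ _ _ c0 d0 e t0) => //; [exact: gz|exact: gp|exact: gq|exact: gp|exact: gq].
rewrite addr0; apply: ind_move; [exact: gz|apply: gp|apply: gq|apply: gp|apply: gq| |exact: H] => //;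
  exact: ltnW.
Qed.

Lemma wind_rev (m : nat) z p : wind m (fun k => z (m - k)%N) p = - wind m z p.
Proof.
rewrite /wind -sumrN big_nat_rev /=; apply: eq_big_nat => k /andP[_ km].
rewrite add0n (_ : (m - (m - k.+1)) = k.+1)%N; last by lia.
rewrite (_ : (m - (m - k.+1).+1) = k)%N; last by lia.
rewrite /ind; set s := triple r (z k) (z k.+1).
have -> : triple r (z k.+1) (z k) = - s by rewrite /s /triple /cross !coE; ring.
rewrite sgrN mulNr; congr (- (_ * _)); rewrite /octant.
have -> : triple p (z k.+1) (z k) = - triple p (z k) (z k.+1) by rewrite /triple /cross !coE; ring.
have -> : triple r p (z k) = - triple r (z k) p by rewrite /triple /cross !coE; ring.
have -> : triple r (z k.+1) p = - triple r p (z k.+1) by rewrite /triple /cross !coE; ring.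
by rewrite invrN !mulrNN -!andbA; congr (_ && _)%:R; rewrite andbC.
Qed.

(* Only the segment from p3 to q crosses an arc, the first one; the boundary terms at
   the common endpoints cancel. *)
Lemma fan m1 m2 m3 z1 z2 z3 p1 p2 p3 q (c d : R) :
  z1 0%N = z2 0%N -> z1 0%N = z3 0%N -> z1 m1.+1 = z2 m2 -> z1 m1.+1 = z3 m3 ->
  gen_chain m1.+1 z1 -> gen_chain m2 z2 -> gen_chain m3 z3 ->
  (gen_point m1.+1 z1 q /\ gen_point m1.+1 z1 p2 /\ gen_point m1.+1 z1 p3) ->
  (gen_point m2 z2 q /\ gen_point m2 z2 p1 /\ gen_point m2 z2 p3) ->
  (gen_point m3 z3 q /\ gen_point m3 z3 p1 /\ gen_point m3 z3 p2) ->
  gen p3 q -> gen p1 q -> gen p2 q ->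
  (forall k, (0 < k)%N -> (k <= m1)%N -> clear p3 q (z1 k) (z1 k.+1)) ->
  (forall k, (k < m1.+1)%N -> clear p2 q (z1 k) (z1 k.+1)) ->
  (forall k, (k < m2)%N -> clear p3 q (z2 k) (z2 k.+1)) ->
  (forall k, (k < m2)%N -> clear p1 q (z2 k) (z2 k.+1)) ->
  (forall k, (k < m3)%N -> clear p1 q (z3 k) (z3 k.+1)) ->
  (forall k, (k < m3)%N -> clear p2 q (z3 k) (z3 k.+1)) ->
  0 < c -> 0 < d -> p3 + q = c *: z1 0%N + d *: z1 1%N -> triple q (z1 0%N) (z1 1%N) != 0 ->
  (wind m1.+1 z1 p3 - wind m2 z2 p3) + (wind m2 z2 p1 - wind m3 z3 p1)
    + (wind m3 z3 p2 - wind m1.+1 z1 p2) = - Num.sg (triple q (z1 0%N) (z1 1%N)).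
Proof.
move=> e12 e13 f12 f13 g1 g2 g3 [g1q [g12 g13]] [g2q [g21 g23]] [g3q [g31 g32]] gp3 gp1 gp2
  c13 c12 c23 c21 c31 c32 c0 d0 e t0.
have := wind_cross g1 g13 g1q gp3 c13 c0 d0 e t0.
have := wind_move g1 g12 g1q gp2 c12.
have := wind_move g2 g23 g2q gp3 c23; have := wind_move g2 g21 g2q gp1 c21.
have := wind_move g3 g31 g3q gp1 c31; have := wind_move g3 g32 g3q gp2 c32.
rewrite -e12 -e13 -f12 -f13; lra.
Qed.

End Cone.

End Winding.

(** * Intersections of shortest paths *)

Section Crossing.
Variables (R : realType) (P : polytope R).
Local Notation V := 'rV[R]_3.
Local Notation J := (facet P).
Local Notation n := (@normal R P).
Local Notation h := (@height R P).
Local Notation K := (body P).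
Local Notation S := (surface P).
Local Notation face := (@face R P).
Local Notation dist := (@dist R P).
Implicit Types (p q u v w : V) (z : nat -> V) (i j : J) (s : nat -> J).

Definition on_seg p q u := exists2 t : R, 0 <= t <= 1 & u = p + t *: (q - p).

Definition leg z k p := on_seg (z k) (z k.+1) p.

Lemma leg_face j z k p : face j (z k) -> face j (z k.+1) -> leg z k p -> face j p.
Proof.
move=> [Ka ja] [Kb jb] [t t01 ->]; split; first exact: body_convex.
by rewrite !dotE ja jb; ring.
Qed.

Lemma leg_enorm z k p : leg z k p ->
  enorm (p - z k) + enorm (z k.+1 - p) = enorm (z k.+1 - z k).
Proof.
move=> [t /andP[t0 t1] ->].
have -> : z k + t *: (z k.+1 - z k) - z k = t *: (z k.+1 - z k).
  by rewrite addrAC subrr add0r.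
have -> : z k.+1 - (z k + t *: (z k.+1 - z k)) = (1 - t) *: (z k.+1 - z k).
  by rewrite scalerBl scale1r opprD addrA.
by rewrite !enormZ !ger0_norm ?subr_ge0//; ring.
Qed.

Lemma leg_tight z k p i t : n i ∙ z k <= h i -> n i ∙ z k.+1 <= h i -> 0 < t < 1 ->
  p = z k + t *: (z k.+1 - z k) -> n i ∙ p = h i -> n i ∙ z k = h i /\ n i ∙ z k.+1 = h i.
Proof. by move=> a b t01 ->; rewrite !dotE; split; nra. Qed.

Variables (x y : V) (i0 j0 : J).
Hypotheses (Sx : S x) (Sy : S y) (xy : x != y) (xs : simple_at x i0) (ys : simple_at y j0).

(** The properties of a shortest chain that [taut_rev] transfers to the reversed chain. *)
Definition taut m s z := [/\ (0 < m)%N /\ @is_chain R P m s z, forall k, (k < m)%N -> z k != z k.+1,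
  z 0%N = x, z m = y & clen m z = dist x y].

Definition shortest m s z := @geodesic R P m s z /\ taut m s z.

Section Taut.
Variables (m : nat) (s : nat -> J) (z : nat -> V).
Hypothesis g : taut m s z.

Let m0 : (0 < m)%N. Proof. by case: g => [[]]. Qed.
Let ch : is_chain m s z. Proof. by case: g => [[]]. Qed.
Let nz k : (k < m)%N -> z k != z k.+1. Proof. by case: g => _ H _ _ _; exact: H. Qed.
Let z0 : z 0%N = x. Proof. by case: g. Qed.
Let zm : z m = y. Proof. by case: g. Qed.
Let cl : clen m z = dist x y. Proof. by case: g. Qed.

Lemma leg_surface k p : (k < m)%N -> leg z k p -> S p.
Proof. by move=> km lp; have [a b] := ch km; exact: face_surface (leg_face a b lp). Qed.

(** The upper bounds for the parts add up to [dist x y], so each of them is an equality. *)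
Lemma leg_dist k p : (k < m)%N -> leg z k p ->
  dist x p = clen k z + enorm (p - z k) /\
  dist p y = enorm (z k.+1 - p) + \sum_(k.+1 <= l < m) enorm (z l.+1 - z l).
Proof.
move=> km lp; have [a b] := ch km; have f := leg_face a b lp.
have Sp := leg_surface km lp.
have d1 : dist x (z k) <= clen k z.
  by rewrite -{1}z0 /clen; apply: (chain_dist ch) => //; exact: ltnW.
have d2 : dist (z k.+1) y <= \sum_(k.+1 <= l < m) enorm (z l.+1 - z l).
  by rewrite -{1}zm; apply: (chain_dist ch).
have t1 := dist_triangle Sx (face_surface a) Sp; rewrite (dist_face a f) enormB in t1.
have t2 := dist_triangle Sp (face_surface b) Sy; rewrite (dist_face f b) enormB in t2.
have t3 := dist_triangle Sx Sp Sy.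
have e := leg_enorm lp.
have : clen m z = clen k z + enorm (z k.+1 - z k) + \sum_(k.+1 <= l < m) enorm (z l.+1 - z l).
  rewrite /clen (@big_cat_nat _ _ _ k) ?(ltnW km)//=.
  by rewrite (big_ltn km) addrA.
rewrite cl; lra.
Qed.

Lemma leg_between k p : (k < m)%N -> leg z k p -> dist x p + dist p y = dist x y.
Proof.
move=> km lp; have [-> ->] := leg_dist km lp; rewrite -cl.
have -> : clen m z = clen k z + \sum_(k <= l < m) enorm (z l.+1 - z l).
  by rewrite /clen (@big_cat_nat _ _ _ k) ?(ltnW km).
by rewrite (big_ltn km) -(leg_enorm lp); ring.
Qed.

Lemma leg0 k : leg z k (z k).
Proof. by exists 0; rewrite ?lexx ?ler01// scale0r addr0. Qed.

Lemma leg1 k : leg z k (z k.+1).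
Proof. by exists 1; rewrite ?lexx ?ler01// scale1r addrC subrK. Qed.

Lemma vertex_first k : (k < m)%N -> z k.+1 != x.
Proof.
move=> km; apply/eqP => e; have [+ _] := leg_dist km (leg1 k).
rewrite e dist_xx// -e; have : 0 < enorm (z k.+1 - z k) by rewrite enorm_gt0 subr_eq0 eq_sym nz.
have : 0 <= clen k z by apply: sumr_ge0 => l _; exact: enorm_ge0.
lra.
Qed.

Lemma vertex_last k : (k < m)%N -> z k != y.
Proof.
move=> km; apply/eqP => e; have [_ +] := leg_dist km (leg0 k).
rewrite e dist_xx// -e; have : 0 < enorm (z k.+1 - z k) by rewrite enorm_gt0 subr_eq0 eq_sym nz.
have : 0 <= \sum_(k.+1 <= l < m) enorm (z l.+1 - z l) by apply: sumr_ge0 => l _; exact: enorm_ge0.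
lra.
Qed.

End Taut.

Section One.
Variables (m : nat) (s : nat -> J) (z : nat -> V).
Hypothesis g : shortest m s z.

Let inj : inj_below m s. Proof. by case: g => [[[]]]. Qed.
Let ch : is_chain m s z. Proof. by case: g => [[]]. Qed.
Let z0 : z 0%N = x. Proof. by case: g => _ []. Qed.
Let zm : z m = y. Proof. by case: g => _ []. Qed.

Lemma vertex_tight k i : (k.+1 < m)%N -> n i ∙ z k.+1 = h i <-> i = s k \/ i = s k.+1.
Proof.
move=> km; split; first by case: g => [[_ _ _ H _] _]; exact: H.
have [_ [_ f1]] := ch (ltnW km); have [[_ f2] _] := ch km.
by case=> ->.
Qed.

Lemma facet_neq k : (k.+1 < m)%N -> s k <> s k.+1.
Proof. by move=> km /(inj (ltnW km) km) /eqP; rewrite -[X in X == _]addn0 -addn1 eqn_add2l. Qed.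

Lemma leg_inner k p i : (k < m)%N -> leg z k p -> p != z k -> p != z k.+1 ->
  n i ∙ p = h i -> i = s k.
Proof.
move=> km [t t01 pE] pa pb ip; have [[Ka ka] [Kb kb]] := ch km.
have t0 : t != 0 by apply: contraNneq pa => t0; rewrite pE t0 scale0r addr0.
have t1 : t != 1 by apply: contraNneq pb => t1; rewrite pE t1 scale1r addrC subrK.
have t01' : 0 < t < 1 by rewrite !lt_def t0 (eq_sym 1) t1.
have [ia ib] := leg_tight (Ka i) (Kb i) t01' pE ip.
have [km1|mk] := ltnP k.+1 m; last first.
  have e : k.+1 = m by apply/eqP; rewrite eqn_leq km mk.
  rewrite e zm in ib kb; case: ys => _ H; by rewrite (H _ ib) (H _ kb).
have [//|ik1] := proj1 (@vertex_tight _ i km1) ib.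
case: k km t01' ka kb ia ib km1 ik1 {pE pa pb Ka Kb} => [|k] km _ ka kb ia ib km1 ik1.
  rewrite z0 in ka ia; case: xs => _ H; by rewrite (H _ ia) (H _ ka).
have [ik|//] := proj1 (@vertex_tight _ i km) ia.
have := inj (ltnW km) km1; rewrite -ik ik1 => /(_ erefl) /eqP.
by rewrite -[X in X == _]addn0 -addn2 eqn_add2l.
Qed.

End One.

(* A shortest path through p arrives from a in facet i with direction e and leaves
   towards b in facet j with direction f. *)
Definition pass p i (e a : V) j (f b : V) := [/\ (face i a /\ face i p) /\ (face j p /\ face j b),
  (a != p /\ e = (enorm (p - a))^-1 *: (p - a)) /\ (p != b /\ f = (enorm (b - p))^-1 *: (b - p)),
  forall k, n k ∙ p = h k <-> k = i \/ k = j,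
  (i = j -> e = f) /\ (i <> j -> rot (n i) (n j) f = e /\ 0 < n j ∙ e) &
  dist x p = dist x a + enorm (p - a) /\ dist p y = enorm (b - p) + dist b y].

Lemma pass_vertex m s z k : shortest m s z -> (k.+1 < m)%N ->
  pass (z k.+1) (s k) (dir z k) (z k) (s k.+1) (dir z k.+1) (z k.+2).
Proof.
move=> g km; have km' := ltnW km; have [[_ ch nz _ bend] _] := g.
split; [split; [exact: ch|exact: ch]|split; split; rewrite ?nz//| | |].
- by move=> i; exact: (vertex_tight g i km).
- by split=> [/(facet_neq g km)//|_]; exact: bend.
- have [a _] := leg_dist (proj2 g) km' (leg1 z k); have [b _] := leg_dist (proj2 g) km' (leg0 z k).
  have [_ c] := leg_dist (proj2 g) km (leg1 z k.+1); have [_ d] := leg_dist (proj2 g) km (leg0 z k.+1).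
  by rewrite a b c d !subrr enorm0 addr0 add0r.
Qed.

Lemma pass_inner m s z k p : shortest m s z -> (k < m)%N -> leg z k p -> p != z k -> p != z k.+1 ->
  pass p (s k) (dir z k) (z k) (s k) (dir z k) (z k.+1).
Proof.
move=> g km lp pa pb; have [[_ ch nz _ bend] _] := g; have [fa fb] := ch k km.
have fp := leg_face fa fb lp.
have dE := dir_scale (nz k km); have ab0 : 0 < enorm (z k.+1 - z k) by rewrite enorm_gt0 subr_eq0 eq_sym nz.
have d1 : enorm (dir z k) = 1 by rewrite /enorm dir1 ?sqrtr1// nz.
have unit (c : R) v : 0 <= c -> v = c *: dir z k -> v != 0 -> dir z k = (enorm v)^-1 *: v.
  move=> c0 -> nz0; rewrite enormZ d1 mulr1 ger0_norm// scalerA mulVf ?scale1r//.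
  by apply: contraNneq nz0 => ->; rewrite scale0r.
have lp' := lp; have [t /andP[t0 t1] pE] := lp.
have e1 : p - z k = (t * enorm (z k.+1 - z k)) *: dir z k.
  by rewrite -scalerA dE pE addrAC subrr add0r.
have e2 : z k.+1 - p = ((1 - t) * enorm (z k.+1 - z k)) *: dir z k.
  by rewrite -scalerA dE pE scalerBl scale1r opprD addrA.
split; [by []|split; split| |by []|].
- by rewrite eq_sym.
- by apply: unit e1 _; rewrite ?mulr_ge0 ?(ltW ab0)// subr_eq0.
- by [].
- by apply: unit e2 _; rewrite ?mulr_ge0 ?subr_ge0 ?(ltW ab0)// subr_eq0 eq_sym.
- by move=> i; split=> [/(leg_inner g km lp pa pb)|[]] ->; [left| |]; case: fp.
- have [a c] := leg_dist (proj2 g) km lp; have [b _] := leg_dist (proj2 g) km (leg0 z k).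
  have [_ d] := leg_dist (proj2 g) km (leg1 z k).
  by rewrite a b c d !subrr enorm0 addr0 add0r.
Qed.

(** At a vertex the leg leaving it is chosen, so that p is never the end of the outgoing leg. *)
Lemma pass_exists m s z k p : shortest m s z -> (k < m)%N -> leg z k p -> p != x -> p != y ->
  exists k' i e a, [/\ (k' < m)%N, leg z k' p & pass p i e a (s k') (dir z k') (z k'.+1)].
Proof.
move=> g km lp px py.
have [pe|pb] := eqVneq p (z k.+1).
  have km1 : (k.+1 < m)%N.
    rewrite ltn_neqAle km andbT; apply/eqP => e; move/eqP: py; apply.
    by rewrite pe e; case: g => _ [].
  exists k.+1, (s k), (dir z k), (z k); rewrite pe; split => //; first exact: leg0.
  exact: (pass_vertex g km1).
have [pe|pa] := eqVneq p (z k); last first.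
  by exists k, (s k), (dir z k), (z k); split => //; exact: (pass_inner g km lp pa pb).
case: k km lp pb pe => [|k] km lp pb pe.
  by move/eqP: px; case; rewrite pe; case: g => _ [].
exists k.+1, (s k), (dir z k), (z k); split => //.
by rewrite pe; exact: (pass_vertex g km).
Qed.


(** Arriving by the first path and leaving by the second is again shortest, hence straight at p.
    Inside a facet, or across the same edge in the same sense, this determines the outgoing
    direction. Turning back into facet i would make e the direction of a segment of that facet,
    against n_j ∙ e > 0. *)
Lemma pass_swap p i e a j f b i' e' a' j' f' b' : dist x p + dist p y = dist x y ->
  pass p i e a j f b -> pass p i' e' a' j' f' b' -> j = j' /\ f = f'.
Proof.
move=> btw [[[ia ip] [jp jb]] [[ap eE] [pb fE]] N [st bd] [dx dy]].
move=> [[[ia' ip'] [jp' jb']] [[ap' eE'] [pb' fE']] N' [st' bd'] [dx' dy']].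
have Sp := face_surface ip; have Sa := face_surface ia; have Sb := face_surface jb'.
have short : dist a b' = enorm (p - a) + enorm (b' - p).
  have := dist_triangle Sx Sa Sy; have := dist_triangle Sa Sb Sy.
  have := dist_triangle Sa Sp Sb; rewrite (dist_face ia ip) (dist_face jp' jb') enormB (enormB p b').
  lra.
have straight : face i b' -> e = f'.
  move=> ib'; rewrite eE fE'; symmetry; apply: enorm_collinear; rewrite ?subr_eq0 1?eq_sym//.
  by rewrite -short (dist_face ia ib') enormB; congr enorm; rewrite addrC addrA subrK.
have [ij|/eqP ij] := eqVneq i j.
  have ij' : j' = i.
    have : n j' ∙ p = h j' by apply/N'; right.
    by move=> /N[->//|->].
  by rewrite -(st ij) -ij ij'; split=> //; apply: straight; rewrite -ij'.
have [j'j|/eqP j'j] := eqVneq j' j.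
  have i'i : i' = i.
    have : n i ∙ p = h i by apply/N; left.
    by move=> /N'[->//|]; rewrite j'j.
  split=> //; have [rf _] := bd ij; have c1 := normal_opp (proj2 ip) (proj2 jp).
  have rf' : rot (n i) (n j) f' = e.
    rewrite j'j in jb'; move/eqP: (ij) => ij0.
    have -> : e = - ((enorm (a - p))^-1 *: (a - p)) by rewrite enormB eE -scalerN opprB.
    apply: (bend_rot ij0 ia ip jp jb' ap _ _ erefl fE'); first by rewrite eq_sym.
    by rewrite short (enormB p a) (enormB b').
  have inv v : rot (n j) (n i) (rot (n i) (n j) v) = v by apply: rot_inv; rewrite ?normal1.
  by rewrite -(inv f) -(inv f') rf rf'.
have j'i : j' = i.
  have : n j' ∙ p = h j' by apply/N'; right.
  by move=> /N[].
have ib' : face i b' by rewrite -j'i.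
have [_ pos] := bd ij; move: pos; rewrite (straight ib') fE'.
have [Kb _] := jb'; have := Kb j; have := proj2 jp.
have l0 : 0 < enorm (b' - p) by rewrite enorm_gt0 subr_eq0 eq_sym.
by move=> jp0 jb0; rewrite dotpZr pmulr_rgt0 ?invr_gt0// dotpB jp0 subr_gt0 => jb1; move: jb0; rewrite leNgt jb1.
Qed.


Lemma leg_rest m s z k p : shortest m s z -> (k < m)%N -> leg z k p -> p != z k.+1 ->
  z k.+1 = p + enorm (z k.+1 - p) *: dir z k.
Proof.
move=> [[_ _ nz _ _] _] km [t /andP[t0 t1] pE] pb.
have e2 : z k.+1 - p = (1 - t) *: (z k.+1 - z k).
  by rewrite pE scalerBl scale1r opprD addrA.
by rewrite e2 enormZ ger0_norm ?subr_ge0// -scalerA dir_scale ?nz// -e2 addrC subrK.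
Qed.

(* Otherwise z (k + 1), which is an endpoint or lies on two facets, would be interior
   to a leg of z'. *)
Lemma no_overshoot m s z k m' s' z' l p : shortest m s z -> shortest m' s' z' ->
  (k < m)%N -> (l < m')%N -> leg z k p -> leg z' l p -> p != z k.+1 -> p != z' l.+1 ->
  dir z k = dir z' l -> enorm (z' l.+1 - p) <= enorm (z k.+1 - p).
Proof.
move=> g g' km lm lp lp' pb pb' de; rewrite leNgt; apply/negP => lt.
set c := enorm (z k.+1 - p) in lt *; set c' := enorm (z' l.+1 - p) in lt *.
have c0 : 0 < c by rewrite enorm_gt0 subr_eq0 eq_sym.
have c'0 : 0 < c' by apply: lt_trans lt.
have qE : z k.+1 = p + (c / c') *: (z' l.+1 - p).
  rewrite (leg_rest g' lm lp' pb') -/c' -de addrAC subrr add0r scalerA divfK ?gt_eqF//.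
  exact: leg_rest g km lp pb.
have lq : leg z' l (z k.+1) /\ z k.+1 != z' l.
  have [t /andP[t0 t1] pE] := lp'.
  pose r := c / c'; have r01 : 0 < r < 1 by rewrite divr_gt0//= ltr_pdivrMr// mul1r.
  have E : z k.+1 - z' l = (t + r * (1 - t)) *: (z' l.+1 - z' l).
    by rewrite qE -/r pE; apply: vecP; rewrite !coV; ring.
  have t1' : t != 1 by apply: contraNneq pb' => t1'; rewrite pE t1' scale1r addrC subrK.
  have t1l : 0 < 1 - t by rewrite subr_gt0 lt_def eq_sym t1' t1.
  split; first by exists (t + r * (1 - t)); [apply/andP; split; nra|rewrite -E addrC subrK].
  rewrite -subr_eq0 E scaler_eq0 negb_or subr_eq0; have [[_ _ nz _ _] _] := g'.
  by rewrite (eq_sym (z' l.+1)) nz// andbT gt_eqF//; nra.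
have [lq0 q0] := lq.
have qb : z k.+1 != z' l.+1.
  apply/eqP => e; move: lt; rewrite /c /c' e; lra.
have [km1|mk] := ltnP k.+1 m.
  have /(vertex_tight g _ km1) e1 : s k = s k \/ s k = s k.+1 by left.
  have /(vertex_tight g _ km1) e2 : s k.+1 = s k \/ s k.+1 = s k.+1 by right.
  have := facet_neq g km1; apply.
  by rewrite (leg_inner g' lm lq0 q0 qb e1) (leg_inner g' lm lq0 q0 qb e2).
have e : z k.+1 = y by have -> : k.+1 = m; [apply/eqP; rewrite eqn_leq km mk|case: g => _ []].
have [_ ] := leg_dist (proj2 g') lm lq0; rewrite e dist_xx// -e.
have : 0 < enorm (z' l.+1 - z k.+1) by rewrite enorm_gt0 subr_eq0 eq_sym.
have : 0 <= \sum_(l.+1 <= i < m') enorm (z' i.+1 - z' i) by apply: sumr_ge0 => *; exact: enorm_ge0.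
lra.
Qed.

(** With a common point, facet and direction the two legs end at the same vertex by [no_overshoot].
    The next facet is the other one there, and the rotation fixes the next direction; so the paths
    agree up to y. *)
Lemma forward m s z m' s' z' : shortest m s z -> shortest m' s' z' -> forall N k l p,
  (m - k <= N)%N -> (k < m)%N -> (l < m')%N -> leg z k p -> leg z' l p -> p != z k.+1 -> p != z' l.+1 ->
  s k = s' l -> dir z k = dir z' l -> dir z m.-1 = dir z' m'.-1.
Proof.
move=> g g'; elim=> [|N ih] k l p kN km lm lp lp' pb pb' se de.
  by move: kN; rewrite leqn0 subn_eq0 leqNgt km.
have ce : enorm (z' l.+1 - p) = enorm (z k.+1 - p).
  apply/le_anti; rewrite (no_overshoot g g' km lm lp lp')//=.
  by rewrite (no_overshoot g' g lm km lp' lp).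
have ze : z k.+1 = z' l.+1.
  by rewrite (leg_rest g km lp pb) (leg_rest g' lm lp' pb') ce de.
have [km1|mk] := ltnP k.+1 m; have [lm1|ml] := ltnP l.+1 m'.
- have sn : s k.+1 = s' l.+1.
    have /(vertex_tight g _ km1) : s k.+1 = s k \/ s k.+1 = s k.+1 by right.
    rewrite ze => /(vertex_tight g' _ lm1)[]//; rewrite -se => e.
    by case: (facet_neq g km1).
  have [[_ ch nz _ bend] _] := g; have [[_ ch' nz' _ bend'] _] := g'.
  apply: (ih k.+1 l.+1 (z k.+1)) => //.
  - by rewrite subnS; case: (m - k)%N kN.
  - exact: leg0.
  - by rewrite ze; exact: leg0.
  - exact: nz.
  - by rewrite ze; exact: nz'.
  - have [b _] := bend k km1; have [b' _] := bend' l lm1; rewrite -se -sn in b'.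
    have c1 : 1 + n (s k) ∙ n (s k.+1) != 0.
      have [_ [_ f1]] := ch k km; have [[_ f2] _] := ch k.+1 km1.
      exact: (normal_opp f1 f2).
    have inv v : rot (n (s k.+1)) (n (s k)) (rot (n (s k)) (n (s k.+1)) v) = v.
      by apply: rot_inv; rewrite ?normal1.
    by rewrite -(inv (dir z k.+1)) b de -b' inv.
- have e : l.+1 = m' by apply/eqP; rewrite eqn_leq lm ml.
  have := vertex_last (proj2 g) km1; rewrite ze e.
  by have [_ [_ _ _ -> _]] := g'; rewrite eqxx.
- have e : k.+1 = m by apply/eqP; rewrite eqn_leq km mk.
  have := vertex_last (proj2 g') lm1; rewrite -ze e.
  by have [_ [_ _ _ -> _]] := g; rewrite eqxx.
- have <- : k.+1 = m by apply/eqP; rewrite eqn_leq km mk.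
  by have <- : l.+1 = m' by apply/eqP; rewrite eqn_leq lm ml.
Qed.

Lemma shortest_disjoint m s z m' s' z' k l p : shortest m s z -> shortest m' s' z' ->
  (k < m)%N -> (l < m')%N -> leg z k p -> leg z' l p -> dir z m.-1 <> dir z' m'.-1 ->
  p = x \/ p = y.
Proof.
move=> g g' km lm lp lp' ne; have [|px] := eqVneq p x; first by left.
have [|py] := eqVneq p y; first by right.
have [k' [i [e [a [km' lp1 pa]]]]] := pass_exists g km lp px py.
have [l' [i' [e' [a' [lm' lp1' pa']]]]] := pass_exists g' lm lp' px py.
have [se de] := pass_swap (leg_between (proj2 g) km lp) pa pa'.
case: ne; apply: (forward g g' (leqnn _) km' lm' lp1 lp1') => //.
  by case: pa => _ [_ []].
by case: pa' => _ [_ []].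
Qed.
End Crossing.

(** * Three shortest paths *)

Section PlaneInequalities.
Variable R : realType.
Implicit Types a b s t u v : R.

Lemma conv_gt0 t u v : 0 < u -> 0 < v -> 0 <= t <= 1 -> 0 < (1 - t) * u + t * v.
Proof.
move=> u0 v0 /andP[t0 t1]; have [->|tn] := eqVneq t 0; first by rewrite subr0 mul1r mul0r addr0.
by rewrite ltr_wpDl// ?mulr_ge0 ?subr_ge0 ?(ltW u0)// mulr_gt0// lt_def tn.
Qed.

(** Coordinates in the basis (d1, d2) at x: the segment from (1, 0) to (|a| + 1, - b) misses the ray
    of (a, b). The next two lemmas treat the segment from (0, 1) with the ray of (a, b), and the one
    from (a, b) with the ray of (0, 1). *)
Lemma plane_clear1 a b t s : b < 0 -> 0 <= t <= 1 -> 0 <= s ->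
  (1 - t) * 1 + t * (`|a| + 1) = s * a -> (1 - t) * 0 + t * - b = s * b -> False.
Proof.
move=> b0 t01 s0 h1 h2; have h3 : (s + t) * b = 0 by lra.
move/eqP: h3; rewrite mulf_eq0 (lt_eqF b0) orbF => /eqP h3.
have t0 : t = 0 by lra.
have s00 : s = 0 by lra.
by move: h1; rewrite t0 s00; lra.
Qed.

Lemma plane_clear2 a b t s : b < 0 -> 0 <= t <= 1 -> 0 <= s ->
  (1 - t) * 0 + t * (`|a| + 1) = s * a -> (1 - t) * 1 + t * - b = s * b -> False.
Proof.
move=> b0 t01 s0 _ h; have b0' : 0 < - b by rewrite oppr_gt0.
have := conv_gt0 ltr01 b0' t01; rewrite h ltNge => /negP; apply.
by rewrite mulr_ge0_le0// ltW.
Qed.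

Lemma plane_clear3 a b t s : b < 0 -> 0 <= t <= 1 -> 0 <= s ->
  (1 - t) * a + t * (`|a| + 1) = s * 0 -> (1 - t) * b + t * - b = s * 1 -> False.
Proof.
move=> b0 t01 s0 h1 h2; have b0' : 0 < - b by rewrite oppr_gt0.
have t2 : 0 <= (2 * t - 1) * - b by lra.
rewrite pmulr_lge0// in t2.
have na := ler_norm (- a); rewrite normrN in na.
have t3 : 0 <= 1 - t by lra.
have := mulr_ge0 t2 (normr_ge0 a); have := ler_wpM2l t3 na; lra.
Qed.

End PlaneInequalities.

Section LocalFan.
Variables (R : realType) (P : polytope R).
Local Notation V := 'rV[R]_3.
Local Notation J := (facet P).
Local Notation n := (@normal R P).
Local Notation h := (@height R P).
Local Notation K := (body P).
Local Notation S := (surface P).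
Local Notation face := (@face R P).
Implicit Types (o p q r u v w x : V) (z : nat -> V) (i j : J).

(** Finitely many planes cover no ball: leave them one at a time, shrinking the ball. *)
Lemma dense_planes (T : eqType) (A : T -> V) (c : T -> R) (l : seq T) (o : V) (e : R) :
  0 < e -> exists o' d, [/\ 0 < d, forall q, enorm (q - o') < d -> enorm (q - o) < e &
    forall q, enorm (q - o') < d -> forall t, t \in l -> A t != 0 -> A t ∙ q != c t].
Proof.
move=> e0; elim: l => [|t l [c1 [d1 [d10 h1 h2]]]]; first by exists o, e.
have [At|At] := eqVneq (A t) 0.
  exists c1, d1; split => // q qo t'; rewrite in_cons => /orP[/eqP ->|]; last exact: h2.
  by rewrite At eqxx.
have a0 : 0 < enorm (A t) by rewrite enorm_gt0.
have [c2 c21 c2c] : exists2 c2, enorm (c2 - c1) < d1 & A t ∙ c2 != c t.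
  have [ec|ne] := eqVneq (A t ∙ c1) (c t); last by exists c1; rewrite // subrr enorm0.
  exists (c1 + (d1 / (2 * enorm (A t))) *: A t).
    rewrite addrAC subrr add0r enormZ ger0_norm; last by rewrite divr_ge0 ?mulr_ge0 // ltW.
    have -> : d1 / (2 * enorm (A t)) * enorm (A t) = d1 / 2 by field; rewrite gt_eqF.
    by lra.
  rewrite !dotE ec -subr_eq0 addrAC subrr add0r mulf_neq0 ?dotp_eq0//.
  by rewrite gt_eqF// divr_gt0 ?mulr_gt0.
have g0 : 0 < `|A t ∙ c2 - c t| by rewrite normr_gt0 subr_eq0.
exists c2, (Num.min (d1 - enorm (c2 - c1)) (`|A t ∙ c2 - c t| / enorm (A t))).
have near q : enorm (q - c2) < d1 - enorm (c2 - c1) -> enorm (q - c1) < d1.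
  by have := enorm_dist3 q c2 c1; lra.
split.
- by rewrite lt_min subr_gt0 c21 divr_gt0.
- by move=> q; rewrite lt_min => /andP[/near/h1].
move=> q; rewrite lt_min => /andP[/near/h2 H1 H2] t'; rewrite in_cons => /orP[/eqP ->|]; last exact: H1.
move=> _; apply: contraTneq H2 => ec; rewrite -leNgt ler_pdivrMr// -ec -dotpB.
rewrite ler_norml; have := cauchy (A t) (q - c2); have := cauchyN (A t) (q - c2).
rewrite !dotpB mulrC; lra.
Qed.

(** First o is moved off the lines through two points of L, then r off the planes spanned by two of
    these points seen from o. *)
Lemma generic_frame (L : seq V) : exists o r, (forall j, n j ∙ o < h j) /\
  forall a b, a \in L -> b \in L -> a != b -> triple r (a - o) (b - o) != 0.
Proof.
have [d d0 hd] : exists2 d : R, 0 < d & forall q, enorm (q - center P) < d -> forall j, n j ∙ q < h j.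
  have gap j : 0 < h j - n j ∙ center P by rewrite subr_gt0 center_lt.
  have [d d0 hd] := fin_min gap; exists d => // q qd j.
  have := cauchy (n j) (q - center P); rewrite enorm_normal mul1r dotpB; have := hd j; lra.
(* The plane normal to m through the line ab: keeping o off the plane keeps it off the line. *)
have H (ab : V * V) : exists m : V, ab.1 != ab.2 -> m != 0 /\ (ab.2 - ab.1) ∙ m = 0.
  have [->|ne] := eqVneq ab.1 ab.2; first by exists 0; rewrite eqxx.
  have [|t t0 [H _]] := @perp2 R (ab.2 - ab.1) 0; first by rewrite subr_eq0 eq_sym.
  by exists t.
have [m hm] := choice H.
have [ o [d1 [d10 h1 h2]]] := @dense_planes _ m (fun ab => m ab ∙ ab.1) [seq (a, b) | a <- L, b <- L] (center P) d d0.
have oo : enorm (o - o) < d1 by rewrite subrr enorm0.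
have ne a b : a \in L -> b \in L -> a != b -> cross (a - o) (b - o) != 0.
  move=> aL bL ab; have [/= m0 mo] := hm (a, b) ab.
  have := h2 o oo (a, b); rewrite allpairs_f// => /(_ isT m0) /=; apply: contraNneq => c0.
  have d0' : (b - a) ∙ (b - a) != 0 by rewrite dotp_eq0 subr_eq0 eq_sym.
  have e : ((b - a) ∙ (b - a)) *: (a - o) = ((a - o) ∙ (b - a)) *: (b - a) + cross (b - a) (cross (a - o) (b - o)).
    by apply: vecP; rewrite /cross !coE; ring.
  rewrite c0 (_ : cross (b - a) 0 = 0) ?addr0 in e; last by apply: vecP; rewrite /cross !coE; ring.
  have := congr1 (dotp (m (a, b))) e; rewrite !dotpZr (dotpC (m (a, b)) (b - a)) mo mulr0 => /eqP.
  by rewrite mulf_eq0 (negbTE d0') /= dotpB subr_eq0 eq_sym.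
have [r [d2 [d20 _ h3]]] := @dense_planes _ (fun ab : V * V => cross (ab.1 - o) (ab.2 - o)) (fun=> 0) [seq (a, b) | a <- L, b <- L] 0 1 ltr01.
exists o, r; split; first by apply: hd; exact: h1.
move=> a b aL bL ab; have := h3 r; rewrite subrr enorm0 => /(_ d20 (a, b)).
rewrite allpairs_f// => /(_ isT (ne a b aL bL ab)) /=; apply: contraNneq => <-.
by apply/eqP; rewrite /triple /cross !coE; ring.
Qed.

(** Radial projection from an interior point is injective on the boundary: testing a coincidence of
    cones against n_i and n_j forces l + m = c + d, so the two segments themselves meet. *)
Lemma clear_faces o i j p q a b : (forall k, n k ∙ o < h k) -> face i p -> face i q ->
  face j a -> face j b -> (forall u, on_seg p q u -> on_seg a b u -> False) ->
  clear (p - o) (q - o) (a - o) (b - o).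
Proof.
move=> Ko [Kp ip] [Kq iq] [Ka ja] [Kb jb] dis l m c d l0 m0 lm c0 d0 E.
have e (k : J) : l * (n k ∙ p - n k ∙ o) + m * (n k ∙ q - n k ∙ o) =
    c * (n k ∙ a - n k ∙ o) + d * (n k ∙ b - n k ∙ o).
  by have := congr1 (dotp (n k)) E; rewrite !dotE.
have ei := e i; have ej := e j; rewrite ip iq in ei; rewrite ja jb in ej.
have gi := Ko i; have gj := Ko j.
have := Kp j; have := Kq j; have := Ka i; have := Kb i => bi ai qj pj.
have N1 : l + m <= c + d.
  rewrite -(ler_pM2r (x := h i - n i ∙ o)) ?subr_gt0//; nra.
have N2 : c + d <= l + m.
  rewrite -(ler_pM2r (x := h j - n j ∙ o)) ?subr_gt0//; nra.
have N : c + d = l + m by apply/le_anti; rewrite N1 N2.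
apply: (dis ((l + m)^-1 *: (l *: p + m *: q))).
  exists (m / (l + m)); first by rewrite divr_ge0 ?(ltW lm)//= ler_pdivrMr// mul1r lerDr.
  by apply: vecP; rewrite !coV; field; rewrite gt_eqF.
exists (d / (l + m)); first by rewrite divr_ge0 ?(ltW lm)//= ler_pdivrMr// mul1r -N lerDr.
have -> : l *: p + m *: q = c *: a + d *: b.
  have -> : l *: p + m *: q = l *: (p - o) + m *: (q - o) + (l + m) *: o.
    by apply: vecP; rewrite !coV; ring.
  by rewrite E -N; apply: vecP; rewrite !coV; ring.
have cE : c = l + m - d by lra.
by rewrite cE; apply: vecP; rewrite !coV; field; rewrite gt_eqF.
Qed.

Section AtPoint.
Variables (x : V) (j : J) (d1 d2 d3 : V) (a b rho : R) (m1 m2 m3 : nat) (z1 z2 z3 : nat -> V).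
Hypotheses (Sx : S x) (xs : simple_at x j) (nd1 : n j ∙ d1 = 0) (nd2 : n j ∙ d2 = 0)
  (d12 : cross d1 d2 != 0) (d3E : d3 = a *: d1 + b *: d2) (b0 : b < 0) (rho0 : 0 < rho).

(** Within distance rho of x the chain consists of its first leg only, in direction d. *)
Definition arm m z d := [/\ [/\ (0 < m)%N, z 0%N = x & exists2 l : R, 0 < l & z 1%N = x + l *: d],
  forall k, (k < m)%N -> exists i, face i (z k) /\ face i (z k.+1),
  forall k, (k < m)%N -> z k != z k.+1,
  forall k, (0 < k <= m)%N -> rho <= enorm (z k - x) &
  forall k u, (0 < k < m)%N -> leg z k u -> rho <= enorm (u - x)].

Hypotheses (A1 : arm m1 z1 d1) (A2 : arm m2 z2 d2) (A3 : arm m3 z3 d3)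
  (e12 : z1 m1 = z2 m2) (e13 : z1 m1 = z3 m3).

Definition at_pt (e c1 c2 : R) := x + e *: (c1 *: d1 + c2 *: d2).

Lemma indep c1 c2 c1' c2' : c1 *: d1 + c2 *: d2 = c1' *: d1 + c2' *: d2 -> c1 = c1' /\ c2 = c2'.
Proof.
move=> E; have E' : (c1 - c1') *: d1 = (c2' - c2) *: d2.
  have -> : (c1 - c1') *: d1 = c1 *: d1 + c2 *: d2 - (c1' *: d1 + c2 *: d2).
    by apply: vecP; rewrite !coV; ring.
  by rewrite E; apply: vecP; rewrite !coV; ring.
have F1 : (c1 - c1') *: cross d1 d2 = 0.
  have -> : (c1 - c1') *: cross d1 d2 = cross ((c1 - c1') *: d1) d2.
    by apply: vecP; rewrite /cross !coE; ring.
  by rewrite E'; apply: vecP; rewrite /cross !coE; ring.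
have F2 : (c2' - c2) *: cross d1 d2 = 0.
  have -> : (c2' - c2) *: cross d1 d2 = cross d1 ((c2' - c2) *: d2).
    by apply: vecP; rewrite /cross !coE; ring.
  by rewrite -E'; apply: vecP; rewrite /cross !coE; ring.
move/eqP: F1; rewrite scaler_eq0 (negbTE d12) orbF subr_eq0 => /eqP ->.
by move/eqP: F2; rewrite scaler_eq0 (negbTE d12) orbF subr_eq0 => /eqP ->.
Qed.

Lemma tangent_cross : cross d1 d2 = (n j ∙ cross d1 d2) *: n j.
Proof.
have c1 : cross (n j) (cross d1 d2) = 0.
  have -> : cross (n j) (cross d1 d2) = (n j ∙ d2) *: d1 - (n j ∙ d1) *: d2.
    by apply: vecP; rewrite /cross !coE; ring.
  by rewrite nd1 nd2 !scale0r subrr.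
have := congr1 (fun u => cross u (n j)) c1.
have -> : cross (cross (n j) (cross d1 d2)) (n j) = (n j ∙ n j) *: cross d1 d2 - (n j ∙ cross d1 d2) *: n j.
  by move: (cross d1 d2) => w; apply: vecP; rewrite /cross !coE; ring.
rewrite normal1 scale1r (_ : cross 0 _ = 0) => [/eqP|].
  by rewrite subr_eq0 => /eqP.
by apply: vecP; rewrite /cross !coE; ring.
Qed.

Lemma seg_at e c1 c2 c1' c2' u : on_seg (at_pt e c1 c2) (at_pt e c1' c2') u ->
  exists2 t, 0 <= t <= 1 & u = at_pt e ((1 - t) * c1 + t * c1') ((1 - t) * c2 + t * c2').
Proof.
move=> [t t01 ->]; exists t => //; rewrite /at_pt.
by apply: vecP; rewrite !coV; ring.
Qed.

Let M := (`|a| + 1) * enorm d1 + (`|b| + 1) * enorm d2.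
(** A convex box containing the coordinates of the three test points and of q. *)
Let small (c1 c2 : R) := `|c1| <= `|a| + 1 /\ `|c2| <= `|b| + 1.

Lemma at_pt_near e c1 c2 : 0 <= e -> small c1 c2 -> enorm (at_pt e c1 c2 - x) <= e * M.
Proof.
move=> e0 [h1 h2]; rewrite /at_pt addrAC subrr add0r enormZ ger0_norm//.
apply: ler_wpM2l => //; apply: le_trans (enorm_triangle _ _) _; rewrite !enormZ.
by apply: lerD; apply: ler_wpM2r; rewrite ?enorm_ge0.
Qed.

Lemma small_conv t c1 c2 c1' c2' : 0 <= t <= 1 -> small c1 c2 -> small c1' c2' ->
  small ((1 - t) * c1 + t * c1') ((1 - t) * c2 + t * c2').
Proof.
move=> t01 [h1 h2] [h1' h2']; split; apply/ler_normlP; move/ler_normlP: h1 => [? ?];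
move/ler_normlP: h2 => [? ?]; move/ler_normlP: h1' => [? ?]; move/ler_normlP: h2' => [? ?];
split; nra.
Qed.

Section Eps.
Variable e : R.
Hypotheses (e0 : 0 < e) (eM : e * M < rho).

Lemma clear_far c1 c2 c1' c2' m z d k u : small c1 c2 -> small c1' c2' -> arm m z d ->
  (0 < k < m)%N -> on_seg (at_pt e c1 c2) (at_pt e c1' c2') u -> leg z k u -> False.
Proof.
move=> s s' [_ _ _ _ far] km /seg_at[t t01 uE] /(far k u km).
have := at_pt_near (ltW e0) (small_conv t01 s s'); rewrite -uE => h1 h2.
by have := le_lt_trans (le_trans h2 h1) eM; rewrite ltxx.
Qed.

Lemma clear_leg0 c1 c2 c1' c2' m z d al be u : arm m z d -> d = al *: d1 + be *: d2 ->
  on_seg (at_pt e c1 c2) (at_pt e c1' c2') u -> leg z 0 u ->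
  exists t s, [/\ 0 <= t <= 1, 0 <= s, (1 - t) * c1 + t * c1' = s * al & (1 - t) * c2 + t * c2' = s * be].
Proof.
move=> [[_ z0 [l l0 z1E]] _ _ _ _] dE /seg_at[t t01 uE] [r /andP[r0 _] uE'].
exists t, (r * l / e); rewrite uE' z0 z1E in uE.
have H : e *: (((1 - t) * c1 + t * c1') *: d1 + ((1 - t) * c2 + t * c2') *: d2) =
    e *: ((r * l / e * al) *: d1 + (r * l / e * be) *: d2).
  move: uE; rewrite /at_pt => /addrI <-; rewrite dE.
  by apply: vecP; rewrite !coV; field; rewrite gt_eqF.
have [-> ->] := indep (scalerI (lt0r_neq0 e0) H).
have s0 : 0 <= r * l / e by exact: divr_ge0 (mulr_ge0 r0 (ltW l0)) (ltW e0).
by split.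
Qed.

Lemma at_pt_neq c1 c2 c1' c2' : (c1 != c1') || (c2 != c2') -> at_pt e c1 c2 != at_pt e c1' c2'.
Proof.
apply: contraTneq; rewrite /at_pt => /addrI /(scalerI (lt0r_neq0 e0)) /indep[-> ->].
by rewrite !eqxx.
Qed.

Lemma at_pt_vertex c1 c2 m z d k : arm m z d -> small c1 c2 -> (c1 != 0) || (c2 != 0) ->
  (k <= m)%N -> z k != at_pt e c1 c2.
Proof.
move=> [[_ z0 _] _ _ far _] s nz km; case: k km => [|k] km.
  rewrite z0 (_ : x = at_pt e 0 0) ?at_pt_neq// 1?eq_sym 1?(eq_sym 0 c2)//.
  by rewrite /at_pt !scale0r addr0 scaler0 addr0.
apply: contraTneq (far k.+1 km) => ->; rewrite -ltNge.
exact: le_lt_trans (at_pt_near (ltW e0) s) eM.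
Qed.


Lemma small1 : small 1 0.
Proof. by split; rewrite ?normr1 ?normr0 ?lerDr ?addr_ge0. Qed.
Lemma small2 : small 0 1.
Proof. by split; rewrite ?normr1 ?normr0 ?lerDr ?addr_ge0. Qed.
Lemma small3 : small a b.
Proof. by split; rewrite lerDl. Qed.
Lemma smallq : small (`|a| + 1) (- b).
Proof. by split; rewrite ?normrN ?lerDl// ger0_norm// addr_ge0. Qed.

Hypothesis at_face : forall c1 c2, small c1 c2 -> face j (at_pt e c1 c2).
Variables (o r : V) (L : seq V).
Hypotheses (Ko : forall i, n i ∙ o < h i)
  (gen_L : forall u v, u \in L -> v \in L -> u != v -> triple r (u - o) (v - o) != 0).
Hypotheses (L1 : forall k, (k <= m1)%N -> z1 k \in L) (L2 : forall k, (k <= m2)%N -> z2 k \in L)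
  (L3 : forall k, (k <= m3)%N -> z3 k \in L) (Lp1 : at_pt e 1 0 \in L) (Lp2 : at_pt e 0 1 \in L)
  (Lp3 : at_pt e a b \in L) (Lq : at_pt e (`|a| + 1) (- b) \in L).

Lemma arm_clear_far c1 c2 c1' c2' m z d k : small c1 c2 -> small c1' c2' -> arm m z d ->
  (0 < k < m)%N -> clear (at_pt e c1 c2 - o) (at_pt e c1' c2' - o) (z k - o) (z k.+1 - o).
Proof.
move=> s s' A km; have [_ fz _ _ _] := A; have /andP[_ km'] := km; have [i [fa fb]] := fz k km'.
apply: (clear_faces Ko (at_face s) (at_face s') fa fb) => u.
exact: clear_far s s' A km.
Qed.

Lemma arm_clear c1 c2 c1' c2' m z d al be k : small c1 c2 -> small c1' c2' -> arm m z d ->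
  d = al *: d1 + be *: d2 ->
  (forall t s, 0 <= t <= 1 -> 0 <= s -> (1 - t) * c1 + t * c1' = s * al ->
     (1 - t) * c2 + t * c2' = s * be -> False) ->
  (k < m)%N -> clear (at_pt e c1 c2 - o) (at_pt e c1' c2' - o) (z k - o) (z k.+1 - o).
Proof.
move=> s s' A dE H; case: k => [|k] km; last exact: (arm_clear_far s s' A).
have [_ fz _ _ _] := A; have [i [fa fb]] := fz 0%N km.
apply: (clear_faces Ko (at_face s) (at_face s') fa fb) => u hu hl.
have [t [s0 [? ? ? ?]]] := clear_leg0 A dE hu hl; exact: (H t s0).
Qed.

Lemma arm_gen m z d : arm m z d -> (forall k, (k <= m)%N -> z k \in L) ->
  gen_chain r m (fun k => z k - o).
Proof.
move=> [_ _ nz _ _] Lz k km; apply: gen_L; [exact/Lz/ltnW|exact: Lz|exact: nz].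
Qed.

Lemma arm_gen_point m z d c1 c2 : arm m z d -> (forall k, (k <= m)%N -> z k \in L) ->
  small c1 c2 -> (c1 != 0) || (c2 != 0) -> at_pt e c1 c2 \in L ->
  gen_point r m (fun k => z k - o) (at_pt e c1 c2 - o).
Proof.
move=> A Lz s nz Lp k km; apply: gen_L => //; first exact: Lz.
exact: (at_pt_vertex A).
Qed.

(** Since o is interior, n_j ∙ (x - o) > 0, so the sign is the orientation of (d1, d2) at x. *)
Lemma crossing_sign l : z1 1%N = x + l *: d1 -> 0 < l ->
  Num.sg (triple (at_pt e (`|a| + 1) (- b) - o) (z1 0%N - o) (z1 1%N - o)) = Num.sg (n j ∙ cross d1 d2).
Proof.
move=> z1E l0; have [[_ -> _] _ _ _ _] := A1; rewrite z1E.
have -> : triple (at_pt e (`|a| + 1) (- b) - o) (x - o) (x + l *: d1 - o) =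
    (- b * e * l) * ((x - o) ∙ cross d1 d2).
  by rewrite /at_pt /triple /cross !coE; ring.
have -> : (x - o) ∙ cross d1 d2 = (n j ∙ (x - o)) * (n j ∙ cross d1 d2).
  rewrite {1}tangent_cross.
  by rewrite dotpZr mulrC dotpC.
rewrite !sgrM (gtr0_sg e0) (gtr0_sg l0) sgrN (ltr0_sg b0) opprK !mul1r gtr0_sg ?mul1r//.
by rewrite dotpB subr_gt0; case: xs => ->.
Qed.

(** Test points p1, p2, p3 lie on the three arms. The point q, with coordinates (|a| + 1, - b), is
    such that the midpoint of p3 and q is on the first arm: going from p3 to q crosses that arm
    once, and the other moves needed in [fan] cross nothing. *)
Lemma local_fan (W := fun m z p => wind r m (fun k => z k - o) (p - o)) :
  (W m1 z1 (at_pt e a b) - W m2 z2 (at_pt e a b)) +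
  (W m2 z2 (at_pt e 1 0) - W m3 z3 (at_pt e 1 0)) +
  (W m3 z3 (at_pt e 0 1) - W m1 z1 (at_pt e 0 1)) = - Num.sg (n j ∙ cross d1 d2).
Proof.
have [[m10 z10 [l l0 z1E]] _ _ far1 _] := A1.
rewrite /W -(crossing_sign z1E l0).
have E1 : d1 = 1 *: d1 + 0 *: d2 by rewrite scale1r scale0r addr0.
have E2 : d2 = 0 *: d1 + 1 *: d2 by rewrite scale1r scale0r add0r.
have nb : b != 0 by rewrite lt_eqF.
have a1 : 0 < `|a| + 1 by rewrite ltr_wpDl.
have a1' : `|a| + 1 != 0 by rewrite gt_eqF.
have b0' : 0 < - b by rewrite oppr_gt0.
have t10 : 1 != 0 :> R by rewrite oner_eq0.
have s1 := small1; have s2 := small2; have s3 := small3; have sq := smallq.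
have dn : enorm d1 != 0.
  rewrite enorm_eq0; apply: contraNneq d12 => ->; apply/eqP.
  by apply: vecP; rewrite /cross !coE; ring.
have dn0 : 0 < enorm d1 by rewrite lt_def dn enorm_ge0.
have el : e * (`|a| + 1) < l.
  have := far1 1%N; rewrite m10 z1E addrAC subrr add0r enormZ (gtr0_norm l0) => /(_ isT) h1.
  have h2 : e * M < l * enorm d1 by exact: lt_le_trans eM h1.
  have h3 : e * ((`|a| + 1) * enorm d1) <= e * M.
    by rewrite ler_pM2l// /M lerDl mulr_ge0 ?enorm_ge0// addr_ge0.
  by rewrite -(ltr_pM2r dn0) -mulrA; exact: le_lt_trans h2.
have na := ler_norm a; have na' := ler_norm (- a); rewrite normrN in na'.
have := m10; case: m1 A1 L1 e12 e13 {far1 m10} => // m A1' L1' e12' e13' _.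
have z00 z d m' : arm m' z d -> z 0%N = x by case=> -[].
(* Seen from o, p3 + q is 2 (x - o) + e (a + |a| + 1) d1, and d1 is (z1 1 - x) / l; this gives the
   two coefficients, of sum 2. The bound [el] makes the first one positive. *)
apply: (@fan R r m m2 m3 (fun k => z1 k - o) (fun k => z2 k - o) (fun k => z3 k - o) _ _ _ _
  (2 - e * (a + (`|a| + 1)) / l) (e * (a + (`|a| + 1)) / l)).
- by rewrite (z00 _ _ _ A1') (z00 _ _ _ A2).
- by rewrite (z00 _ _ _ A1') (z00 _ _ _ A3).
- by rewrite e12'.
- by rewrite e13'.
- exact: arm_gen A1' L1'.
- exact: arm_gen A2 L2.
- exact: arm_gen A3 L3.
- by split; [|split]; apply: (arm_gen_point A1' L1') => //; rewrite ?a1' ?nb ?t10 ?orbT.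
- by split; [|split]; apply: (arm_gen_point A2 L2) => //; rewrite ?a1' ?nb ?t10 ?orbT.
- by split; [|split]; apply: (arm_gen_point A3 L3) => //; rewrite ?a1' ?nb ?t10 ?orbT.
- apply: gen_L => //; apply: at_pt_neq; apply/orP; right; rewrite -subr_eq0 opprK -mulr2n mulrn_eq0.
  by rewrite (negbTE nb).
- by apply: gen_L => //; apply: at_pt_neq; apply/orP; right; rewrite eq_sym oppr_eq0.
- by apply: gen_L => //; apply: at_pt_neq; apply/orP; left; rewrite eq_sym.
- by move=> k k0 km; apply: (arm_clear_far s3 sq A1'); rewrite k0.
- move=> k km; apply: (arm_clear s2 sq A1' E1) => // t s t01 _ _.
  by rewrite mulr0 => h; have := conv_gt0 ltr01 b0' t01; rewrite h ltxx.
- move=> k km; apply: (arm_clear s3 sq A2 E2) => // t s; exact: (plane_clear3 b0).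
- move=> k km; apply: (arm_clear s1 sq A2 E2) => // t s t01 _.
  by rewrite mulr0 => h; have := conv_gt0 ltr01 a1 t01; rewrite h ltxx.
- move=> k km; apply: (arm_clear s1 sq A3 d3E) => // t s; exact: (plane_clear1 b0).
- move=> k km; apply: (arm_clear s2 sq A3 d3E) => // t s; exact: (plane_clear2 b0).
- by rewrite subr_gt0 ltr_pdivrMr//; nra.
- by rewrite divr_gt0// mulr_gt0//; lra.
- rewrite z10 z1E; set k := e * _.
  have -> : (k / l) *: (x + l *: d1 - o) = (k / l) *: (x - o) + k *: d1.
    by rewrite addrAC scalerDr scalerA divfK ?gt_eqF.
  by rewrite /k /at_pt; move: (_ / l) => k'; apply: vecP; rewrite !coV; ring.
have : Num.sg (triple (at_pt e (`|a| + 1) (- b) - o) (z1 0%N - o) (z1 1%N - o)) != 0.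
  rewrite (crossing_sign z1E l0) sgr_eq0; apply: contraNneq d12 => c0.
  by rewrite tangent_cross c0 scale0r.
by rewrite sgr_eq0.
Qed.

End Eps.
End AtPoint.
End LocalFan.

(** * Winding numbers along disjoint shortest paths *)

Section ThreePaths.
Variables (R : realType) (P : polytope R).
Local Notation V := 'rV[R]_3.
Local Notation J := (facet P).
Local Notation n := (@normal R P).
Local Notation h := (@height R P).
Local Notation K := (body P).
Local Notation S := (surface P).
Local Notation face := (@face R P).
Local Notation dist := (@dist R P).
Local Notation taut := (@taut R P).
Local Notation shortest := (@shortest R P).
Local Notation arm := (@arm R P).
Implicit Types (o p q r u v w x y : V) (z : nat -> V) (i j : J) (s : nat -> J).

Lemma taut_rev x y m s z : S x -> S y -> taut x y m s z ->
  taut y x m (fun k => s (m - k.+1)%N) (fun k => z (m - k)%N).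
Proof.
move=> Sx Sy [[m0 ch] nz z0 zm cl]; split; rewrite ?subn0 ?subnn//.
- split=> // k km; have e : (m - k = (m - k.+1).+1)%N by rewrite subnSK.
  have km' : (m - k.+1 < m)%N by rewrite ltn_subrL.
  by rewrite e; have [fa fb] := ch _ km'.
- move=> k km; have e : (m - k = (m - k.+1).+1)%N by rewrite subnSK.
  by rewrite e eq_sym nz// ltn_subrL.
- rewrite dist_sym// -cl /clen [RHS]big_nat_rev /=; apply: eq_big_nat => k /andP[_ km].
  by rewrite add0n enormB subnSK.
Qed.

(** After the first leg the intrinsic distance to x is at least its length, and near x intrinsic and
    Euclidean distances agree. *)
Lemma taut_arm x y m s z : S x -> S y -> taut x y m s z -> exists2 rho : R, 0 < rho &
  forall rho', rho' <= rho -> arm x rho' m z (dir z 0).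
Proof.
move=> Sx Sy g; have [[m0 ch] nz z0 zm cl] := g.
have l0 : 0 < enorm (z 1%N - z 0%N) by rewrite enorm_gt0 subr_eq0 eq_sym nz.
have [r r0 hr] := dist_local Sx.
exists (Num.min r (enorm (z 1%N - z 0%N))); first by rewrite lt_min r0.
move=> rho; rewrite le_min => /andP[rr rl].
have far k u : (0 < k < m)%N -> leg z k u -> rho <= enorm (u - x).
  move=> /andP[k0 km] lu; rewrite leNgt; apply/negP => lt.
  have [d _] := leg_dist Sx Sy g km lu.
  have Su := leg_surface g km lu.
  have := hr u Su (lt_le_trans lt rr); rewrite d (enormB x u).
  have : enorm (z 1%N - z 0%N) <= clen k z.
    case: k k0 {km lu d} => // k _; rewrite /clen big_nat_recl//= lerDl.
    by apply: sumr_ge0 => *; exact: enorm_ge0.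
  have := enorm_ge0 (u - z k); lra.
split=> //.
- split=> //; exists (enorm (z 1%N - z 0%N)) => //.
  by rewrite dir_scale ?nz// z0 addrC subrK.
- by move=> k km; have := ch k km; exists (s k).
move=> [|[|k]] // km; first by rewrite -z0.
by apply: (far k.+1) => //; exact: leg1.
Qed.

(** The end of a segment is an extreme point. *)
Lemma on_seg_end a b u v w : a != b -> on_seg a b u -> on_seg a b v -> on_seg u v w ->
  w = a -> u = a \/ v = a.
Proof.
move=> ab [c /andP[c0 _] uE] [d /andP[d0 _] vE] [t /andP[t0 t1] wE] wa.
have e : ((1 - t) * c + t * d) *: (b - a) = 0.
  have -> : ((1 - t) * c + t * d) *: (b - a) = w - a.
    by rewrite wE uE vE; apply: vecP; rewrite !coV; ring.
  by rewrite wa subrr.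
move/eqP: e; rewrite scaler_eq0 subr_eq0 (eq_sym b) (negbTE ab) orbF => /eqP e.
have [t1'|t1'] := eqVneq t 1.
  by right; rewrite vE (_ : d = 0) ?scale0r ?addr0//; move: e; rewrite t1'; lra.
left; rewrite uE (_ : c = 0) ?scale0r ?addr0//.
have t1l : 0 < 1 - t by rewrite subr_gt0 lt_def eq_sym t1' t1.
have h1 := mulr_ge0 t0 d0; have h2 := mulr_ge0 (ltW t1l) c0.
have : (1 - t) * c = 0 by lra.
by move/eqP; rewrite mulf_eq0 (gt_eqF t1l) /= => /eqP.
Qed.

Lemma on_seg_sym a b u : on_seg a b u -> on_seg b a u.
Proof.
move=> [t t01 ->]; exists (1 - t); first by lra.
by apply: vecP; rewrite !coV; ring.
Qed.

Lemma on_seg_conv a b u v w : on_seg a b u -> on_seg a b v -> on_seg u v w -> on_seg a b w.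
Proof.
move=> [c c01 uE] [d d01 vE] [t t01 wE]; exists ((1 - t) * c + t * d); first by nra.
by rewrite wE uE vE; apply: vecP; rewrite !coV; ring.
Qed.

Section Pair.
Variables x y : V.
Hypotheses (Sx : S x) (Sy : S y).

Lemma leg_avoid m s z k u v w : taut x y m s z -> (k < m)%N -> leg z k u -> leg z k v -> on_seg u v w ->
  u != x -> u != y -> v != x -> v != y -> w != x /\ w != y.
Proof.
move=> g km lu lv uvw ux uy vx vy; have [_ nz _ _ _] := g.
have lw : leg z k w := on_seg_conv lu lv uvw; have [dx dy] := leg_dist Sx Sy g km lw.
have c0 : 0 <= clen k z by apply: sumr_ge0 => *; exact: enorm_ge0.
have c1 : 0 <= \sum_(k.+1 <= l < m) enorm (z l.+1 - z l) by apply: sumr_ge0 => *; exact: enorm_ge0.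
split; apply/eqP => e.
- rewrite e dist_xx// -e in dx; have h := enorm_ge0 (w - z k).
  have : enorm (w - z k) = 0 by lra.
  move/eqP; rewrite enorm_eq0 subr_eq0 => /eqP wz.
  have [h'|h'] := on_seg_end (nz k km) lu lv uvw wz.
    by move: ux; rewrite h' -wz e eqxx.
  by move: vx; rewrite h' -wz e eqxx.
- rewrite e dist_xx// -e in dy; have h := enorm_ge0 (z k.+1 - w).
  have : enorm (z k.+1 - w) = 0 by lra.
  move/eqP; rewrite enorm_eq0 subr_eq0 eq_sym => /eqP wz.
  have zk : z k.+1 != z k by rewrite eq_sym nz.
  have [h'|h'] := on_seg_end zk (on_seg_sym lu) (on_seg_sym lv) uvw wz.
    by move: uy; rewrite h' -wz e eqxx.
  by move: vy; rewrite h' -wz e eqxx.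
Qed.

Section Frame.
Variables (o r : V) (L : seq V).
Hypotheses (Ko : forall i, n i ∙ o < h i)
  (gen_L : forall u v, u \in L -> v \in L -> u != v -> triple r (u - o) (v - o) != 0).

Definition windo m z p := wind r m (fun k => z k - o) (p - o).

Variables (m m' : nat) (s s' : nat -> J) (z z' : nat -> V).
Hypotheses (g : taut x y m s z) (g' : taut x y m' s' z') (Lz' : forall k, (k <= m')%N -> z' k \in L)
  (dis : forall k l u, (k < m)%N -> (l < m')%N -> leg z k u -> leg z' l u -> u = x \/ u = y).

Lemma wind_leg k u v : (k < m)%N -> leg z k u -> leg z k v -> u != x -> u != y -> v != x -> v != y ->
  u \in L -> v \in L -> u != v ->
  windo m' z' v - windo m' z' u = xing r (x - o) (u - o) (v - o) - xing r (y - o) (u - o) (v - o).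
Proof.
move=> km lu lv ux uy vx vy uL vL uv; have [[m0 ch] nz _ _ _] := g.
have [[m'0 ch'] nz' z'0 z'm _] := g'.
have off p l : leg z k p -> p != x -> p != y -> (l <= m')%N -> z' l != p.
  move=> lp px py; rewrite leq_eqVlt => /orP[/eqP ->|lm]; first by rewrite z'm eq_sym.
  apply/eqP => e; have lp' : leg z' l p by rewrite -e; exact: leg0.
  by case: (dis km lm lp lp') => e'; move: px py; rewrite e' eqxx.
rewrite /windo (wind_move (p := u - o)) ?z'0 ?z'm//.
- by move=> l lm; apply: gen_L; [exact/Lz'/ltnW|exact: Lz'|exact: nz'].
- by move=> l lm; apply: gen_L => //; [exact: Lz'|exact: off].
- by move=> l lm; apply: gen_L => //; [exact: Lz'|exact: off].
- exact: gen_L.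
move=> l lm; have [fa fb] := ch k km; have [fa' fb'] := ch' l lm.
apply: (clear_faces Ko (leg_face fa fb lu) (leg_face fa fb lv) fa' fb') => w uvw lw'.
have [wx wy] := leg_avoid g km lu lv uvw ux uy vx vy.
have lw : leg z k w := on_seg_conv lu lv uvw.
by case: (dis km lm lw lw') => e'; move: wx wy; rewrite e' eqxx.
Qed.
End Frame.

(** Moving along a leg of z changes either winding number by boundary terms at x and y only. They
    are the same for both arcs and cancel. *)
Lemma wind_diff o r (L : seq V) m s z m1 s1 z1 m2 s2 z2 p p' :
  (forall i, n i ∙ o < h i) ->
  (forall u v, u \in L -> v \in L -> u != v -> triple r (u - o) (v - o) != 0) ->
  taut x y m s z -> taut x y m1 s1 z1 -> taut x y m2 s2 z2 ->
  (forall k, (k <= m)%N -> z k \in L) ->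
  (forall k, (k <= m1)%N -> z1 k \in L) -> (forall k, (k <= m2)%N -> z2 k \in L) ->
  (forall k l u, (k < m)%N -> (l < m1)%N -> leg z k u -> leg z1 l u -> u = x \/ u = y) ->
  (forall k l u, (k < m)%N -> (l < m2)%N -> leg z k u -> leg z2 l u -> u = x \/ u = y) ->
  p \in L -> p' \in L -> leg z 0 p -> leg z m.-1 p' -> p != x -> p != y -> p' != x -> p' != y ->
  windo o r m1 z1 p - windo o r m2 z2 p = windo o r m1 z1 p' - windo o r m2 z2 p'.
Proof.
move=> Ko gL g g1 g2 Lz Lz1 Lz2 dis1 dis2 Lp Lp' lp lp' px py p'x p'y.
pose D q := windo o r m1 z1 q - windo o r m2 z2 q; rewrite -/(D p) -/(D p').
have step k u v : (k < m)%N -> leg z k u -> leg z k v -> u != x -> u != y -> v != x -> v != y ->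
    u \in L -> v \in L -> D u = D v.
  move=> km lu lv ux uy vx vy uL vL; have [->//|uv] := eqVneq u v.
  have := wind_leg Ko gL g g1 Lz1 dis1 km lu lv ux uy vx vy uL vL uv.
  have := wind_leg Ko gL g g2 Lz2 dis2 km lu lv ux uy vx vy uL vL uv.
  rewrite /D; lra.
have [[m0 _] _ _ _ _] := g.
have zx k : (0 < k)%N -> (k < m)%N -> z k != x.
  by case: k => // k _ km; exact: (vertex_first Sx Sy g (ltnW km)).
have H k : (k < m)%N -> forall v, leg z k v -> v != x -> v != y -> v \in L -> D p = D v.
  elim: k => [|k ih] km v lv vx vy vL; first exact: (step 0%N).
  have zy := vertex_last Sx Sy g km; have zx' := zx k.+1 isT km.
  have zL : z k.+1 \in L by apply: Lz; exact: ltnW.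
  rewrite (ih (ltnW km) (z k.+1) (leg1 _ _) zx' zy zL).
  exact: (step k.+1 _ _ km (leg0 _ _) lv).
by apply: (H m.-1) => //; rewrite ltn_predL.
Qed.

End Pair.
End ThreePaths.

(** The unprimed differences are taken near x, the primed ones near y, negated because the arcs are
    traversed backwards there; s is the common local sign. *)
Lemma opposite_sums (R : realType) (a b c a' b' c' s : R) : a + b + c = - s ->
  - a' - b' - c' = - s -> a = a' -> b = b' -> c = c' -> s = 0.
Proof. by move=> *; lra. Qed.

(** * Impossibility of the theta graph *)

Section NoThree.
Variables (R : realType) (P : polytope R).
Local Notation V := 'rV[R]_3.
Local Notation J := (facet P).
Local Notation n := (@normal R P).
Local Notation h := (@height R P).
Local Notation K := (body P).
Local Notation S := (surface P).
Local Notation face := (@face R P).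
Local Notation dist := (@dist R P).
Local Notation taut := (@taut R P).
Local Notation shortest := (@shortest R P).
Local Notation arm := (@arm R P).
Local Notation tangent := (@tangent R P).
Local Notation seg := (@seg R P).
Implicit Types (o p q r u v w x y : V) (z : nat -> V) (i j : J) (s : nat -> J) (t : ctype P).

Lemma fan_scale x j (d1 d2 : V) (a b rho : R) : S x -> simple_at x j -> n j ∙ d1 = 0 -> n j ∙ d2 = 0 ->
  0 < rho -> exists e, [/\ 0 < e, e * ((`|a| + 1) * enorm d1 + (`|b| + 1) * enorm d2) < rho &
    forall c1 c2, `|c1| <= `|a| + 1 /\ `|c2| <= `|b| + 1 -> face j (at_pt x d1 d2 e c1 c2)].
Proof.
move=> Sx [jx xj] nd1 nd2 rho0; have [r r0 hr] := tangent_surface Sx.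
have m0 : 0 < Num.min rho r by rewrite lt_min rho0.
have [e [e0 _]] := small_pos ((`|a| + 1) * enorm d1 + (`|b| + 1) * enorm d2) m0 ltr01.
rewrite lt_min => /andP[er er']; exists e; split=> // c1 c2 sm.
have tn : n j ∙ (e *: (c1 *: d1 + c2 *: d2)) = 0 by rewrite !dotE nd1 nd2 !mulr0 addr0 mulr0.
split; last by rewrite /at_pt dotpDr tn addr0.
apply: surface_body; apply: hr => [|i /xj ->//].
have := @at_pt_near _ x d1 d2 a b e c1 c2 (ltW e0) sm; rewrite /at_pt addrAC subrr add0r => le.
exact: le_lt_trans er'.
Qed.

Lemma arm_leg x rho m z d (e : R) : arm x rho m z d -> d ∙ d = 1 -> 0 < e -> e < rho ->
  [/\ leg z 0 (x + e *: d), x + e *: d != x & x + e *: d != z m].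
Proof.
move=> [[m0 z0 [l l0 z1E]] _ _ far _] d1 e0 er.
have dn : enorm d = 1 by rewrite /enorm d1 sqrtr1.
have d0 : d != 0 by rewrite -dotp_eq0 d1 oner_eq0.
have le : rho <= l.
  by have := far 1%N m0; rewrite z1E addrAC subrr add0r enormZ dn mulr1 gtr0_norm.
split.
- exists (e / l); first by rewrite (divr_ge0 (ltW e0) (ltW l0))/= ler_pdivrMr// mul1r (le_trans (ltW er)).
  rewrite z0 z1E (_ : x + l *: d - x = l *: d); last by rewrite addrAC subrr add0r.
  by rewrite scalerA divfK ?gt_eqF.
- by rewrite -subr_eq0 addrAC subrr add0r scaler_eq0 negb_or d0 gt_eqF.
apply: contraTneq (far m _) => [<-|]; last by rewrite m0 leqnn.
by rewrite addrAC subrr add0r enormZ dn mulr1 gtr0_norm// -ltNge.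
Qed.

Lemma dir_rev m z : (0 < m)%N -> dir (fun k => z (m - k)%N) 0 = - dir z m.-1.
Proof.
by case: m => // m _; rewrite /dir subn0 subn1 /= -scalerN opprB enormB.
Qed.

Lemma leg_rev m z p : (0 < m)%N -> leg (fun k => z (m - k)%N) 0 p -> leg z m.-1 p.
Proof. by case: m => // m _; rewrite /leg subn0 subn1 /= => /on_seg_sym. Qed.

Section Data.
Variables (x y : V) (i0 j0 : J) (m1 m2 m3 : nat) (s1 s2 s3 : nat -> J) (z1 z2 z3 : nat -> V) (a b : R).
Hypotheses (Sx : S x) (Sy : S y) (xy : x != y) (xs : simple_at x i0) (ys : simple_at y j0).
Hypotheses (g1 : shortest x y m1 s1 z1) (g2 : shortest x y m2 s2 z2) (g3 : shortest x y m3 s3 z3).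
Let w1 := dir z1 0. Let w2 := dir z2 0. Let w3 := dir z3 0.
Let u1 := dir z1 m1.-1. Let u2 := dir z2 m2.-1. Let u3 := dir z3 m3.-1.
Hypotheses (c0 : n i0 ∙ cross w1 w2 != 0) (cE : n i0 ∙ cross w1 w2 = n j0 ∙ cross u1 u2)
  (w3E : w3 = a *: w1 + b *: w2) (u3E : u3 = a *: u1 + b *: u2) (b0 : b < 0)
  (u12 : u1 <> u2) (u13 : u1 <> u3) (u23 : u2 <> u3).

Lemma shortest_first m s z : shortest x y m s z ->
  [/\ (0 < m)%N, dir z 0 ∙ dir z 0 = 1 & n i0 ∙ dir z 0 = 0].
Proof.
move=> [_ [[m0 ch] nz z0 zm _]]; split=> //; first by rewrite dir1// nz.
have [[_ fa] [_ fb]] := ch 0%N m0; have [_ H] := xs.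
rewrite z0 in fa; have e := H _ fa; rewrite e in fa fb.
by rewrite /dir dotpZr dotpB fb z0 fa subrr mulr0.
Qed.

Lemma shortest_last m s z : shortest x y m s z ->
  dir z m.-1 ∙ dir z m.-1 = 1 /\ n j0 ∙ dir z m.-1 = 0.
Proof.
move=> [_ [[m0 ch] nz z0 zm _]]; have km : (m.-1 < m)%N by rewrite ltn_predL.
split; first by rewrite dir1// nz.
have [[_ fa] [_ fb]] := ch _ km; have [_ H] := ys.
rewrite prednK// zm in fb; have e := H _ fb; rewrite e in fa fb.
by rewrite /dir dotpZr dotpB prednK// zm fb fa subrr mulr0.
Qed.

Lemma no_three_paths : False.
Proof.
have [m10 w1n nw1] : [/\ (0 < m1)%N, w1 ∙ w1 = 1 & n i0 ∙ w1 = 0] := shortest_first g1; have [m20 w2n nw2] : [/\ (0 < m2)%N, w2 ∙ w2 = 1 & n i0 ∙ w2 = 0] := shortest_first g2.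
have [m30 w3n nw3] : [/\ (0 < m3)%N, w3 ∙ w3 = 1 & n i0 ∙ w3 = 0] := shortest_first g3.
have [u1n nu1] : u1 ∙ u1 = 1 /\ n j0 ∙ u1 = 0 := shortest_last g1; have [u2n nu2] : u2 ∙ u2 = 1 /\ n j0 ∙ u2 = 0 := shortest_last g2.
have [u3n nu3] : u3 ∙ u3 = 1 /\ n j0 ∙ u3 = 0 := shortest_last g3.
have t1 := proj2 g1; have t2 := proj2 g2; have t3 := proj2 g3.
have T1 := taut_rev Sx Sy t1; have T2 := taut_rev Sx Sy t2; have T3 := taut_rev Sx Sy t3.
have [rx rx0 [A1 A2 A3]] : exists2 rho : R, 0 < rho &
    [/\ arm x rho m1 z1 w1, arm x rho m2 z2 w2 & arm x rho m3 z3 w3].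
  have [r1 r10 h1] := taut_arm Sx Sy t1; have [r2 r20 h2] := taut_arm Sx Sy t2.
  have [r3 r30 h3] := taut_arm Sx Sy t3; exists (Num.min r1 (Num.min r2 r3)).
    by rewrite !lt_min r10 r20.
  by split; [apply: h1|apply: h2|apply: h3]; rewrite !ge_min lexx ?orbT.
(* The reversed arcs leave y opposite to the arrival directions; two changes of sign leave the cross
   product, hence the local sign, unchanged. *)
have [v1 v1E] : exists v, v = - u1 by exists (- u1).
have [v2 v2E] : exists v, v = - u2 by exists (- u2).
have [v3 v3E] : exists v, v = - u3 by exists (- u3).
have nv1 : n j0 ∙ v1 = 0 by rewrite v1E dotpNr nu1 oppr0.
have nv2 : n j0 ∙ v2 = 0 by rewrite v2E dotpNr nu2 oppr0.
have v1n : v1 ∙ v1 = 1 by rewrite v1E dotpNl dotpNr opprK.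
have v2n : v2 ∙ v2 = 1 by rewrite v2E dotpNl dotpNr opprK.
have v3n : v3 ∙ v3 = 1 by rewrite v3E dotpNl dotpNr opprK.
have [ry ry0 [B1 B2 B3]] : exists2 rho : R, 0 < rho &
    [/\ arm y rho m1 (fun k => z1 (m1 - k)%N) v1, arm y rho m2 (fun k => z2 (m2 - k)%N) v2 &
        arm y rho m3 (fun k => z3 (m3 - k)%N) v3].
  rewrite v1E v2E v3E /u1 /u2 /u3 -!dir_rev//.
  have [r1 r10 h1] := taut_arm Sy Sx T1; have [r2 r20 h2] := taut_arm Sy Sx T2.
  have [r3 r30 h3] := taut_arm Sy Sx T3; exists (Num.min r1 (Num.min r2 r3)).
    by rewrite !lt_min r10 r20.
  by split; [apply: h1|apply: h2|apply: h3]; rewrite !ge_min lexx ?orbT.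
have [e [e0 eM eF]] := fan_scale a b Sx xs nw1 nw2 rx0.
have [e' [e'0 e'M e'F]] := fan_scale a b Sy ys nv1 nv2 ry0.
have N1 v : v ∙ v = 1 -> enorm v = 1 by rewrite /enorm => ->; rewrite sqrtr1.
have M1 (r : R) v v' : 0 < r -> v ∙ v = 1 -> v' ∙ v' = 1 ->
    r <= r * ((`|a| + 1) * enorm v + (`|b| + 1) * enorm v').
  move=> r0 /N1 -> /N1 ->; rewrite !mulr1 ler_peMr// ?ltW//.
  by have := normr_ge0 a; have := normr_ge0 b; lra.
have er : e < rx := le_lt_trans (M1 _ _ _ e0 w1n w2n) eM.
have er' : e' < ry := le_lt_trans (M1 _ _ _ e'0 v1n v2n) e'M.
have P1 : at_pt x w1 w2 e 1 0 = x + e *: w1 by rewrite /at_pt scale1r scale0r addr0.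
have P2 : at_pt x w1 w2 e 0 1 = x + e *: w2 by rewrite /at_pt scale1r scale0r add0r.
have P3 : at_pt x w1 w2 e a b = x + e *: w3 by rewrite /at_pt -w3E.
have Q1 : at_pt y v1 v2 e' 1 0 = y + e' *: v1 by rewrite /at_pt scale1r scale0r addr0.
have Q2 : at_pt y v1 v2 e' 0 1 = y + e' *: v2 by rewrite /at_pt scale1r scale0r add0r.
have u3E' : v3 = a *: v1 + b *: v2 by rewrite v3E v2E v1E u3E !scalerN opprD.
have Q3 : at_pt y v1 v2 e' a b = y + e' *: v3 by rewrite /at_pt -u3E'.
pose vs m z := [seq z k | k <- iota 0 m.+1] : seq V.
(* All points used at both ends, so that one frame (o, r) is generic for the two local
   computations. *)
pose L := vs m1 z1 ++ vs m2 z2 ++ vs m3 z3 ++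
  [:: x + e *: w1; x + e *: w2; x + e *: w3; at_pt x w1 w2 e (`|a| + 1) (- b);
      y + e' *: v1; y + e' *: v2; y + e' *: v3; at_pt y v1 v2 e' (`|a| + 1) (- b)].
have vsP m z k : (k <= m)%N -> z k \in vs m z.
  by move=> km; apply: map_f; rewrite mem_iota.
have L1 k : (k <= m1)%N -> z1 k \in L by move=> /(@vsP _ z1) H; rewrite mem_cat H.
have L2 k : (k <= m2)%N -> z2 k \in L by move=> /(@vsP _ z2) H; rewrite !mem_cat H orbT.
have L3 k : (k <= m3)%N -> z3 k \in L by move=> /(@vsP _ z3) H; rewrite !mem_cat H !orbT.
have LL v : v \in [:: x + e *: w1; x + e *: w2; x + e *: w3; at_pt x w1 w2 e (`|a| + 1) (- b);
      y + e' *: v1; y + e' *: v2; y + e' *: v3; at_pt y v1 v2 e' (`|a| + 1) (- b)] -> v \in L.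
  by move=> H; rewrite !mem_cat H !orbT.
have [ o [r [Ko gL]]] := generic_frame P L.
have cw : cross w1 w2 != 0 by apply: contraNneq c0 => ->; rewrite dotp0r.
have cu : cross v1 v2 = cross u1 u2 by rewrite v1E v2E; apply: vecP; rewrite /cross !coE; ring.
have cu0 : cross v1 v2 != 0 by rewrite cu; apply: contraNneq c0; rewrite cE => ->; rewrite dotp0r.
have ends m s z : shortest x y m s z -> z 0%N = x /\ z m = y by case=> _ [].
have [z10 z1m] := ends _ _ _ g1; have [z20 z2m] := ends _ _ _ g2; have [z30 z3m] := ends _ _ _ g3.
have Fx := local_fan xs nw1 nw2 cw w3E b0 A1 A2 A3 (etrans z1m (esym z2m)) (etrans z1m (esym z3m)) e0 eM eF
  Ko gL L1 L2 L3.
have Fy := local_fan ys nv1 nv2 cu0 u3E' b0 B1 B2 B3.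
rewrite !subnn z10 z20 z30 in Fy.
have Fy' := Fy erefl erefl e' e'0 e'M e'F o r L Ko gL (fun k _ => L1 _ (leq_subr k m1))
  (fun k _ => L2 _ (leq_subr k m2)) (fun k _ => L3 _ (leq_subr k m3)).
rewrite P1 P2 P3 in Fx; rewrite Q1 Q2 Q3 cu -cE in Fy'.
have X : (windo o r m1 z1 (x + e *: w3) - windo o r m2 z2 (x + e *: w3)) +
    (windo o r m2 z2 (x + e *: w1) - windo o r m3 z3 (x + e *: w1)) +
    (windo o r m3 z3 (x + e *: w2) - windo o r m1 z1 (x + e *: w2)) = - Num.sg (n i0 ∙ cross w1 w2).
  by apply: Fx; apply: LL; rewrite !in_cons eqxx ?orbT.
have wrev m z p : wind r m (fun k => z (m - k)%N - o) (p - o) = - windo o r m z p.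
  exact: (wind_rev r m (fun k => z k - o)).
have Y : - (windo o r m1 z1 (y + e' *: v3) - windo o r m2 z2 (y + e' *: v3)) -
    (windo o r m2 z2 (y + e' *: v1) - windo o r m3 z3 (y + e' *: v1)) -
    (windo o r m3 z3 (y + e' *: v2) - windo o r m1 z1 (y + e' *: v2)) = - Num.sg (n i0 ∙ cross w1 w2).
  rewrite -Fy' ?wrev; [ring| | | |]; by apply: LL; rewrite !in_cons eqxx ?orbT.
have [l1 q1x q1y] := arm_leg A1 w1n e0 er; have [l2 q2x q2y] := arm_leg A2 w2n e0 er.
have [l3 q3x q3y] := arm_leg A3 w3n e0 er.
have [k1 p1y p1x] := arm_leg B1 v1n e'0 er'; have [k2 p2y p2x] := arm_leg B2 v2n e'0 er'.
have [k3 p3y p3x] := arm_leg B3 v3n e'0 er'.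
have h1 := leg_rev m10 k1; have h2 := leg_rev m20 k2; have h3 := leg_rev m30 k3.
rewrite subnn z10 in p1x; rewrite subnn z20 in p2x; rewrite subnn z30 in p3x.
rewrite z1m in q1y; rewrite z2m in q2y; rewrite z3m in q3y.
have dis m s z m' s' z' : shortest x y m s z -> shortest x y m' s' z' -> dir z m.-1 <> dir z' m'.-1 ->
    forall k l u, (k < m)%N -> (l < m')%N -> leg z k u -> leg z' l u -> u = x \/ u = y.
  by move=> g g' ne k l u km lm lu lu'; exact: (shortest_disjoint Sx Sy xs ys g g' km lm lu lu' ne).
have u21 := nesym u12; have u31 := nesym u13; have u32 := nesym u23.
have W3 := wind_diff Sx Sy Ko gL t3 t1 t2 L3 L1 L2 (dis _ _ _ _ _ _ g3 g1 u31) (dis _ _ _ _ _ _ g3 g2 u32)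
  _ _ l3 h3 q3x q3y p3x p3y.
have W1 := wind_diff Sx Sy Ko gL t1 t2 t3 L1 L2 L3 (dis _ _ _ _ _ _ g1 g2 u12) (dis _ _ _ _ _ _ g1 g3 u13)
  _ _ l1 h1 q1x q1y p1x p1y.
have W2 := wind_diff Sx Sy Ko gL t2 t3 t1 L2 L3 L1 (dis _ _ _ _ _ _ g2 g3 u23) (dis _ _ _ _ _ _ g2 g1 u21)
  _ _ l2 h2 q2x q2y p2x p2y.
have in3 : [/\ x + e *: w1 \in L, x + e *: w2 \in L & x + e *: w3 \in L].
  by split; apply: LL; rewrite !in_cons eqxx ?orbT.
have in3' : [/\ y + e' *: v1 \in L, y + e' *: v2 \in L & y + e' *: v3 \in L].
  by split; apply: LL; rewrite !in_cons eqxx ?orbT.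
case: in3 in3' => i1 i2 i3 [i1' i2' i3'].
have W1' := W1 i1 i1'; have W2' := W2 i2 i2'; have W3' := W3 i3 i3'.
have : Num.sg (n i0 ∙ cross w1 w2) == 0 by apply/eqP; exact: opposite_sums X Y W3' W1' W2'.
by rewrite sgr_eq0 (negbTE c0).
Qed.

End Data.
End NoThree.

(** * Not every point has a partner at distance D *)

Section Equidistant.
Variables (R : realType) (P : polytope R).
Local Notation V := 'rV[R]_3.
Local Notation J := (facet P).
Local Notation n := (@normal R P).
Local Notation h := (@height R P).
Local Notation S := (surface P).
Local Notation dist := (@dist R P).
Local Notation shortest := (@shortest R P).
Local Notation seg := (@seg R P).
Local Notation tangent := (@tangent R P).
Implicit Types (o p q r u v w x y : V) (z : nat -> V) (i j : J) (s : nat -> J) (t : ctype P).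

Lemma seg_shortest x y j1 t w : S y -> simple_at y j1 -> seg x y t w ->
  exists m s z, [/\ shortest x y m s z, w = dir z 0, trT t (dir z m.-1) = w & n j1 ∙ dir z m.-1 = 0].
Proof.
move=> Sy ys [z [m [oz [mT g] cl zy ->]]]; have [[t0 _ [_ chT] z0 zT] _] := oz.
have [[m0 inj] ch nz _ _] := g; have zm : z m = y by apply: zy.
have sh : shortest x y m (tfac t) z by split.
have [_ tn] := shortest_last ys sh.
exists m, (tfac t), z; split => //.
rewrite (trT_tangent m0 mT chT zy) ?geodesic_dir// ?ltn_predL//.
  by rewrite (geodesic_dir g)// ltn_predL.
by move=> i iy; case: ys => _ H; rewrite (H _ iy).
Qed.

Variable D : R.
Hypotheses (D0 : 0 < D) (Dmax : forall x y, S x -> S y -> dist x y <= D)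
  (Dpartner : forall x, S x -> exists2 y, S y & dist x y = D).

Lemma no_equidistant : False.
Proof.
have [x [y [j0 [j1 [xi [eta [[Sx Sy] [xs ys] dxy [xi0 [nxi neta]] [[t1 [w1 [sg1 tx1]]] H]]]]]]]] :=
  moving_pair D0 Dmax Dpartner.
have xy : x != y.
  by apply/eqP => e; move: D0; rewrite -dxy e dist_xx// ltxx.
have xi0' : xi ∙ xi != 0 by rewrite dotp_eq0.
(* On the tangent plane at y, all these types induce the rotation B of [t1]. *)
have com t w zeta : seg x y t w -> trT t eta = xi -> n j1 ∙ zeta = 0 -> trT t zeta = trT t1 zeta.
  move=> sg tx nz; apply: (scalerI xi0').
  by rewrite (trT_unique Sy xs ys xy sg tx neta nz) (trT_unique Sy xs ys xy sg1 tx1 neta nz).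
have tng v : n j1 ∙ v = 0 -> tangent y v by move=> nv i iy; case: ys => _ F; rewrite (F _ iy).
have no := seg_no_opp sg1; have tl0 := seg_tlen sg1; have first := seg_first xs sg1.
have tl : ((tlen t1).-1 < tlen t1)%N by rewrite ltn_predL.
have last : tfac t1 (tlen t1).-1 = j1.
  have [z [m [[[_ _ [_ ch] _ zT] _] _ _ _ _]]] := sg1.
  by have [_ [_]] := ch _ tl; rewrite prednK// zT; case: ys => _ F; apply: F.
have Bn : trT t1 (n j1) = n j0 by rewrite /trT -{1}last (tr_normal no tl) first.
have Bc u v : trT t1 (cross u v) = cross (trT t1 u) (trT t1 v) by exact: (tr_cross _ _ no tl).
have Bd u v : trT t1 u ∙ trT t1 v = u ∙ v by exact: (tr_dot _ _ no tl).
have BD u v : trT t1 (u + v) = trT t1 u + trT t1 v by exact: trD.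
have BZ c v : trT t1 (c *: v) = c *: trT t1 v by exact: trZ.
have get t w : seg x y t w -> trT t eta = xi -> exists m s z, [/\ shortest x y m s z, w = dir z 0,
    trT t1 (dir z m.-1) = w & n j1 ∙ dir z m.-1 = 0].
  move=> sg tx; have [m [s [z [sh wE Bw nu]]]] := seg_shortest Sy ys sg.
  by exists m, s, z; split=> //; rewrite -(com t w).
have [m1 [s1 [z1 [g1 w1E Bu1 nu1]]]] := get _ _ sg1 tx1.
set u1 := dir z1 m1.-1 in Bu1 nu1.
have [_ w1n _] := shortest_first xs g1; rewrite -w1E in w1n.
have u1n : u1 ∙ u1 = 1 by rewrite -Bd Bu1.
have nc u : n j1 ∙ cross (n j1) u = 0 by rewrite dotpC cross_orthol.
have z0 : cross (n j1) u1 != 0.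
  by rewrite -dotp_eq0 cross_sqr normal1 u1n nu1 mulr1 expr0n subr0 oner_eq0.
(* A direction strictly on one side of w1, hence independent of it. *)
have [t2 [w2 [sg2 tx2]]] := H _ (tng _ (nc u1)) z0.
rewrite (com _ _ _ sg2 tx2 (nc u1)) Bc Bn Bu1 => neg2.
have [m2 [s2 [z2 [g2 w2E Bu2 nu2]]]] := get _ _ sg2 tx2.
set u2 := dir z2 m2.-1 in Bu2 nu2.
have c0 : n j0 ∙ cross w1 w2 < 0.
  rewrite (_ : _ ∙ _ = w2 ∙ cross (n j0) w1)//; by rewrite /cross !coE; ring.
have cE : n j0 ∙ cross w1 w2 = n j1 ∙ cross u1 u2 by rewrite -[RHS]Bd Bc Bn Bu1 Bu2.
have cu : cross u1 u2 != 0.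
  by apply/eqP => e; move: c0; rewrite cE e dotp0r ltxx.
have u120 : u1 + u2 != 0.
  rewrite addr_eq0; apply: contraNneq cu => ->; apply/eqP.
  by apply: vecP; rewrite /cross !coE; ring.
have nu12 : n j1 ∙ (u1 + u2) = 0 by rewrite dotpDr nu1 nu2 addr0.
(* A direction with w3 ∙ (w1 + w2) < 0, that is (a' + b') (1 + w1 ∙ w2) < 0, so one of the two
   coefficients is negative. *)
have [t3 [w3 [sg3 tx3]]] := H _ (tng _ nu12) u120.
rewrite (com _ _ _ sg3 tx3 nu12) BD Bu1 Bu2 => neg3.
have [m3 [s3 [z3 [g3 w3E Bu3 nu3]]]] := get _ _ sg3 tx3.
set u3 := dir z3 m3.-1 in Bu3 nu3.
have [_ w2n _] := shortest_first xs g2; rewrite -w2E in w2n.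
pose c := n j1 ∙ cross u1 u2; have cn0 : c != 0 by rewrite /c -cE lt_eqF.
pose a := triple (n j1) u3 u2 / c; pose b := triple (n j1) u1 u3 / c.
have [a' aE] : exists a', a' = a by exists a.
have [b' bE] : exists b', b' = b by exists b.
have u3E : u3 = a' *: u1 + b' *: u2.
  have := triple_expand (n j1) u1 u2 u3.
  have -> : triple (n j1) u1 u2 = c by rewrite /c /triple /cross !coE; ring.
  have -> : triple u3 u1 u2 = 0.
    have -> : triple u3 u1 u2 = u3 ∙ cross u1 u2 by rewrite /triple /cross !coE; ring.
    by rewrite (tangent_cross nu1 nu2) dotpZr (dotpC u3) nu3 mulr0.
  rewrite scale0r add0r => e; apply: (scalerI cn0); rewrite e scalerDr !scalerA aE bE /a /b.
  by rewrite ![c * _]mulrC !divfK.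
have w3E' : w3 = a' *: w1 + b' *: w2.
by rewrite -Bu3 u3E BD (BZ a') (BZ b') Bu1 Bu2.
have ab : a' + b' < 0.
  have c1 : 0 <= 1 + w1 ∙ w2.
    have := dotp_ge0 (w1 + w2); rewrite !dotE w1n w2n (dotpC w2 w1); lra.
  have : (a' + b') * (1 + w1 ∙ w2) < 0.
    move: neg3; rewrite w3E' !dotE w1n w2n (dotpC w2 w1); lra.
  move=> lt; rewrite ltNge; apply/negP => ge; have := mulr_ge0 ge c1; lra.
have u12 : u1 <> u2.
  move=> e; move/eqP: cu; apply; rewrite e; apply: vecP; rewrite /cross !coE; ring.
have u13 : u1 <> u3.
  move=> e; have : 1 *: u1 + 0 *: u2 = a' *: u1 + b' *: u2 by rewrite -u3E -e scale1r scale0r addr0.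
  move=> /(indep cu)[ea eb]; lra.
have u23 : u2 <> u3.
  move=> e; have : 0 *: u1 + 1 *: u2 = a' *: u1 + b' *: u2 by rewrite -u3E -e scale1r scale0r add0r.
  move=> /(indep cu)[ea eb]; lra.
rewrite w1E w2E in c0 cE; rewrite w1E w2E w3E in w3E'.
have [b0|b0] := ltP b' 0.
  by apply: (no_three_paths Sx Sy xs ys g1 g2 g3 _ cE w3E' u3E b0 u12 u13 u23); rewrite lt_eqF.
(* The roles of the first two paths are exchanged, which changes the sign of both cross products. *)
have a0 : a' < 0 by lra.
have sw u v : cross v u = - cross u v by apply: vecP; rewrite /cross !coE; ring.
apply: (no_three_paths Sx Sy xs ys g2 g1 g3 _ _ _ _ a0 (nesym u12) u23 u13).
- by rewrite sw dotpNr oppr_eq0 lt_eqF.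
- by rewrite sw dotpNr cE sw dotpNr opprK.
- by rewrite w3E' addrC.
- by rewrite -/u3 u3E addrC.
Qed.

End Equidistant.

(** * Diameter and radius *)

Section DiamRad.
Variables (R : realType) (P : polytope R).
Local Notation V := 'rV[R]_3.
Local Notation n := (@normal R P).
Local Notation h := (@height R P).
Local Notation S := (surface P).
Local Notation dist := (@dist R P).
Implicit Types (x y : V).

Lemma surface_two_points : exists x y, [/\ S x, S y & x != y].
Proof.
have e0 : vec 1 0 0 != 0 :> V.
  by apply/eqP => /(congr1 (@co0 R)) /eqP; rewrite !coE oner_eq0.
have [j _] := @normals_unbounded R P _ e0.
have [q jq hq] := irredundant j.
have Sq : S q.
  apply/surfaceP; split; last by exists j.
  by move=> i; have [->|/hq/ltW//] := eqVneq i j; rewrite jq.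
have [r r0 hr] := tangent_surface Sq.
have [t t0 [jt _]] := @perp2 R (n j) 0 (normal_neq0 j).
have et : 0 < enorm t by rewrite enorm_gt0.
exists q, (q + (r / (2 * enorm t)) *: t); split => //.
  apply: hr.
    rewrite enormZ ger0_norm; last by rewrite divr_ge0 ?mulr_ge0// ltW.
    have -> : r / (2 * enorm t) * enorm t = r / 2 by field; rewrite gt_eqF.
    by lra.
  move=> i iq; have [->|/hq] := eqVneq i j; first by rewrite dotpZr jt mulr0.
  by rewrite iq ltxx.
rewrite -subr_eq0 opprD addrA subrr add0r oppr_eq0 scaler_eq0 negb_or t0 andbT.
by rewrite gt_eqF// divr_gt0// mulr_gt0.
Qed.

Lemma farthest x : S x -> exists2 y, S y & forall y', S y' -> dist x y' <= dist x y.
Proof.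
move=> Sx; have ne : S !=set0 by exists x.
have [y yS hy] := compact_EVT_max ne (@surface_compact R P) (dist_continuous Sx).
by exists y => [|y' Sy']; [exact: set_mem|apply: hy; exact: mem_set].
Qed.

(** If the radius were at least D, every point would have a partner at distance D, against
    [no_equidistant]. *)
Lemma diam_rad : exists D r : R, [/\ intrinsic_diam S = D%:E, intrinsic_radius S = r%:E,
  0 < r < D, D <= 2 * r & (forall x y, S x -> S y -> dist x y <= D) /\
  forall x c, S x -> (forall y, S y -> dist x y <= c) -> r <= c].
Proof.
have [x0 [y0 [Sx0 Sy0 xy0]]] := surface_two_points.
have [C hC] := dist_ub P.
pose E : set R := [set dist p.1 p.2 | p in S `*` S].
have Eub : has_ubound E by exists C => _ [[x y] [/= Sx Sy] <-]; exact: hC.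
have E0 : E !=set0 by exists (dist x0 y0), (x0, y0).
have dD x y : S x -> S y -> dist x y <= sup E.
  by move=> Sx Sy; apply: ub_le_sup => //; exists (x, y).
have diamE : intrinsic_diam S = (sup E)%:E.
  rewrite -ereal_sup_EFin// /intrinsic_diam; congr ereal_sup.
  apply/seteqP; split=> [_ [[x y] [/= Sx Sy] <-]|_ [_ [[x y] [/= Sx Sy] <-] <-]].
    by exists (dist x y); [exists (x, y)|rewrite dist_fin].
  by exists (x, y) => //=; rewrite dist_fin.
(* The eccentricity of x; the default 0 is irrelevant on the surface, where the maximum is
   attained. *)
pose ecc x := xget 0 [set c : R | exists2 y, S y & c = dist x y /\ forall y', S y' -> dist x y' <= c].
have eccP x : S x -> exists2 y, S y & ecc x = dist x y /\ forall y', S y' -> dist x y' <= ecc x.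
  move=> Sx; have [y Sy hy] := farthest Sx.
  by apply: (@xgetPex _ 0 [set c : R | exists2 y, S y & c = dist x y /\ forall y', S y' -> dist x y' <= c]); exists (dist x y), y.
pose F : set R := [set ecc x | x in S].
have half x : S x -> sup E <= 2 * ecc x.
  move=> Sx; apply: ge_sup => // _ [[y z] [/= Sy Sz] <-].
  have [_ _ [_ H]] := eccP x Sx; have := H y Sy; have := H z Sz.
  have := dist_triangle Sy Sx Sz; rewrite (dist_sym Sx Sy); lra.
have Flb : has_lbound F by exists (sup E / 2) => _ [x Sx <-]; have := half x Sx; lra.
have F0 : F !=set0 by exists (ecc x0), x0.
have radE : intrinsic_radius S = (inf F)%:E.
  rewrite -ereal_inf_EFin// /intrinsic_radius; congr ereal_inf.
  have e x : S x -> ereal_sup [set intrinsic_dist S x y | y in S] = (ecc x)%:E.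
    move=> Sx; have [y Sy [ey H]] := eccP x Sx; apply/le_anti/andP; split.
      by apply: ge_ereal_sup => _ [z Sz <-]; rewrite dist_fin// lee_fin H.
    by apply: ereal_sup_ubound; exists y => //; rewrite dist_fin// ey.
  apply/seteqP; split=> [_ [x Sx <-]|_ [_ [x Sx <-] <-]].
    by exists (ecc x); [exists x|rewrite e].
  by exists x => //; rewrite e.
have D0 : 0 < sup E.
  apply: lt_le_trans (dD x0 y0 Sx0 Sy0); apply: lt_le_trans (dist_ge_enorm Sx0 Sy0).
  by rewrite enorm_gt0 subr_eq0.
have half' : sup E <= 2 * inf F.
  have : sup E / 2 <= inf F by apply: lb_le_inf => // _ [x Sx <-]; have := half x Sx; lra.
  lra.
exists (sup E), (inf F); split => //.
- apply/andP; split; first by lra.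
  rewrite ltNge; apply/negP => le; apply: (no_equidistant D0 dD) => x Sx.
  have [y Sy [ey H]] := eccP x Sx; exists y => //.
  apply/le_anti; rewrite dD//= -ey (le_trans le)//; apply: ge_inf => //; by exists x.
- split=> // x c Sx H; have [y Sy [ey _]] := eccP x Sx.
  by apply: (le_trans (y := ecc x)); [apply: ge_inf => //; exists x|rewrite ey H].
Qed.

Lemma ereal_ratio (D r : R) : r != 0 -> (D%:E / r%:E = (D / r)%:E)%E.
Proof. by move=> r0; rewrite inver (negbTE r0) -EFinM. Qed.

Lemma ratio_bounds : (1 < intrinsic_diam S / intrinsic_radius S <= 2%:E)%E.
Proof.
have [D [r [-> -> /andP[r0 rD] Dr _]]] := diam_rad.
rewrite ereal_ratio ?gt_eqF// lte_fin lee_fin.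
by rewrite ltr_pdivlMr// mul1r rD ler_pdivrMr.
Qed.

(** The radius is at most half of |a - b|, hence at most half of the diameter; the converse is the
    triangle inequality. *)
Lemma diam_eq_twice x a b : S x -> S a -> S b -> (forall y, S y -> dist x y <= enorm (a - b) / 2) ->
  (intrinsic_diam S = 2%:E * intrinsic_radius S)%E /\
  (intrinsic_diam S / intrinsic_radius S = 2%:E)%E.
Proof.
move=> Sx Sa Sb H; have [D [r [-> -> /andP[r0 rD] Dr [HD Hr]]]] := diam_rad.
have e : D = 2 * r.
  have := Hr x _ Sx H; have := HD a b Sa Sb; have := dist_ge_enorm Sa Sb; lra.
by rewrite ereal_ratio ?gt_eqF// e -EFinM mulfK// gt_eqF.
Qed.

End DiamRad.

Lemma hull_surface (R : realType) (I : finType) (v : I -> 'rV[R]_3) :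
  interior (convex_hull (range v)) !=set0 ->
  exists P : polytope R, body P = convex_hull (range v) /\ surface P = boundary (convex_hull (range v)).
Proof.
case=> o Ko; have [P PE] := hull_polytope Ko.
by exists P; rewrite /surface PE.
Qed.

Lemma polyhedron_ratio (R : realType) (P : set 'rV[R]_3) : convex_polyhedron P ->
  (1 < intrinsic_diam P / intrinsic_radius P <= 2%:E)%E.
Proof.
move=> [W [/finite_seqP[s ->] ne ->]].
have e : [set` s] = range (fun i : 'I_(size s) => nth 0 s i).
  apply/seteqP; split=> [x /= xs|_ [i _ <-]]; last exact: mem_nth.
  have xi : (index x s < size s)%N by rewrite index_mem.
  by exists (Ordinal xi) => //=; rewrite nth_index.
rewrite e in ne *; have [P' [_ <-]] := hull_surface ne.
exact: ratio_bounds.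
Qed.

(** * Tetrahedra *)

Lemma mem4 (i j k l m : 'I_4) : uniq [:: i; j; k; l] -> m \in [:: i; j; k; l].
Proof.
move=> u; have e : [:: i; j; k; l] =i 'I_4.
  by apply/subset_cardP; [rewrite (card_uniqP u) card_ord|exact: subset_predT].
by rewrite e.
Qed.

Lemma sum4 (W : nmodType) (i j k l : 'I_4) (F : 'I_4 -> W) : uniq [:: i; j; k; l] ->
  \sum_m F m = F i + F j + F k + F l.
Proof.
move=> u; rewrite (perm_big [:: i; j; k; l]) /=; last first.
  by apply: uniq_perm => //; [exact: index_enum_uniq|move=> m; rewrite mem_index_enum mem4].
by rewrite !big_cons big_nil addr0 !addrA.
Qed.

Section Tetra.
Variable R : realType.
Local Notation V := 'rV[R]_3.
Implicit Types (x y p q : V).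

Lemma convex_ball q (r : R) : @convex_set R V [set x | enorm (x - q) <= r].
Proof.
apply/convex_setE => x y t /andP[t0 t1] /= hx hy.
have -> : x + t *: (y - x) - q = (1 - t) *: (x - q) + t *: (y - q).
  by apply: vecP; rewrite !coV; ring.
apply: le_trans (enorm_triangle _ _) _; rewrite !enormZ !ger0_norm ?subr_ge0//.
have t1' : 0 <= 1 - t by rewrite subr_ge0.
have := ler_wpM2l t0 hy; have := ler_wpM2l t1' hx; lra.
Qed.

Variable v : 'I_4 -> V.
Local Notation K := (convex_hull (range v)).

Lemma hull_diam (L : R) : (forall k l, enorm (v k - v l) <= L) -> forall x y, K x -> K y -> enorm (x - y) <= L.
Proof.
move=> H x y Kx Ky.
have Hy k : enorm (y - v k) <= L.
  by apply: (convex_hull_min (@convex_ball (v k) L) _ Ky) => _ [l _ <-]; exact: H.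
by apply: (convex_hull_min (@convex_ball y L) _ Kx) => _ [l _ <-] /=; rewrite enormB.
Qed.

(* Barycentric coordinates, given as affine functionals. *)
Variables (u : 'I_4 -> V) (c : 'I_4 -> R).
Let lam i x := u i ∙ x + c i.
Hypotheses (lam_v : forall i k, lam i (v k) = (i == k)%:R)
  (lamE : forall x, x = \sum_i lam i x *: v i) (lam1 : forall x, \sum_i lam i x = 1).

Lemma lam_comb (l : 'I_4 -> R) i : \sum_k l k = 1 -> lam i (comb v l) = l i.
Proof.
move=> s1; rewrite /lam /comb.
have -> : u i ∙ (\sum_k l k *: v k) = \sum_k l k * (u i ∙ v k).
  elim/big_ind2 : _ => [|x a y b <- <-|k _]; first by rewrite dotp0r.
    by rewrite dotpDr.
  by rewrite dotpZr.
have -> : c i = \sum_k l k * c i by rewrite -mulr_suml s1 mul1r.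
rewrite -big_split /= (eq_bigr (fun k => l k * (i == k)%:R)) => [|k _]; last by rewrite -mulrDr -/(lam i (v k)) lam_v.
rewrite (bigD1 i)//= eqxx mulr1 big1 ?addr0// => k ki.
by rewrite eq_sym (negbTE ki) mulr0.
Qed.

Lemma hull_lam x : K x <-> forall i, 0 <= lam i x.
Proof.
split=> [/convex_hullE[l [l0 l1 ->]] i|H]; first by rewrite lam_comb.
by apply/convex_hullE; exists (fun i => lam i x); split=> //; exact: lamE.
Qed.

Lemma hull_interior x : (forall i, 0 < lam i x) -> interior K x.
Proof.
move=> H; have [d d0 hd] := fin_min H.
have m0 : 0 < 1 + \sum_i enorm (u i).
  by rewrite ltr_wpDr// sumr_ge0// => i _; exact: enorm_ge0.
apply/nbhs_enorm; exists (d / (1 + \sum_i enorm (u i))); first by rewrite divr_gt0.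
move=> y yx; apply/hull_lam => i.
have := cauchyN (u i) (y - x).
have : enorm (u i) <= 1 + \sum_i enorm (u i).
  rewrite (bigD1 i)//= addrCA lerDl addr_ge0// sumr_ge0// => k _; exact: enorm_ge0.
have := hd i; move: yx; rewrite ltr_pdivlMr// /lam dotpB.
have := enorm_ge0 (y - x); set E := enorm (y - x); set U := enorm (u i); set M := 1 + _.
move=> E0 EM dl UM cs; have := ler_wpM2l E0 UM; lra.
Qed.

Lemma hull_interior0 : interior K !=set0.
Proof.
exists (comb v (fun=> 4^-1)); apply: hull_interior => i.
rewrite lam_comb ?invr_gt0//.
by rewrite sumr_const card_ord -[LHS]mulr_natr mulVf ?pnatr_eq0.
Qed.

Lemma u_neq0 i : u i != 0.
Proof.
have [k ki] : exists k, k != i.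
  by exists (if i == ord0 then ord_max else ord0); case: ifPn => [/eqP ->|]; rewrite // eq_sym.
apply/eqP => e; have := lam_v i i; have := lam_v i k; rewrite /lam e !dotp0l eqxx eq_sym (negbTE ki) => ->.
by move=> /eqP; rewrite eq_sym oner_eq0.
Qed.

Variable P : polytope R.
Hypothesis PK : body P = K.
Local Notation S := (surface P).
Local Notation dist := (@dist R P).

Lemma lam_supports i : supports (body P) (- u i) (c i).
Proof.
split; first by rewrite oppr_eq0 u_neq0.
by move=> x; rewrite PK => /hull_lam/(_ i); rewrite /lam dotpNl; lra.
Qed.

Lemma surface_lam x : S x <-> K x /\ exists i, lam i x = 0.
Proof.
rewrite -PK; split=> [Sx|[Kx [i ix]]]; last first.
  apply: (supports_boundary (@body_compact R P) (lam_supports i)) => //.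
  by rewrite dotpNl; move: ix; rewrite /lam; lra.
have Kx := surface_body Sx; split=> //; apply: contrapT => H.
have [_] := proj1 (boundaryE (@body_compact R P) x) Sx; apply; rewrite PK; apply: hull_interior => i.
rewrite lt_def; apply/andP; split; first by apply/eqP => e; apply: H; exists i.
by move: Kx; rewrite PK => /hull_lam; apply.
Qed.

(** The facets of P come from a choice and are never matched with the faces of the tetrahedron:
    supporting planes are enough to project. *)
Lemma dist_lam i x y : K x -> K y -> lam i x = 0 -> lam i y = 0 -> dist x y <= enorm (x - y).
Proof.
rewrite -PK => Kx Ky ix iy; apply: dist_le; rewrite -{1}(prE Kx) -{1}(prE Ky).
have ge z : lam i z = 0 -> c i <= - u i ∙ z by rewrite /lam dotpNl; lra.
by apply: conn_halfspace (lam_supports i) (ge x ix) (ge y iy) _ => //; exact: body_convex.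
Qed.


Section Thick.
Variables (i j k l : 'I_4) (L : R).
Hypotheses (ijkl : uniq [:: i; j; k; l]) (LE : enorm (v i - v j) = L).
Let M := midpoint (v i) (v j).
Hypotheses (kM : enorm (v k - M) <= L / 6) (lM : enorm (v l - M) <= L / 6).

Let iM : enorm (v i - M) = L / 2.
Proof.
rewrite -LE /M /midpoint (_ : v i - _ = 2^-1 *: (v i - v j)).
  by rewrite enormZ ger0_norm ?invr_ge0// mulrC.
by apply: vecP; rewrite !coV; field.
Qed.

Let jM : enorm (v j - M) = L / 2.
Proof.
rewrite -LE /M /midpoint (_ : v j - _ = - 2^-1 *: (v i - v j)).
  by rewrite enormZ normrN ger0_norm ?invr_ge0// mulrC.
by apply: vecP; rewrite !coV; field.
Qed.

Let L0 : 0 <= L. Proof. by rewrite -LE enorm_ge0. Qed.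

Lemma lam_mid m : lam m M = 2^-1 * ((m == i)%:R + (m == j)%:R).
Proof.
have e1 := lam_v m i; have e2 := lam_v m j; by rewrite -e1 -e2 /lam /M /midpoint !dotE; lra.
Qed.

Lemma lam_conv m (a b : R) p q : a + b = 1 -> lam m (a *: p + b *: q) = a * lam m p + b * lam m q.
Proof.
by move=> s1; have -> : a = 1 - b; [lra|rewrite /lam !dotE; ring].
Qed.

Lemma hull_mid : K M.
Proof.
by apply/hull_lam => m; rewrite lam_mid mulr_ge0 ?invr_ge0// addr_ge0.
Qed.

Lemma hull_near x : K x -> enorm (x - M) <= L / 2.
Proof.
move=> Kx; apply: (convex_hull_min (@convex_ball M (L / 2)) _ Kx) => _ [m _ <-] /=.
have : m \in [:: i; j; k; l].
  exact: mem4.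
rewrite !inE => /or4P[] /eqP ->; rewrite ?iM ?jM//.
  by apply: le_trans kM _; have := L0; lra.
by apply: le_trans lM _; have := L0; lra.
Qed.


Lemma surface_mid : S M.
Proof.
apply/surface_lam; split; first exact: hull_mid.
exists k; rewrite lam_mid; move: ijkl; rewrite /= !inE !negb_or => /and4P[/and3P[_ ik _] /andP[jk _] _ _].
by rewrite eq_sym (negbTE ik) eq_sym (negbTE jk) addr0 mulr0.
Qed.

Lemma surface_vertex m : S (v m).
Proof.
apply/surface_lam; split; first by apply: sub_convex_hull; exists m.
have [m' mm'] : exists m', m' != m.
  by exists (if m == ord0 then ord_max else ord0); case: ifPn => [/eqP ->|]; rewrite // eq_sym.
by exists m'; rewrite lam_v (negbTE mm').
Qed.

(** The faces opposite to k and l contain the longest edge, hence M, and a straight segment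
    suffices. *)
Lemma dist_mid_face y : K y -> lam k y = 0 \/ lam l y = 0 -> dist M y <= L / 2.
Proof.
move=> Ky H; have [ik jk il jl] : [/\ k != i, k != j, l != i & l != j].
  move: ijkl; rewrite /= !inE !negb_or => /and4P[/and3P[_ ik il] /andP[jk jl] _ _].
  by rewrite !(eq_sym _ i) !(eq_sym _ j).
have [m mM my] : exists2 m, lam m M = 0 & lam m y = 0.
  case: H => H; [exists k|exists l] => //; rewrite lam_mid.
    by rewrite (negbTE ik) (negbTE jk) addr0 mulr0.
  by rewrite (negbTE il) (negbTE jl) addr0 mulr0.
apply: le_trans (dist_lam hull_mid Ky mM my) _.
by rewrite enormB hull_near.
Qed.

(* The path goes from M to the edge from v i to v k, then along a line parallel to
   the short edge. *)
Lemma dist_mid_end y : K y -> lam j y = 0 -> dist M y <= L / 2.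
Proof.
move=> Ky jy; have := lamE y; rewrite (sum4 _ ijkl) jy scale0r addr0.
have := lam1 y; rewrite (sum4 _ ijkl) jy addr0.
have Sy : S y by apply/surface_lam; split=> //; exists j.
have := proj1 (hull_lam y) Ky => y0; have := y0 i; have := y0 k; have := y0 l.
set a := lam i y; set b := lam k y; set d := lam l y => d0 b0 a0 s1 yE.
have [ik jk il jl] : [/\ k != i, k != j, l != i & l != j].
  move: ijkl; rewrite /= !inE !negb_or => /and4P[/and3P[_ ik il] /andP[jk jl] _ _].
  by rewrite !(eq_sym _ i) !(eq_sym _ j).
have [lk ji] : l != k /\ j != i.
  move: ijkl; rewrite /= !inE !negb_or => /and4P[/and3P[ij _ _] _ kl _].
  by rewrite !(eq_sym _ i) (eq_sym l).
(* The point of the edge from i to k reached from y in the direction from l to k. *)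
pose z := a *: v i + (b + d) *: v k.
have lz m : lam m z = a * (m == i)%:R + (b + d) * (m == k)%:R.
  by rewrite /z lam_conv ?lam_v// addrA.
have Kz : K z.
  by apply/hull_lam => m; rewrite lz addr_ge0// mulr_ge0// addr_ge0.
have Mz : dist M z <= a * (L / 2) + (b + d) * (L / 6).
  apply: le_trans (@dist_lam l _ _ hull_mid Kz _ _) _.
  - by rewrite lam_mid (negbTE il) (negbTE jl) addr0 mulr0.
  - by rewrite lz (negbTE il) (negbTE lk) !mulr0 addr0.
  rewrite enormB (_ : z - M = a *: (v i - M) + (b + d) *: (v k - M)).
    have bd0 : 0 <= b + d by rewrite addr_ge0.
    apply: le_trans (enorm_triangle _ _) _.
    rewrite !enormZ iM (ger0_norm a0) (ger0_norm bd0) lerD2l.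
    exact: ler_wpM2l.
  have -> : z - M = z - (a + b + d) *: M by rewrite s1 scale1r.
  by rewrite /z; move: M => M'; apply: vecP; rewrite !coV; ring.
have zy : dist z y <= d * (L / 3).
  apply: le_trans (@dist_lam j _ _ Kz Ky _ jy) _.
    by rewrite lz (negbTE ji) eq_sym (negbTE jk) !mulr0 addr0.
  rewrite yE (_ : z - _ = d *: (v k - v l)).
    rewrite enormZ ger0_norm//; apply: ler_wpM2l => //.
    apply: le_trans (enorm_dist3 (v k) M (v l)) _; rewrite (enormB M (v l)).
    by apply: le_trans (lerD kM lM) _; lra.
  by rewrite /z; apply: vecP; rewrite !coV; ring.
have Sz : S z.
  by apply/surface_lam; split=> //; exists j; rewrite lz (negbTE ji) eq_sym (negbTE jk) !mulr0 addr0.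
(* The total a L/2 + (b + d) L/6 + d L/3 is at most L/2 because a + b + d = 1 and 1/6 + 1/3 = 1/2,
   which is where the constant 6 comes from. *)
apply: le_trans (dist_triangle surface_mid Sz Sy) _.
have := mulr_ge0 b0 L0; have : a = 1 - b - d by lra.
move: Mz zy => /[swap] h1 /[swap] -> h2; move: h2 h1; nra.
Qed.

End Thick.

Lemma thick_diam i j k l : uniq [:: i; j; k; l] ->
  enorm (v k - midpoint (v i) (v j)) <= enorm (v i - v j) / 6 ->
  enorm (v l - midpoint (v i) (v j)) <= enorm (v i - v j) / 6 ->
  (intrinsic_diam S = 2%:E * intrinsic_radius S)%E /\
  (intrinsic_diam S / intrinsic_radius S = 2%:E)%E.
Proof.
move=> ijkl kM lM.
apply: (diam_eq_twice (surface_mid ijkl) (surface_vertex i) (surface_vertex j)) => y /surface_lam[Ky [m my]].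
have : m \in [:: i; j; k; l].
  exact: mem4.
have mC : midpoint (v j) (v i) = midpoint (v i) (v j) by rewrite /midpoint addrC.
have jikl : uniq [:: j; i; k; l].
  by move: ijkl => /=; rewrite !inE !negb_or (eq_sym j i) => /andP[/and3P[-> -> ->]] /andP[/andP[-> ->]].
rewrite !inE => /or4P[] /eqP e; rewrite e in my.
- rewrite -mC -(enormB (v j)) in kM lM *.
  by apply: (dist_mid_end jikl).
- exact: (dist_mid_end ijkl).
- by apply: (dist_mid_face ijkl) => //; left.
- by apply: (dist_mid_face ijkl) => //; right.
Qed.
End Tetra.

Section Barycentric.
Variable R : realType.
Local Notation V := 'rV[R]_3.

(** The columns of the inverse of the edge matrix give three coordinates; the one of vertex 0 is
    their complement to 1. *)
Lemma barycentric (v : 'I_4 -> V) : Defs.nondegenerate v -> exists (u : 'I_4 -> V) (c : 'I_4 -> R),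
  [/\ forall i k, u i ∙ v k + c i = (i == k)%:R,
      forall x, x = \sum_i (u i ∙ x + c i) *: v i & forall x, \sum_i (u i ∙ x + c i) = 1].
Proof.
rewrite /Defs.nondegenerate row_free_unit; set A := \matrix_(i < 3) _ => Au.
pose B := invmx A; pose U (m : 'I_3) : V := \row_k B k m; set o := v ord0.
have UE m x : U m ∙ x = (x *m B) ord0 m.
  by rewrite dotpC /dotp mxE; apply: eq_bigr => k _; rewrite mxE.
pose u i := if unlift ord0 i is Some m then U m else - \sum_m U m.
pose c i := if unlift ord0 i is Some m then - (U m ∙ o) else 1 + \sum_m (U m ∙ o).
have dS (F : 'I_3 -> V) x : (\sum_m F m) ∙ x = \sum_m (F m ∙ x).
  by elim/big_ind2 : _ => [|a b a' b' <- <-|//]; rewrite ?dotp0l ?dotpDl.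
have lamS m x : u (lift ord0 m) ∙ x + c (lift ord0 m) = ((x - o) *m B) ord0 m.
  by rewrite /u /c liftK -UE dotpDr dotpNr.
have lam0 x : u ord0 ∙ x + c ord0 = 1 - \sum_m ((x - o) *m B) ord0 m.
  have -> : \sum_m ((x - o) *m B) ord0 m = \sum_m U m ∙ x - \sum_m U m ∙ o.
    by rewrite -sumrB; apply: eq_bigr => m _; rewrite -UE dotpDr dotpNr.
  by rewrite /u /c unlift_none dotpNl dS; ring.
exists u, c; split.
- move=> i k; have row k' : (v (lift ord0 k') - o) *m B = delta_mx ord0 k'.
    rewrite -(rowK (fun i : 'I_3 => v (lift ord0 i) - o) k') -/A -row_mul mulmxV//.
    by rewrite row1.
  have e m : ((v k - o) *m B) ord0 m = (lift ord0 m == k)%:R.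
    case: (unliftP ord0 k) => [k' ->|->]; last by rewrite subrr mul0mx mxE.
    by rewrite row mxE eqxx (inj_eq lift_inj) eq_sym.
  case: (unliftP ord0 i) => [m ->|->]; first by rewrite lamS e.
  rewrite lam0 (eq_bigr _ (fun m _ => e m)).
  case: (unliftP ord0 k) => [k' ->|->]; last by rewrite big1 ?subr0.
  rewrite (bigD1 k')//= eqxx big1 ?addr0 ?subrr// => m mk.
  by rewrite (inj_eq lift_inj) (negbTE mk).
- move=> x; rewrite big_ord_recl lam0 scalerBl scale1r.
  rewrite (eq_bigr (fun m => ((x - o) *m B) ord0 m *: row m A + ((x - o) *m B) ord0 m *: o)); last first.
    by move=> m _; rewrite lamS -scalerDr rowK subrK.
  rewrite big_split /= -mulmx_sum_row mulmxKV// -scaler_suml -/o.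
  by rewrite addrACA addNr addr0 addrC subrK.
move=> x; rewrite big_ord_recl lam0 (eq_bigr _ (fun m _ => lamS m x)).
by rewrite subrK.
Qed.

Lemma thick_surface (v : 'I_4 -> V) (eps : R) : 0 < eps <= 6^-1 -> thick_tetrahedron eps v ->
  (intrinsic_diam (tetra_surface v) = 2%:E * intrinsic_radius (tetra_surface v))%E.
Proof.
move=> /andP[e0 e6] [/barycentric[u [c [lv lE l1]]] [i [j [[ij lng] [k [l [kl thick]]]]]]].
have [P [PK PS]] := hull_surface (hull_interior0 lv lE l1).
rewrite /tetra_surface -PS in thick *.
set L := enorm (v i - v j) in lng.
have L0 : 0 < L.
  rewrite enorm_gt0 subr_eq0; apply/eqP => e; have := lv i i; rewrite e lv (negbTE ij) eqxx.
  by move/eqP; rewrite eq_sym oner_eq0.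
(* The extrinsic diameter is at most L, the largest distance between vertices. *)
have near x : convex_hull [set v k; v l] x -> enorm (x - midpoint (v i) (v j)) <= eps * L.
  move=> /thick h; rewrite -lee_fin EFinM (le_trans h)// lee_wpmul2l ?lee_fin ?(ltW e0)//.
  apply: ge_ereal_sup => _ [[y z] [/= Sy Sz] <-]; rewrite lee_fin.
  by apply: (hull_diam lng); rewrite -PK; exact: surface_body.
have vk := near (v k) (sub_convex_hull (or_introl erefl)).
have vl := near (v l) (sub_convex_hull (or_intror erefl)).
have iM : enorm (v i - midpoint (v i) (v j)) = L / 2.
  rewrite /midpoint (_ : v i - _ = 2^-1 *: (v i - v j)).
    by rewrite enormZ ger0_norm ?invr_ge0// mulrC.
  by apply: vecP; rewrite !coV; field.
have jM : enorm (v j - midpoint (v i) (v j)) = L / 2.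
  rewrite /midpoint (_ : v j - _ = - 2^-1 *: (v i - v j)).
    by rewrite enormZ normrN ger0_norm ?invr_ge0// mulrC.
  by apply: vecP; rewrite !coV; field.
have eL : eps * L <= L / 6 by rewrite mulrC ler_pM2l.
(* The ends of the longest edge are at distance L/2 > L/6 from its midpoint, so the edge near the
   midpoint is the opposite one. *)
have far m : enorm (v m - midpoint (v i) (v j)) <= eps * L -> i != m /\ j != m.
  by move=> h; split; apply/eqP => e; move: h; rewrite -e ?iM ?jM; lra.
have [ik jk] := far k vk; have [il jl] := far l vl.
have u4 : uniq [:: i; j; k; l] by rewrite /= !inE !negb_or ij ik il jk jl kl.
by have [] := thick_diam lv lE l1 PK u4 (le_trans vk eL) (le_trans vl eL).
Qed.

Lemma ratio_two : exists P : set V, convex_polyhedron P /\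
  (intrinsic_diam P / intrinsic_radius P = 2%:E)%E.
Proof.
(* The longest edge has length 2 and midpoint 0, and the other two vertices are at distance sqrt 2 /
   6 < 2 / 6 from it; u and c are the barycentric coordinates. *)
pose v (i : 'I_4) : V := [:: vec (-1) 0 0; vec 1 0 0; vec 0 6^-1 6^-1; vec 0 (- 6^-1) 6^-1]`_i.
pose u (i : 'I_4) : V := [:: vec (- 2^-1) 0 (- 3); vec 2^-1 0 (- 3); vec 0 3 3; vec 0 (- 3) 3]`_i.
pose c (i : 'I_4) : R := [:: 2^-1; 2^-1; 0; 0]`_i.
have lv i k : u i ∙ v k + c i = (i == k)%:R.
  by case: i => [[|[|[|[|//]]]] ?]; case: k => [[|[|[|[|//]]]] ?];
    rewrite /u /v /c /= !coE; field.
have lE x : x = \sum_i (u i ∙ x + c i) *: v i.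
  by rewrite !big_ord_recl big_ord0 /u /v /c /=; apply: vecP; rewrite !coE; field.
have l1 x : \sum_i (u i ∙ x + c i) = 1.
  by rewrite !big_ord_recl big_ord0 /u /v /c /= !coE; field.
have ne := hull_interior0 lv lE l1; have [P [PK PS]] := hull_surface ne.
exists (surface P); split.
  exists (range v); split => //; apply: finite_image; exact: finite_finset.
have e2 : enorm (v (inord 0) - v (inord 1)) = 2.
  rewrite /v !inordK//= /enorm (_ : dotp _ _ = 2 ^+ 2) ?sqrtr_sqr ?ger0_norm//.
  by rewrite !coE; ring.
have near k : k = inord 2 \/ k = inord 3 ->
    enorm (v k - midpoint (v (inord 0)) (v (inord 1))) <= enorm (v (inord 0) - v (inord 1)) / 6.
  rewrite e2 => H; apply: enorm_le => //.
  by case: H => ->; rewrite /v /midpoint !inordK//= !coE; lra.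
have u4 : uniq [:: inord 0 : 'I_4; inord 1; inord 2; inord 3].
  by rewrite /= !inE -!val_eqE /= !inordK.
by have [] := thick_diam lv lE l1 PK u4 (near _ (or_introl erefl)) (near _ (or_intror erefl)).
Qed.
End Barycentric.

Theorem proposition2 (R : realType) :
  (forall P : set 'rV[R]_3, convex_polyhedron P ->
     (1 < intrinsic_diam P / intrinsic_radius P <= 2%:E)%E)
  /\ (exists P : set 'rV[R]_3, convex_polyhedron P /\
        (intrinsic_diam P / intrinsic_radius P = 2%:E)%E)
  /\ (exists eps0 : R, 0 < eps0 /\
        forall eps : R, 0 < eps < eps0 ->
        forall v : 'I_4 -> 'rV[R]_3, normal_thick_tetrahedron eps v ->
          (intrinsic_diam (tetra_surface v)
             = 2%:E * intrinsic_radius (tetra_surface v))%E).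
Proof.
split; first exact: polyhedron_ratio.
split; first exact: ratio_two.
exists 6^-1; split => [|eps /andP[e0 e6] v [th _]]; first by rewrite invr_gt0.
by apply: (thick_surface _ th); rewrite e0 ltW.
Qed.
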